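(* Let $b$ be a non-extreme point of the closed unit ball of $H^\infty$ and let $\mathcal H(b)$ be the de Branges–Rovnyak space with kernel $K(z,w)=\frac{1-b(z)\overline{b(w)}}{1-z\overline w}$ on the unit disk. For $\alpha\ge0$ and $h\in\mathcal H(b)$ with Taylor coefficients $\hat h(j)$, let $\sigma_n^\alpha(h):=\sum_{j=0}^n\binom{n}{j}\big/\binom{n+\alpha}{j}\,\hat h(j)z^j$. If $\sigma_n^\alpha(h)\to h$ (weakly or in norm) in $\mathcal H(b)$ for all $h\in\mathcal H(b)$, then \[ \|z^j\|_{\mathcal H(b)}=O(j^\alpha)\quad(j\to\infty). \]
   Context: $H^\infty$ is the space of bounded holomorphic functions on the unit disk with sup-norm; $b$ non-extreme in its unit ball means equivalently $\log(1-|b|^2)\in L^1(\mathbb T)$, in which case $\mathcal H(b)$ contains the polynomials. Binomial coefficients with non-integer arguments are defined via the Gamma function. *)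

(* Defs.v *)
(* MathComp + MathComp-Analysis; complex numbers R[i] from mathcomp-real-closed. *)
From HB Require Import structures.
From mathcomp Require Import all_boot all_order all_algebra.
From mathcomp Require Import all_classical all_reals all_analysis.
From mathcomp Require Import complex.
Import Order.TTheory GRing.Theory Num.Theory.

Set Implicit Arguments.
Unset Strict Implicit.
Unset Printing Implicit Defensive.

Import numFieldNormedType.Exports.
Local Open Scope classical_set_scope.
Local Open Scope ring_scope.

Section DeBrangesRovnyak.
Variable R : realType.
Local Notation C := (R[i]).

(* modulus of a complex number *)
Definition normc (z : C) : R :=
  Num.sqrt (complex.Re z ^+ 2 + complex.Im z ^+ 2).

(* the open unit disk *)
Definition disk : Type := { z : C | normc z < 1 }.

(* convergence of a complex sequence *)
Definition cconv (u : nat -> C) (l : C) : Prop :=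
  (fun n => normc (u n - l)) @ \oo --> (0 : R).

(* complex differentiability at every point of the disk *)
Definition holomorphic_disk (f : disk -> C) : Prop :=
  forall z : disk, exists l : C, forall e : R, 0 < e ->
    exists d : R, 0 < d /\
      forall w : disk, 0 < normc (sval w - sval z) < d ->
        normc ((f w - f z) / (sval w - sval z) - l) < e.

(* the closed unit ball of H^infty *)
Definition Hinf_ball (b : disk -> C) : Prop :=
  holomorphic_disk b /\ forall z : disk, normc (b z) <= 1.

(* b is a non-extreme point of the closed unit ball of H^infty *)
Definition non_extreme (b : disk -> C) : Prop :=
  Hinf_ball b /\
  exists b1 b2 : disk -> C, [/\ Hinf_ball b1, Hinf_ball b2, b1 <> b2 &
    forall z, b z = (b1 z + b2 z) / 2].

(* the de Branges-Rovnyak kernel *)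
Definition dBR_kernel (b : disk -> C) (z w : disk) : C :=
  (1 - b z * (b w)^*) / (1 - sval z * (sval w)^*).

(* norm induced by a (sesquilinear) inner product *)
Definition hnorm (ip : (disk -> C) -> (disk -> C) -> C) (f : disk -> C) : R :=
  Num.sqrt (complex.Re (ip f f)).

(* (H, ip) is the reproducing kernel Hilbert space of functions on the disk
   with reproducing kernel K: a complete inner-product space of functions,
   containing every K(., w), with <f, K(., w)> = f(w). *)
Definition is_RKHS (K : disk -> disk -> C) (H : (disk -> C) -> Prop)
    (ip : (disk -> C) -> (disk -> C) -> C) : Prop :=
  (forall (a : C) f g, H f -> H g -> H (fun z => a * f z + g z)) /\
  (forall (a : C) f g k, H f -> H g -> H k ->
      ip (fun z => a * f z + g z) k = a * ip f k + ip g k) /\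
  (forall f g, H f -> H g -> ip g f = (ip f g)^*) /\
  (forall f, H f -> 0 <= ip f f) /\
  (forall f, H f -> ip f f = 0 -> f = (fun _ => 0)) /\
  (forall u : nat -> disk -> C, (forall n, H (u n)) ->
     (forall e : R, 0 < e -> exists N, forall m n, (N <= m)%N -> (N <= n)%N ->
        hnorm ip (fun z => u m z - u n z) < e) ->
     exists f, H f /\ (fun n => hnorm ip (fun z => u n z - f z)) @ \oo --> (0 : R)) /\
  (forall w, H (fun z => K z w)) /\
  (forall f w, H f -> ip f (fun z => K z w) = f w).

(* a is the sequence of Taylor coefficients of f on the disk *)
Definition power_series_rep (f : disk -> C) (a : nat -> C) : Prop :=
  forall z : disk, cconv (fun n => \sum_(k < n) a k * (sval z) ^+ k) (f z).

(* Taylor coefficients hat f (j) (0 if f has no power series expansion) *)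
Definition taylor_coef (f : disk -> C) : nat -> C :=
  match pselect (exists a, power_series_rep f a) with
  | left P => projT1 (cid P)
  | right _ => fun _ => 0
  end.

(* generalized binomial coefficient binom(x, j) = x(x-1)...(x-j+1)/j!
   (= Gamma(x+1)/(Gamma(j+1) Gamma(x-j+1)) whenever defined) *)
Definition dbr_binom (x : R) (j : nat) : R :=
  (\prod_(i < j) (x - i%:R)) / (j`!)%:R.

(* Cesaro means sigma_n^alpha(h) *)
Definition dbr_sigma (alpha : R) (n : nat) (h : disk -> C) : disk -> C :=
  fun z => \sum_(j < n.+1)
    real_complex R (dbr_binom n%:R j / dbr_binom (n%:R + alpha) j)
      * taylor_coef h j * (sval z) ^+ j.

(* the dbr_monomial z^j on the disk *)
Definition dbr_monomial (j : nat) : disk -> C := fun z => (sval z) ^+ j.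

End DeBrangesRovnyak.

(* Main.v *)
(* Non-extremality gives c <> 0 holomorphic with |b|^2 + |c|^2 <= 1 on the disk. Hence
   |c f|^2 <= |f|^2 - |b f|^2 in H^2, i.e. 1 - T_b T_b^* >= T_c^* T_c, so the Toeplitz operator with
   symbol conj(c) maps the unit ball of H^2 into that of H(b). Applied to z^m it gives polynomials
   q_m of degree m - k and H(b)-norm at most 1, all with the same leading coefficient conj(c_k),
   where k is the order of vanishing of c at 0; in particular H(b) contains the polynomials.
   By uniform boundedness the Cesaro means of a fixed h are bounded, and inverting the means
   bounds the norm of the n-th Taylor term of h by a constant times A_n = O(n^alpha); by uniform
   boundedness again the constant is linear in the norm of h. Taking h = q_(n+k) concludes.

   Pointwise complex differentiability is turned into power series by Goursat's lemma. *)

Require Import Defs.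
From HB Require Import structures.
From mathcomp Require Import all_boot all_order all_algebra.
From mathcomp Require Import all_classical all_reals all_analysis.
From mathcomp Require Import complex ring lra.
Import Order.TTheory GRing.Theory Num.Theory.
Local Open Scope ring_scope.

Set Implicit Arguments.
Unset Strict Implicit.
Unset Printing Implicit Defensive.

Import numFieldNormedType.Exports.

(** The space [H] is known only through its kernel. Membership with a norm bound is therefore tested
    against finite combinations of kernels, and the operator inequality becomes an inequality
    between finite sums, obtained as the mean over the circle of a sum of squares. No Hardy space is
    built: [b] and [c] are dilated by a factor [s < 1], which makes them bounded on the circle, and
    [s] tends to 1 only in the finite sums. The function [c] is half the difference of two points of
    the unit ball whose midpoint is [b]. The Cesaro weights are [A (n - j) / A n], where [A n] are
    the coefficients of [(1 - x)^(-alpha-1)]. The means are inverted by convolution with the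
    coefficients of [(1 - x)^(alpha+1)], which are absolutely summable because [alpha >= 0]; this is
    why the inversion costs no more than the factor [A n]. *)

Section Modulus.
Variable R : realType.
Local Notation C := R[i].
Local Notation nc := (@Defs.normc R).
Local Notation toC := (real_complex R).
Implicit Types (z w : C) (x : R).

Lemma ncE z : toC (nc z) = `|z|.
Proof. by rewrite normc_def. Qed.
Lemma nc_ge0 z : 0 <= nc z. Proof. exact: sqrtr_ge0. Qed.
Lemma nc0 : nc 0 = 0.
Proof. by apply: complexI; rewrite ncE normr0. Qed.
Lemma nc1 : nc 1 = 1.
Proof. by apply: complexI; rewrite ncE normr1. Qed.
Lemma ncM z w : nc (z * w) = nc z * nc w.
Proof. by apply: complexI; rewrite rmorphM /= !ncE normrM. Qed.
Lemma ncV z : nc z^-1 = (nc z)^-1.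
Proof. by apply: complexI; rewrite fmorphV /= !ncE normfV. Qed.
Lemma ncX z n : nc (z ^+ n) = nc z ^+ n.
Proof. by apply: complexI; rewrite rmorphXn /= !ncE normrX. Qed.
Lemma ncN z : nc (- z) = nc z.
Proof. by apply: complexI; rewrite !ncE normrN. Qed.
Lemma ncB z w : nc (z - w) = nc (w - z).
Proof. by rewrite -ncN opprB. Qed.
Lemma nc_conj z : nc z^* = nc z.
Proof. by apply: complexI; rewrite !ncE norm_conjC. Qed.
Lemma ncD z w : nc (z + w) <= nc z + nc w.
Proof. by rewrite -lecR rmorphD /= !ncE ler_normD. Qed.
Lemma ncBD z w : nc (z - w) <= nc z + nc w.
Proof. by rewrite -(ncN w) ncD. Qed.
Lemma nc_trans u z w : nc (z - w) <= nc (z - u) + nc (u - w).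
Proof. by apply: le_trans (ncD _ _); rewrite addrA subrK. Qed.
Lemma nc_eq0 z : nc z = 0 -> z = 0.
Proof. by move=> h; apply/eqP; rewrite -normr_eq0 -ncE h. Qed.
Lemma nc_gt0 z : z != 0 -> 0 < nc z.
Proof.
by move=> h; rewrite lt_def nc_ge0 andbT; apply: contraNneq h => /nc_eq0 ->.
Qed.
Lemma nc_real x : nc (toC x) = `|x|.
Proof. by rewrite /Defs.normc /= expr0n addr0 sqrtr_sqr. Qed.
Lemma nc_nat n : nc n%:R = n%:R.
Proof. by rewrite -(rmorph_nat toC) nc_real ger0_norm. Qed.
Lemma nc_sum (I : Type) (r : seq I) (P : pred I) (F : I -> C) :
  nc (\sum_(i <- r | P i) F i) <= \sum_(i <- r | P i) nc (F i).
Proof.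
elim/big_ind2: _ => [|a b c d h1 h2|i _]; rewrite ?nc0 //.
by apply: le_trans (ncD _ _) _; apply: lerD.
Qed.
Lemma nc_Re z : `|complex.Re z| <= nc z.
Proof.
case: z => a b; rewrite /Defs.normc /= -(sqrtr_sqr a) ler_sqrt; last first.
  by rewrite addr_ge0 ?sqr_ge0.
by rewrite lerDl sqr_ge0.
Qed.
Lemma nc_Im z : `|complex.Im z| <= nc z.
Proof.
case: z => a b; rewrite /Defs.normc /= -(sqrtr_sqr b) ler_sqrt; last first.
  by rewrite addr_ge0 ?sqr_ge0.
by rewrite lerDr sqr_ge0.
Qed.
Lemma nc_ReIm z : nc z <= `|complex.Re z| + `|complex.Im z|.
Proof.
case: z => a b; rewrite -[_ + _]ger0_norm ?addr_ge0 // -sqrtr_sqr ler_sqrt ?sqr_ge0 //=.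
rewrite sqrrD !real_normK ?num_real // lerD2r lerDl mulrn_wge0 //.
Qed.
Lemma nc_sqr z : toC (nc z ^+ 2) = z * z^*.
Proof. by rewrite rmorphXn /= ncE normCK. Qed.
Lemma nc_sqrE z : nc z ^+ 2 = complex.Re z ^+ 2 + complex.Im z ^+ 2.
Proof. by rewrite /Defs.normc sqr_sqrtr // addr_ge0 ?sqr_ge0. Qed.
Lemma nc_lerB z w : nc z - nc w <= nc (z - w).
Proof. by rewrite lerBlDr; apply: le_trans (ncD _ _); rewrite subrK. Qed.
Lemma ReD z w : complex.Re (z + w) = complex.Re z + complex.Re w.
Proof. by case: z; case: w. Qed.
Lemma ReN z : complex.Re (- z) = - complex.Re z.
Proof. by case: z. Qed.
Lemma ImD z w : complex.Im (z + w) = complex.Im z + complex.Im w.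
Proof. by case: z; case: w. Qed.
Lemma ImN z : complex.Im (- z) = - complex.Im z.
Proof. by case: z. Qed.
Lemma ReZ x z : complex.Re (toC x * z) = x * complex.Re z.
Proof. by case: z => a b /=; rewrite mul0r subr0. Qed.
Lemma ImZ x z : complex.Im (toC x * z) = x * complex.Im z.
Proof. by case: z => a b /=; rewrite mul0r addr0. Qed.
Lemma cRe_conj z : complex.Re z^* = complex.Re z.
Proof. by case: z. Qed.
Lemma real_eps0 (x M : R) : 0 <= M -> (forall e, 0 < e -> x <= M * e) -> x <= 0.
Proof.
move=> M0 h; apply/ler_addgt0Pr => e e0; rewrite add0r.
have [M1|] := ltP 0 M; last first.
  move=> M1; apply: le_trans (h _ ltr01) _; rewrite mulr1.
  exact: le_trans M1 (ltW e0).
by have := h (e / M) (divr_gt0 e0 M1); rewrite mulrC divfK // gt_eqF.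
Qed.

End Modulus.

(** * Limits of complex sequences and dyadic Cauchy sequences *)

Section Convergence.
Variable R : realType.
Local Notation C := R[i].
Local Notation nc := (@Defs.normc R).
Local Notation toC := (real_complex R).

Lemma cconvP (u : nat -> C) (l : C) :
  cconv u l <-> forall e : R, 0 < e -> exists N, forall n, (N <= n)%N -> nc (u n - l) < e.
Proof.
split.
  move=> /cvgrPdist_lt h e e0; have [N _ hN] := h e e0.
  exists N => n /hN /=; rewrite sub0r normrN ger0_norm //; exact: nc_ge0.
move=> h; apply/cvgrPdist_lt => e e0; have [N hN] := h e e0.
exists N => // n /= /hN; rewrite sub0r normrN ger0_norm //; exact: nc_ge0.
Qed.

Lemma cconv_unique (u : nat -> C) (l m : C) : cconv u l -> cconv u m -> l = m.
Proof.
move=> /cconvP hl /cconvP hm; apply/eqP; rewrite -subr_eq0; apply/eqP/nc_eq0.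
apply/eqP; rewrite eq_le nc_ge0 andbT; apply: (@real_eps0 R _ 2) => // e e0.
have [N1 h1] := hl e e0; have [N2 h2] := hm e e0.
have := h1 _ (leq_maxl N1 N2); have := h2 _ (leq_maxr N1 N2).
set n := maxn _ _ => a b; apply: le_trans (nc_trans (u n) _ _) _.
rewrite ncB; lra.
Qed.

Lemma cconv_ext (u v : nat -> C) (l : C) : u =1 v -> cconv u l -> cconv v l.
Proof. by move=> /funext ->. Qed.

Lemma cconv_cst (l : C) : cconv (fun=> l) l.
Proof. by apply/cconvP => e e0; exists 0%N => n _; rewrite subrr nc0. Qed.

Lemma cconv_bounded (u : nat -> C) (l : C) : cconv u l -> exists M, forall n, nc (u n) <= M.
Proof.
move=> /cconvP /(_ 1 ltr01) [N hN].
exists (\sum_(i < N) nc (u i) + (nc l + 1)) => n.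
have s0 : 0 <= \sum_(i < N) nc (u i) by apply: sumr_ge0 => i _; exact: nc_ge0.
have [/hN h|lt] := leqP N n.
  have := nc_lerB (u n) l; lra.
rewrite (bigD1 (Ordinal lt)) //= -addrA lerDl; apply: addr_ge0.
  by apply: sumr_ge0 => i _; exact: nc_ge0.
by rewrite addr_ge0 ?nc_ge0.
Qed.

Lemma half_pow_small (M e : R) : 0 < e -> exists n, M / 2 ^+ n < e.
Proof.
move=> e0; have [M0|M0] := leP M 0.
  by exists 0%N; rewrite expr0 divr1; apply: le_lt_trans e0.
exists (Num.bound (M / e)).
rewrite ltr_pdivrMr ?exprn_gt0 // mulrC -ltr_pdivrMr //.
apply: lt_trans (archi_boundP _) _; first by rewrite divr_ge0 // ltW.
by rewrite -natrX ltr_nat ltn_expl.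
Qed.

Lemma nested_intervals (u v : nat -> R) :
  (forall n, u n <= u n.+1) -> (forall n, v n.+1 <= v n) -> (forall n, u n <= v n) ->
  exists l, forall n, u n <= l <= v n.
Proof.
move=> hu hv huv.
have mu n m : u n <= u (n + m)%N.
  by elim: m => [|m IH]; rewrite ?addn0 // addnS (le_trans IH).
have mv n m : v (n + m)%N <= v n.
  by elim: m => [|m IH]; rewrite ?addn0 // addnS (le_trans _ IH).
have key n m : u m <= v n.
  have [le|/ltnW le] := leqP n m.
    by apply: le_trans (huv m) _; rewrite -(subnKC le).
  by apply: le_trans (huv n); rewrite -(subnKC le).
have S0 : has_sup [set u m | m in [set: nat]]%classic.
  by split; [exists (u 0%N), 0%N|exists (v 0%N) => _ [m _ <-]].
exists (sup [set u m | m in [set: nat]]%classic) => n; apply/andP; split.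
  by apply: ub_le_sup; [case: S0|exists n].
by apply: ge_sup; [case: S0|move=> _ [m _ <-]].
Qed.

(** The increments from [n] on sum to at most [2 * M / 2 ^+ n], so the closed intervals of that
    radius about [a n] are nested. *)
Lemma real_dyadic_limit (a : nat -> R) (M : R) :
  (forall n, `|a n.+1 - a n| <= M / 2 ^+ n) ->
  exists l, forall n, `|a n - l| <= M * 2 / 2 ^+ n.
Proof.
move=> h.
have M0 : 0 <= M by have := le_trans (normr_ge0 _) (h 0%N); rewrite expr0 divr1.
have e2 n : M * 2 / 2 ^+ n.+1 = M / 2 ^+ n.
  by rewrite exprS invfM mulrA -(mulrA M) divff ?mulr1.
have e3 n : M * 2 / 2 ^+ n = M / 2 ^+ n + M / 2 ^+ n by rewrite mulrAC mulr_natr mulr2n.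
have [||n|l hl] := @nested_intervals (fun n => a n - M * 2 / 2 ^+ n) (fun n => a n + M * 2 / 2 ^+ n).
- by move=> n; rewrite e2 e3; have := h n; rewrite ler_norml => /andP[]; lra.
- by move=> n; rewrite e2 e3; have := h n; rewrite ler_norml => /andP[]; lra.
- have : 0 <= M * 2 / 2 ^+ n by rewrite divr_ge0 ?exprn_ge0 // mulr_ge0.
  lra.
by exists l => n; rewrite ler_distlC.
Qed.

Lemma complex_dyadic_limit (a : nat -> C) (M : R) :
  (forall n, nc (a n.+1 - a n) <= M / 2 ^+ n) ->
  exists l, forall n, nc (a n - l) <= M * 4 / 2 ^+ n.
Proof.
move=> h.
have [x hx] : exists l, forall n, `|complex.Re (a n) - l| <= M * 2 / 2 ^+ n.
  apply: real_dyadic_limit => n; apply: le_trans (h n).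
  by rewrite -ReN -ReD; exact: nc_Re.
have [y hy] : exists l, forall n, `|complex.Im (a n) - l| <= M * 2 / 2 ^+ n.
  apply: real_dyadic_limit => n; apply: le_trans (h n).
  by rewrite -ImN -ImD; exact: nc_Im.
exists (Complex x y) => n; apply: le_trans (nc_ReIm _) _.
rewrite ReD ReN ImD ImN /=; have := hx n; have := hy n; lra.
Qed.

End Convergence.

(** * Primitives along segments *)

Section PathIntegral.
Variable R : realType.
Local Notation C := R[i].
Local Notation nc := (@Defs.normc R).
Local Notation toC := (real_complex R).

(** Differentiability on the closed interval, one-sided at the endpoints. The non-strict bound with
    the factor [|s - t|] avoids a quotient and includes [s = t]. *)
Definition deriv01 (G g : R -> C) := forall t, 0 <= t <= 1 -> forall e, 0 < e ->
  exists2 d, 0 < d & forall s, 0 <= s <= 1 -> `|s - t| < d ->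
    nc (G s - G t - toC (s - t) * g t) <= e * `|s - t|.

(** A mean value inequality for complex values, where no point with the exact slope need exist. If
    the increment exceeded [M], bisection would always keep a half whose average slope stays above
    some [M' > M]; at the common point of these halves this contradicts the bound on the
    derivative. *)
Lemma deriv01_lipschitz (G g : R -> C) (M : R) :
  deriv01 G g -> (forall t, 0 <= t <= 1 -> nc (g t) <= M) -> nc (G 1 - G 0) <= M.
Proof.
move=> dG gM; rewrite leNgt; apply/negP => lt.
pose M' := (M + nc (G 1 - G 0)) / 2.
have MM' : M < M' by rewrite /M'; lra.
have M'G : M' < nc (G 1 - G 0) by rewrite /M'; lra.
pose h n : R := (2 ^+ n)^-1.
have hp n : 0 < h n by rewrite invr_gt0 exprn_gt0.
have hS n : h n = h n.+1 + h n.+1.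
  by rewrite /h exprS invfM; set x := _^-1; field.
pose step n (u : R) : R :=
  if M' * h n.+1 < nc (G (u + h n.+1) - G u) then u else u + h n.+1.
pose u := fix u n := if n is m.+1 then step m (u m) else 0.
have uS n : u n.+1 = step n (u n) by [].
have inv n : M' * h n < nc (G (u n + h n) - G (u n)).
  elim: n => [|n IH]; first by rewrite /= /h expr0 invr1 add0r mulr1.
  rewrite uS /step; case: ifPn => // /negbTE/negbT; rewrite -leNgt => le.
  have -> : u n + h n.+1 + h n.+1 = u n + h n by rewrite (hS n) addrA.
  have := nc_trans (G (u n + h n.+1)) (G (u n + h n)) (G (u n)).
  move: IH; rewrite (hS n) mulrDr -hS; lra.
have su n : u n <= u n.+1 <= u n + h n.+1.
  by rewrite uS /step; case: ifP => _; rewrite ?lexx ?lerDl ?ltW.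
have [||n|t ht] := @nested_intervals R u (fun n => u n + h n).
- by move=> n; case/andP: (su n).
- by move=> n; have := su n; rewrite (hS n); lra.
- by rewrite lerDl ltW.
have u0 n : 0 <= u n /\ u n + h n <= 1.
  elim: n => [|n [I1 I2]]; first by rewrite /= /h expr0 invr1 add0r; split.
  by have := su n; move: I2; rewrite (hS n); split; lra.
have t01 : 0 <= t <= 1.
  by have := ht 0%N; rewrite /= /h expr0 invr1 add0r.
have e0 : 0 < M' - M by rewrite subr_gt0.
have [d d0 hd] := dG t t01 _ e0.
have [n hn] := half_pow_small 1 d0; rewrite mul1r -/(h n) in hn.
have [un0 un1] := u0 n; have /andP[ut tv] := ht n; have hn0 := hp n.
have B s : 0 <= s <= 1 -> `|s - t| < d -> nc (G s - G t) <= M' * `|s - t|.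
  move=> s01 sd; have := hd s s01 sd.
  have := nc_lerB (G s - G t) (toC (s - t) * g t).
  rewrite ncM nc_real; have := ler_wpM2l (normr_ge0 (s - t)) (gM t t01).
  lra.
(* The limit [t] lies between [u n] and [u n + h n], so the two bounds taken from [t] add up to
   [M' * h n], against the invariant [inv n]. *)
have B1 := B (u n); have B2 := B (u n + h n).
have := nc_trans (G t) (G (u n + h n)) (G (u n)).
rewrite (ncB (G t)); have := inv n.
have E1 : `|u n - t| = t - u n by rewrite ler0_norm ?opprB // subr_le0.
have E2 : `|u n + h n - t| = u n + h n - t by rewrite ger0_norm // subr_ge0.
have {}B1 : nc (G (u n) - G t) <= M' * (t - u n) by rewrite -E1; apply: B1; [lra|rewrite E1; lra].
have {}B2 : nc (G (u n + h n) - G t) <= M' * (u n + h n - t) by rewrite -E2; apply: B2; [lra|rewrite E2; lra].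
lra.
Qed.

Lemma deriv01_sub (G H g h : R -> C) :
  deriv01 G g -> deriv01 H h -> deriv01 (fun t => G t - H t) (fun t => g t - h t).
Proof.
move=> dG dH t t01 e e0.
have e2 : 0 < e / 2 by rewrite divr_gt0.
have [d1 d10 h1] := dG t t01 _ e2; have [d2 d20 h2] := dH t t01 _ e2.
exists (Num.min d1 d2); first by rewrite lt_min d10.
move=> s s01; rewrite lt_min => /andP[sd1 sd2].
have := h1 s s01 sd1; have := h2 s s01 sd2.
have -> : G s - H s - (G t - H t) - toC (s - t) * (g t - h t) =
  (G s - G t - toC (s - t) * g t) - (H s - H t - toC (s - t) * h t) by ring.
have := ncBD (G s - G t - toC (s - t) * g t) (H s - H t - toC (s - t) * h t).
lra.
Qed.

Lemma deriv01_ext (G g h : R -> C) : (forall t, 0 <= t <= 1 -> g t = h t) ->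
  deriv01 G g -> deriv01 G h.
Proof. by move=> gh dG t t01 e e0; rewrite -gh //; exact: dG. Qed.

Lemma deriv01_quad (G g : R -> C) (K : R) : 0 <= K ->
  (forall s t, 0 <= s <= 1 -> 0 <= t <= 1 ->
     nc (G s - G t - toC (s - t) * g t) <= K * `|s - t| ^+ 2) -> deriv01 G g.
Proof.
move=> K0 h t t01 e e0; exists (e / (K + 1)); first by rewrite divr_gt0 // ltr_wpDl.
move=> s s01 sd; apply: le_trans (h s t s01 t01) _.
rewrite expr2 mulrA ler_wpM2r //.
rewrite ltr_pdivlMr ?ltr_wpDl // in sd.
have := normr_ge0 (s - t); lra.
Qed.

Lemma deriv01_affine (G g : R -> C) (x y : R) : 0 <= x <= 1 -> 0 <= y <= 1 ->
  deriv01 G g ->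
  deriv01 (fun t => G (x + t * (y - x))) (fun t => toC (y - x) * g (x + t * (y - x))).
Proof.
move=> x01 y01 dG.
have in01 t : 0 <= t <= 1 -> 0 <= x + t * (y - x) <= 1.
  move=> /andP[t0 t1]; have -> : x + t * (y - x) = (1 - t) * x + t * y by ring.
  have [x0 x1] := andP x01; have [y0 y1] := andP y01.
  have a0 : 0 <= 1 - t by lra.
  have := mulr_ge0 a0 x0; have := mulr_ge0 t0 y0.
  have := ler_wpM2l a0 x1; have := ler_wpM2l t0 y1; lra.
move=> t t01 e e0; have [d d0 hd] := dG _ (in01 t t01) e e0.
have yx : `|y - x| <= 1 by rewrite ler_norml; move: x01 y01; lra.
exists d => // s s01 sd.
have E : x + s * (y - x) - (x + t * (y - x)) = (s - t) * (y - x) by ring.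
have le1 : `|(s - t) * (y - x)| <= `|s - t| by rewrite normrM ler_piMr.
have := hd _ (in01 s s01); rewrite E => /(_ (le_lt_trans le1 sd)) {}hd.
rewrite mulrA -rmorphM /=; apply: le_trans hd _.
by rewrite ler_wpM2l // ltW.
Qed.

(** Defined through a primitive along the segment rather than as an integral: uniqueness and all
    estimates then follow from the mean value inequality, and integration serves only for
    existence. *)
Definition is_segment_integral (f : C -> C) (a b v : C) := exists2 G,
  deriv01 G (fun t => (b - a) * f (a + toC t * (b - a))) & v = G 1 - G 0.

Lemma pint_dist (f g : C -> C) (a b v w : C) (M : R) : is_segment_integral f a b v ->
  is_segment_integral g a b w ->
  (forall t, 0 <= t <= 1 ->
     nc (f (a + toC t * (b - a)) - g (a + toC t * (b - a))) <= M) ->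
  nc (v - w) <= nc (b - a) * M.
Proof.
move=> [G dG ->] [H dH ->] fg.
have -> : G 1 - G 0 - (H 1 - H 0) = (G 1 - H 1) - (G 0 - H 0) by ring.
apply: (deriv01_lipschitz (deriv01_sub dG dH)) => t t01.
by rewrite -mulrBr ncM ler_wpM2l ?nc_ge0 // fg.
Qed.

Lemma pint_unique (f : C -> C) (a b v w : C) : is_segment_integral f a b v ->
  is_segment_integral f a b w -> v = w.
Proof.
move=> pv pw; apply/eqP; rewrite -subr_eq0; apply/eqP/nc_eq0/eqP.
rewrite eq_le nc_ge0 andbT; apply: le_trans (pint_dist (M := 0) pv pw _) _.
  by move=> t _; rewrite subrr nc0.
by rewrite mulr0.
Qed.

(** The same [G], reparametrised affinely, is a primitive on the subsegment. The parameters may come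
    in either order, so reversal and splitting at the midpoint are both instances. *)
Lemma pint_sub (f : C -> C) (a b v : C) (x y : R) : 0 <= x <= 1 -> 0 <= y <= 1 ->
  forall G, deriv01 G (fun t => (b - a) * f (a + toC t * (b - a))) ->
  is_segment_integral f (a + toC x * (b - a)) (a + toC y * (b - a)) (G y - G x).
Proof.
move=> x01 y01 G dG; exists (fun t => G (x + t * (y - x))); last first.
  by rewrite mul1r mul0r addr0 (addrC x) subrK.
apply: deriv01_ext (deriv01_affine x01 y01 dG) => t t01.
have E : a + toC y * (b - a) - (a + toC x * (b - a)) = toC (y - x) * (b - a).
  by rewrite rmorphB /=; ring.
rewrite E mulrA; congr (_ * f _).
by rewrite rmorphD rmorphM /= rmorphB /=; ring.
Qed.

Lemma pint_rev (f : C -> C) (a b v : C) : is_segment_integral f a b v -> is_segment_integral f b a (- v).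
Proof.
move=> [G dG ->].
have i0 : (0 : R) <= (0 : R) <= (1 : R) by apply/andP; split; lra.
have i1 : (0 : R) <= (1 : R) <= (1 : R) by apply/andP; split; lra.
have := pint_sub v i1 i0 dG.
by rewrite rmorph1 rmorph0 mul1r mul0r addr0 (addrC a) subrK opprB.
Qed.

Lemma pint_mid (f : C -> C) (a b v v1 v2 : C) : is_segment_integral f a b v ->
  is_segment_integral f a ((a + b) / 2) v1 -> is_segment_integral f ((a + b) / 2) b v2 -> v = v1 + v2.
Proof.
move=> [G dG ->] p1 p2.
have i0 : (0 : R) <= (0 : R) <= (1 : R) by apply/andP; split; lra.
have i1 : (0 : R) <= (1 : R) <= (1 : R) by apply/andP; split; lra.
have ih : (0 : R) <= (1/2 : R) <= (1 : R) by apply/andP; split; lra.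
have E0 : a + toC 0 * (b - a) = a by rewrite rmorph0 mul0r addr0.
have E1 : a + toC 1 * (b - a) = b by rewrite rmorph1 mul1r addrC subrK.
have Eh : a + toC (1/2) * (b - a) = (a + b) / 2.
  by rewrite fmorph_div /= rmorph1 (rmorph_nat toC 2); field.
have := pint_sub v i0 ih dG; rewrite E0 Eh => /(pint_unique p1) ->.
have := pint_sub v ih i1 dG; rewrite E1 Eh => /(pint_unique p2) ->.
by ring.
Qed.

Lemma pint_affine (k l a b : C) :
  is_segment_integral (fun z => k + l * z) a b (k * (b - a) + l * (b ^+ 2 - a ^+ 2) / 2).
Proof.
pose p t : C := a + toC t * (b - a).
exists (fun t => k * p t + l * p t ^+ 2 / 2); last first.
  by rewrite /p rmorph1 rmorph0; field.
apply: (@deriv01_quad _ _ (nc (l / 2 * (b - a) ^+ 2))); first exact: nc_ge0.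
move=> s t _ _; rewrite -nc_real -ncX -ncM le_eqVlt; apply/orP; left; apply/eqP.
by congr nc; rewrite /p rmorphB /=; field.
Qed.

Definition cont_at (f : C -> C) (z : C) := forall e, 0 < e ->
  exists2 d, 0 < d & forall w, nc w < 1 -> nc (w - z) < d -> nc (f w - f z) < e.

Lemma real_primitive (g : R -> R) : continuous g ->
  exists P : R -> R, forall t, 0 <= t <= 1 -> forall e, 0 < e ->
  exists2 d, 0 < d & forall s, `|s - t| < d -> `|P s - P t - (s - t) * g t| <= e * `|s - t|.
Proof.
move=> cg.
(* Starting at -1 and working on [-1, 2] makes every point of [0, 1] interior, so the derivative is
   two-sided there. *)
exists (fun x => \int[lebesgue_measure]_(t in `[(-1)%R, x]) g t)%R => t t01 e e0.
have [||||dP] := @continuous_FTC1_closed R g (-1) t 2.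
- by move: t01; lra.
- apply: continuous_compact_integrable; first exact: segment_compact.
  exact: continuous_subspaceT.
- by move: t01; lra.
- exact: cg.
set P := (fun x => _) in dP *.
rewrite derive1E => Pg.
have /eqaddoP/(_ e e0) := derivable_nbhs dP; rewrite Pg.
move=> /nbhs_ballP [d /= d0 hd]; exists d => // s sd.
have := hd (s - t); rewrite /ball /= sub0r normrN => /(_ sd).
rewrite /= !fctE /GRing.scale /= mulr1 subrK.
by rewrite opprD addrA.
Qed.

Lemma segment_disk (a b : C) (r : R) t : nc a <= r -> nc b <= r -> 0 <= t <= 1 ->
  nc (a + toC t * (b - a)) <= r.
Proof.
move=> ha hb /andP[t0 t1].
have -> : a + toC t * (b - a) = toC (1 - t) * a + toC t * b by rewrite rmorphB rmorph1; ring.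
apply: le_trans (ncD _ _) _; rewrite !ncM !nc_real !ger0_norm // ?subr_ge0 //.
have t1' : 0 <= 1 - t by lra.
have := ler_wpM2l t0 hb; have := ler_wpM2l t1' ha; lra.
Qed.

Lemma pint_exists (f : C -> C) (a b : C) : nc a < 1 -> nc b < 1 ->
  (forall z, nc z < 1 -> cont_at f z) -> exists v, is_segment_integral f a b v.
Proof.
move=> a1 b1 cf.
(* [tau] clamps the parameter to [0, 1]. This makes the integrand continuous on the whole line, as
   [real_primitive] demands, without changing it on [0, 1]. *)
pose tau (t : R) : R := Num.max 0 (Num.min 1 t).
have tau01 t : 0 <= tau t <= 1.
  rewrite /tau; case: (leP t 1) => h; case: (leP 0 t) => h'; rewrite ?minElt ?maxElt;
  repeat case: ifPn; rewrite -?leNgt; lra.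
have tauE t : 0 <= t <= 1 -> tau t = t.
  by move=> /andP[h1 h2]; rewrite /tau (min_idPr h2) (max_idPr h1).
have tau_lip s t : `|tau s - tau t| <= `|s - t|.
  rewrite /tau !minElt !maxElt; have := ler_norm (s - t);
  have := ler_norm (- (s - t)); rewrite normrN ler_norml; repeat case: ifPn; rewrite -?leNgt; lra.
pose q t : C := a + toC (tau t) * (b - a).
have q1 t : nc (q t) < 1.
  apply: le_lt_trans (segment_disk (r := Num.max (nc a) (nc b)) _ _ (tau01 t)) _.
  - by rewrite le_max lexx.
  - by rewrite le_max lexx orbT.
  - by rewrite gt_max a1.
pose F t := (b - a) * f (q t).
have cF t e : 0 < e -> exists2 d, 0 < d & forall s, `|s - t| < d -> nc (F s - F t) < e.
  move=> e0; have k0 : 0 < nc (b - a) + 1 by rewrite ltr_wpDl ?nc_ge0.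
  have [d d0 hd] := cf _ (q1 t) _ (divr_gt0 e0 k0).
  exists (d / (nc (b - a) + 1)); first by rewrite divr_gt0.
  move=> s; rewrite ltr_pdivlMr // => sd.
  have : nc (q s - q t) < d.
    have -> : q s - q t = toC (tau s - tau t) * (b - a) by rewrite /q rmorphB /=; ring.
    rewrite ncM nc_real; apply: le_lt_trans sd.
    by apply: ler_pM => //; [exact: nc_ge0|rewrite lerDl].
  move=> /(hd _ (q1 s)); rewrite ltr_pdivlMr // => lt.
  rewrite /F -mulrBr ncM; apply: le_lt_trans lt; rewrite mulrC.
  by rewrite ler_wpM2l ?nc_ge0 // lerDl.
have cRe : continuous (fun t => complex.Re (F t) : R).
  move=> t; apply/cvgrPdist_lt => e e0; have [d d0 hd] := cF t e e0.
  apply/nbhs_ballP; exists d => // s; rewrite /ball /= distrC => /hd lt.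
  by rewrite distrC -ReN -ReD; apply: le_lt_trans lt; exact: nc_Re.
have cIm : continuous (fun t => complex.Im (F t) : R).
  move=> t; apply/cvgrPdist_lt => e e0; have [d d0 hd] := cF t e e0.
  apply/nbhs_ballP; exists d => // s; rewrite /ball /= distrC => /hd lt.
  by rewrite distrC -ImN -ImD; apply: le_lt_trans lt; exact: nc_Im.
have [P hP] := real_primitive cRe; have [Q hQ] := real_primitive cIm.
pose G t : C := Complex (P t) (Q t).
exists (G 1 - G 0); exists G => //.
apply: (@deriv01_ext _ F); first by move=> t t01; rewrite /F /q tauE.
move=> t t01 e e0; have e2 : 0 < e / 2 by rewrite divr_gt0.
have [d1 d10 h1] := hP t t01 _ e2; have [d2 d20 h2] := hQ t t01 _ e2.
exists (Num.min d1 d2); first by rewrite lt_min d10.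
move=> s s01; rewrite lt_min => /andP[sd1 sd2].
apply: le_trans (nc_ReIm _) _.
rewrite !ReD !ReN !ImD !ImN ReZ ImZ /=.
have := h1 s sd1; have := h2 s sd2; lra.
Qed.

End PathIntegral.

(** * Goursat's lemma *)

Section Goursat.
Variable R : realType.
Local Notation C := R[i].
Local Notation nc := (@Defs.normc R).
Local Notation toC := (real_complex R).

(** Only points of the unit disk are tested, so that functions on the disk can later be extended by
    zero. *)
Definition has_deriv (f : C -> C) (z l : C) := forall e, 0 < e ->
  exists2 d, 0 < d & forall w, nc w < 1 -> nc (w - z) < d ->
    nc (f w - f z - (w - z) * l) <= e * nc (w - z).

Definition holo (f : C -> C) := forall z, nc z < 1 -> exists l, has_deriv f z l.

Lemma holo_cont (f : C -> C) z : holo f -> nc z < 1 -> cont_at f z.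
Proof.
move=> hf z1 e e0; have [l hl] := hf z z1; have [d d0 hd] := hl _ ltr01.
have k0 : 0 < 1 + nc l by rewrite ltr_pwDl ?nc_ge0.
exists (Num.min d (e / (1 + nc l))); first by rewrite lt_min d0 divr_gt0.
move=> w w1; rewrite lt_min => /andP[wd]; rewrite ltr_pdivlMr // => we.
have := hd w w1 wd; have := nc_lerB (f w - f z) ((w - z) * l); rewrite ncM.
lra.
Qed.

Definition segment_integral (f : C ->
  C) (a b : C) : C := xget 0 [set v | is_segment_integral f a b v]%classic.
Local Notation J := segment_integral.

Section Continuous.
Variables (f : C -> C).
Hypothesis cf : forall z, nc z < 1 -> cont_at f z.

Lemma segment_integralP a b : nc a < 1 -> nc b < 1 -> is_segment_integral f a b (J f a b).
Proof.
move=> a1 b1; have [v hv] := pint_exists a1 b1 cf.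
exact: (@xgetPex _ 0 [set v | is_segment_integral f a b v]%classic (ex_intro _ v hv)).
Qed.

Lemma segment_integral_rev a b : nc a < 1 -> nc b < 1 -> J f b a = - J f a b.
Proof. by move=> a1 b1; apply: pint_unique (segment_integralP b1 a1)
  (pint_rev (segment_integralP a1 b1)). Qed.

Lemma nc_mid a b (r : R) : nc a <= r -> nc b <= r -> nc ((a + b) / 2) <= r.
Proof.
move=> ha hb; rewrite ncM ncV nc_nat ler_pdivrMr //.
by apply: le_trans (ncD _ _) _; lra.
Qed.

Lemma nc_mid1 a b : nc a < 1 -> nc b < 1 -> nc ((a + b) / 2) < 1.
Proof.
move=> ha hb; apply: le_lt_trans (nc_mid (r := Num.max (nc a) (nc b)) _ _) _.
- by rewrite le_max lexx.
- by rewrite le_max lexx orbT.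
- by rewrite gt_max ha.
Qed.

Lemma segment_integral_mid a b : nc a < 1 -> nc b < 1 ->
  J f a b = J f a ((a + b) / 2) + J f ((a + b) / 2) b.
Proof.
move=> a1 b1; have m1 := nc_mid1 a1 b1.
exact: pint_mid (segment_integralP a1 b1) (segment_integralP a1 m1) (segment_integralP m1 b1).
Qed.

Lemma segment_integral_dist_const z u M : nc z < 1 -> nc u < 1 ->
  (forall t, 0 <= t <= 1 -> nc (f (z + toC t * (u - z)) - f z) <= M) ->
  nc (J f z u - (u - z) * f z) <= nc (u - z) * M.
Proof.
move=> z1 u1 hM; have := pint_dist (M := M) (segment_integralP z1 u1) (pint_affine (f z) 0 z u).
rewrite mul0r mul0r addr0 (mulrC (f z)); apply => t t01.
by rewrite mul0r addr0; exact: hM.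
Qed.

Definition triangle_integral (x : C * C * C) : C :=
  let: (a, b, c) := x in J f a b + J f b c + J f c a.
Local Notation T := triangle_integral.

(** Subdivision by the midpoints of the sides. The last triangle is the fallback: if the other three
    fail the test, it must carry at least a quarter of the integral. *)
Definition inner_triangle (x : C * C * C) : C * C * C :=
  let: (a, b, c) := x in
  let m1 := (a + b) / 2 in let m2 := (b + c) / 2 in let m3 := (c + a) / 2 in
  if nc (T x) <= 4 * nc (T (a, m1, m3)) then (a, m1, m3)
  else if nc (T x) <= 4 * nc (T (m1, b, m2)) then (m1, b, m2)
  else if nc (T x) <= 4 * nc (T (m3, m2, c)) then (m3, m2, c)
  else (m1, m2, m3).

Definition vertices_within (rho : R) (x : C * C * C) :=
  let: (a, b, c) := x in [/\ nc a <= rho, nc b <= rho & nc c <= rho].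

Definition sides_le (D : R) (x : C * C * C) :=
  let: (a, b, c) := x in [/\ nc (b - a) <= D, nc (c - b) <= D & nc (a - c) <= D].

(** The integrals over the three inner segments cancel in pairs, so the four small triangles add up
    to the large one. *)
Lemma triangle_integral_inner x rho : rho < 1 -> vertices_within rho x ->
  nc (T x) <= 4 * nc (T (inner_triangle x)).
Proof.
case: x => [[a b] c] rho1 [ha hb hc]; rewrite /inner_triangle.
case: ifPn => // h1; case: ifPn => // h2; case: ifPn => // h3.
rewrite -!ltNge in h1 h2 h3.
have a1 := le_lt_trans ha rho1; have b1 := le_lt_trans hb rho1.
have c1 := le_lt_trans hc rho1.
have m1 := nc_mid1 a1 b1; have m2 := nc_mid1 b1 c1; have m3 := nc_mid1 c1 a1.
have E : T (a, b, c) = T (a, (a + b) / 2, (c + a) / 2) + T ((a + b) / 2, b, (b + c) / 2)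
   + T ((c + a) / 2, (b + c) / 2, c) + T ((a + b) / 2, (b + c) / 2, (c + a) / 2).
  rewrite /triangle_integral (segment_integral_mid a1 b1) (segment_integral_mid b1 c1)
    (segment_integral_mid c1 a1).
  rewrite (segment_integral_rev m1 m3) (segment_integral_rev m2 m1) (segment_integral_rev m3 m2); ring.
move: h1 h2 h3; move: E.
set t := T _; set t1 := T _; set t2 := T _; set t3 := T _; set t4 := T _ => E.
have := ncD (t1 + t2 + t3) t4; have := ncD (t1 + t2) t3; have := ncD t1 t2.
rewrite -E; lra.
Qed.

Lemma nc_half (z : C) (D : R) : nc z <= D -> nc (z / 2) <= D / 2.
Proof. by move=> h; rewrite ncM ncV nc_nat ler_pM2r. Qed.

Lemma inner_triangle_within x rho : vertices_within rho x -> vertices_within rho (inner_triangle x).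
Proof.
case: x => [[a b] c] [ha hb hc]; rewrite /inner_triangle.
by repeat case: ifPn => _; split=> //; exact: nc_mid.
Qed.

Lemma inner_triangle_sides x D : sides_le D x -> sides_le (D / 2) (inner_triangle x).
Proof.
case: x => [[a b] c] [ha hb hc]; rewrite /inner_triangle.
have ha' : nc (a - b) <= D by rewrite ncB.
have hb' : nc (b - c) <= D by rewrite ncB.
have hc' : nc (c - a) <= D by rewrite ncB.
have K u v w : nc w <= D -> u - v = w / 2 -> nc (u - v) <= D / 2.
  by move=> h ->; exact: nc_half.
by repeat case: ifPn => _; split;
  first [ (by apply: (K _ _ _ ha); field) | (by apply: (K _ _ _ hb); field)
        | (by apply: (K _ _ _ hc); field) | (by apply: (K _ _ _ ha'); field)
        | (by apply: (K _ _ _ hb'); field) | (by apply: (K _ _ _ hc'); field) ].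
Qed.

(** Makes the first vertices of the iterated triangles a dyadic Cauchy sequence; differentiability
    is used at their limit. *)
Lemma inner_triangle_close x D : sides_le D x -> nc ((inner_triangle x).1.1 - x.1.1) <= D.
Proof.
case: x => [[a b] c] [ha hb hc]; rewrite /inner_triangle.
have D0 := le_trans (nc_ge0 _) ha.
have hc' : nc (c - a) <= D by rewrite ncB.
have K w u : nc w <= D -> u - a = w / 2 -> nc (u - a) <= D.
  by move=> h ->; apply: le_trans (nc_half h) _; lra.
repeat case: ifPn => _ /=; first by rewrite subrr nc0.
- by apply: (K _ _ ha); field.
- by apply: (K _ _ hc'); field.
- by apply: (K _ _ ha); field.
Qed.

End Continuous.

(** Integration around the triangle kills the affine part of [f] at the limit point [z]. What
    remains on the [n]-th triangle, of size [h], is of order [e * h ^+ 2], which the factor [4 ^+ n]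
    turns into a multiple of [e]. *)
Lemma goursat (f : C -> C) a b c : holo f -> nc a < 1 -> nc b < 1 -> nc c < 1 ->
  J f a b + J f b c + J f c a = 0.
Proof.
move=> hf a1 b1 c1; have cf z : nc z < 1 -> cont_at f z by exact: holo_cont.
pose rho := Num.max (nc a) (Num.max (nc b) (nc c)).
have rho1 : rho < 1 by rewrite !gt_max a1 b1.
pose D := Num.max (nc (b - a)) (Num.max (nc (c - b)) (nc (a - c))).
have D0 : 0 <= D by rewrite !le_max nc_ge0.
pose x n := iter n (inner_triangle f) (a, b, c).
have wx n : vertices_within rho (x n).
  elim: n => [|n IH]; last exact: inner_triangle_within.
  by split; rewrite !le_max lexx ?orbT.
have sx n : sides_le (D / 2 ^+ n) (x n).
  elim: n => [|n IH]; last by rewrite exprSr invfM mulrA; exact: inner_triangle_sides.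
  by rewrite expr0 divr1; split; rewrite !le_max lexx ?orbT.
have Tx n : nc (triangle_integral f (a, b, c)) <= 4 ^+ n * nc (triangle_integral f (x n)).
  elim: n => [|n IH]; first by rewrite expr0 mul1r.
  apply: le_trans IH _; rewrite exprSr -mulrA ler_wpM2l ?exprn_ge0 //.
  by rewrite {2}/x iterS; apply: triangle_integral_inner (wx n).
have [|z hz] := @complex_dyadic_limit R (fun n => (x n).1.1) D.
  by move=> n; exact: inner_triangle_close (sx n).
have xw n : nc (x n).1.1 <= rho by have := wx n; case: (x n) => [[? ?] ?] [].
have z1 : nc z < 1.
  apply: le_lt_trans rho1; apply/ler_addgt0Pr => e e0.
  have [n hn] := half_pow_small (D * 4) e0.
  have := nc_lerB z (x n).1.1; rewrite (ncB z).
  have := hz n; have := xw n; lra.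
have [l hl] := hf z z1.
apply: nc_eq0; apply/eqP; rewrite eq_le nc_ge0 andbT.
(* Each of the three sides has length at most [h = D / 2 ^+ n] and lies within [5 * h] of [z]:
   [4 * h] from the limit estimate plus one side. Hence [15 = 3 * 5]. *)
apply: (@real_eps0 R _ (15 * D ^+ 2)); first by rewrite mulr_ge0 ?sqr_ge0.
move=> e e0; have [d d0 hd] := hl e e0.
have [n hn] := half_pow_small (5 * D) d0.
apply: le_trans (Tx n) _.
pose h := D / 2 ^+ n.
have h0 : 0 <= h by rewrite divr_ge0 ?exprn_ge0.
suff le : nc (triangle_integral f (x n)) <= 15 * e * h ^+ 2.
  apply: le_trans (ler_wpM2l _ le) _; first exact: exprn_ge0.
  rewrite le_eqVlt; apply/orP; left; apply/eqP.
  rewrite /h expr_div_n -exprM mulnC exprM (_ : 2 ^+ 2 = 4 :> R); last by rewrite -natrX.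
  have : 4 ^+ n != 0 :> R by rewrite expf_neq0 // pnatr_eq0.
  by set q := 4 ^+ n => q0; field.
have := sx n; have := wx n; have := hz n; rewrite -/h.
case: (x n) => [[p q] r] /= hp [p1 q1 r1] [s1 s2 s3].
have {}p1 := le_lt_trans p1 rho1; have {}q1 := le_lt_trans q1 rho1.
have {}r1 := le_lt_trans r1 rho1.
have hp5 : nc (p - z) <= 5 * h by apply: le_trans hp _; rewrite mulrAC -/h; lra.
have hq5 : nc (q - z) <= 5 * h.
  have := nc_trans p q z; move: hp s1; rewrite mulrAC -/h; lra.
have hr5 : nc (r - z) <= 5 * h.
  have := nc_trans p r z; move: hp s3; rewrite mulrAC -/h (ncB p r); lra.
have hd5 : 5 * h < d by rewrite /h mulrA.
pose k := f z - z * l.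
have est u v : nc u < 1 -> nc v < 1 -> nc (u - z) <= 5 * h -> nc (v - z) <= 5 * h ->
   nc (v - u) <= h ->
   nc (J f u v - (k * (v - u) + l * (v ^+ 2 - u ^+ 2) / 2)) <= 5 * e * h ^+ 2.
  move=> u1 v1 uz vz vu.
  apply: le_trans (pint_dist (M := e * (5 * h)) (segment_integralP cf u1 v1) (pint_affine k l u v) _) _.
    move=> t t01; set w := u + _.
    have wz : nc (w - z) <= 5 * h.
      have -> : w - z = (u - z) + toC t * ((v - z) - (u - z)) by rewrite /w; ring.
      exact: segment_disk.
    have w1 : nc w < 1.
      apply: le_lt_trans (segment_disk (r := Num.max (nc u) (nc v)) _ _ t01) _.
      - by rewrite le_max lexx.
      - by rewrite le_max lexx orbT.
      - by rewrite gt_max u1.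
    have := hd w w1 (le_lt_trans wz hd5).
    have -> : f w - f z - (w - z) * l = f w - (k + l * w) by rewrite /k; ring.
    move=> le; apply: le_trans le _; apply: ler_wpM2l => //; exact: ltW.
  have -> : 5 * e * h ^+ 2 = h * (e * (5 * h)) by ring.
  apply: ler_wpM2r => //; rewrite !mulr_ge0 //; exact: ltW.
have := est p q p1 q1 hp5 hq5 s1; have := est q r q1 r1 hq5 hr5 s2.
have := est r p r1 p1 hr5 hp5 s3.
set A1 := J f p q; set A2 := J f q r; set A3 := J f r p.
set B1 := _ - _; set B2 := _ - _; set B3 := _ - _ => h3 h2 h1.
(* The affine contributions of the three sides telescope to zero. *)
have -> : A1 + A2 + A3 = B3 + B2 + B1 by rewrite /B1 /B2 /B3; field.
have := ncD (B3 + B2) B1; have := ncD B3 B2; lra.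
Qed.

(* The quadratic bound upgrades to uniformity what differentiability gives only pointwise:
   the primitive of a Lipschitz function is uniformly differentiable. *)
Definition quad_deriv (K rho : R) (F D : C -> C) := forall u v,
  nc u <= rho -> nc v <= rho -> nc (F v - F u - (v - u) * D u) <= K * nc (v - u) ^+ 2.

Lemma segment_integral_diff (f : C -> C) z u : holo f -> nc z < 1 -> nc u < 1 ->
  J f 0 u - J f 0 z = J f z u.
Proof.
move=> hf z1 u1; have o1 : nc (0 : C) < 1 by rewrite nc0.
have := goursat hf o1 z1 u1; rewrite (segment_integral_rev (fun z => @holo_cont f z hf) o1 u1).
by move/eqP; rewrite subr_eq add0r => /eqP <-; ring.
Qed.

Lemma primitive_deriv (f : C -> C) z : holo f -> nc z < 1 -> has_deriv (J f 0) z (f z).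
Proof.
move=> hf z1 e e0; have [d d0 hd] := holo_cont hf z1 e0.
exists d => // w w1 wd; rewrite segment_integral_diff // (mulrC e).
apply: segment_integral_dist_const => //; first by move=> *; exact: holo_cont.
move=> t t01; apply/ltW/hd.
  apply: le_lt_trans (segment_disk (r := Num.max (nc z) (nc w)) _ _ t01) _.
  - by rewrite le_max lexx.
  - by rewrite le_max lexx orbT.
  - by rewrite gt_max z1.
rewrite addrC addKr ncM nc_real ger0_norm; last by case/andP: t01.
by apply: le_lt_trans wd; rewrite ler_piMl ?nc_ge0 //; case/andP: t01.
Qed.

Lemma primitive_lipschitz (f : C -> C) z w : holo f -> (forall z, nc (f z) <= 1) ->
  nc z < 1 -> nc w < 1 -> nc (J f 0 w - J f 0 z) <= nc (w - z).
Proof.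
move=> hf f1 z1 w1; rewrite segment_integral_diff //.
have cf z' : nc z' < 1 -> cont_at f z' by exact: holo_cont.
have := pint_dist (M := 1) (segment_integralP cf z1 w1) (pint_affine 0 0 z w).
rewrite !mul0r addr0 subr0 mulr1; apply => t t01.
by rewrite add0r mul0r subr0.
Qed.

Lemma primitive_quad (f : C -> C) (rho : R) : rho < 1 -> holo f ->
  (forall z w, nc z < 1 -> nc w < 1 -> nc (f w - f z) <= nc (w - z)) ->
  quad_deriv 1 rho (J f 0) f.
Proof.
move=> rho1 hf lf u v hu hv; have u1 := le_lt_trans hu rho1; have v1 := le_lt_trans hv rho1.
rewrite segment_integral_diff // mul1r expr2; apply: segment_integral_dist_const => //.
  by move=> *; exact: holo_cont.
move=> t t01; apply: le_trans (lf _ _ u1 _) _.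
  exact: le_lt_trans (segment_disk hu hv t01) rho1.
rewrite addrC addKr ncM nc_real ger0_norm; last by case/andP: t01.
by rewrite ler_piMl ?nc_ge0 //; case/andP: t01.
Qed.

End Goursat.

(** * Averages over roots of unity and their ultrafilter limit *)

Section Circle.
Variable R : realType.
Local Notation C := R[i].
Local Notation nc := (@Defs.normc R).
Local Notation toC := (real_complex R).

Definition cis (x : R) : C := Complex (cos x) (sin x).

Lemma cisD x y : cis (x + y) = cis x * cis y.
Proof. by rewrite /cis cosD sinD (addrC (sin x * _)). Qed.

Lemma cis0 : cis 0 = 1. Proof. by rewrite /cis cos0 sin0. Qed.

Lemma cisMn x n : cis (x *+ n) = cis x ^+ n.
Proof. by elim: n => [|n IH]; rewrite ?mulr0n ?cis0 // mulrS cisD IH exprS. Qed.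

Lemma nc_cis x : nc (cis x) = 1.
Proof. by rewrite /Defs.normc /= cos2Dsin2 sqrtr1. Qed.

Lemma cis_neq1 x : 0 < x < pi *+ 2 -> cis x != 1.
Proof.
move=> hx; apply/eqP => -[hc _].
have : 0 < sin (x / 2) by apply: sin_gt0_pi; move: hx; rewrite mulr2n; lra.
have E2 : x / 2 + x / 2 = x by field.
have : cos (x / 2 + x / 2) = 1 by rewrite E2.
rewrite cosD; have := cos2Dsin2 (x / 2); rewrite !expr2 => h1 h2 s0.
have : 0 < sin (x / 2) * sin (x / 2) by rewrite mulr_gt0.
lra.
Qed.

Definition omega (n : nat) : C := cis (pi *+ 2 / n.+1%:R).

Lemma nc_omega n : nc (omega n) = 1. Proof. exact: nc_cis. Qed.

Lemma omega_unity n : omega n ^+ n.+1 = 1.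
Proof.
rewrite -cisMn -(mulr_natr (_ / _)) divfK ?pnatr_eq0 // mulr2n cisD.
by rewrite /cis cospi sinpi; apply/eqP; rewrite eq_complex /=; apply/andP; split; apply/eqP; ring.
Qed.

Lemma omega_prim n k : (0 < k < n.+1)%N -> omega n ^+ k != 1.
Proof.
move=> /andP[k0 kn]; rewrite -cisMn; apply: cis_neq1.
rewrite -(mulr_natr (_ / _)) -mulrA; have p0 : 0 < pi *+ 2 :> R by rewrite mulrn_wgt0 // pi_gt0.
rewrite mulr_gt0 //=; last by rewrite mulr_gt0 ?invr_gt0 ?ltr0n.
by rewrite gtr_pMr // mulrC ltr_pdivrMr ?ltr0n // mul1r ltr_nat.
Qed.

Lemma omega_near1 (e : R) : 0 < e -> exists N, forall n, (N <= n)%N -> nc (omega n - 1) < e.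
Proof.
move=> e0; have e2 : 0 < e / 2 by rewrite divr_gt0.
have /cvgrPdist_lt/(_ _ e2)/nbhs_ballP[d1 /= d10 h1] := @continuous_cos R 0.
have /cvgrPdist_lt/(_ _ e2)/nbhs_ballP[d2 /= d20 h2] := @continuous_sin R 0.
have d0 : 0 < Num.min d1 d2 by rewrite lt_min d10.
have p0 : 0 <= pi *+ 2 :> R by rewrite mulrn_wge0 // pi_ge0.
exists (Num.bound (pi *+ 2 / Num.min d1 d2)) => n hn.
have : pi *+ 2 / n.+1%:R < Num.min d1 d2.
  rewrite ltr_pdivrMr ?ltr0n // mulrC -ltr_pdivrMr //.
  apply: lt_le_trans (archi_boundP _) _; first by rewrite divr_ge0 // ltW.
  by rewrite ler_nat (leq_trans hn).
rewrite lt_min => /andP[x1 x2].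
set x := _ / _ in x1 x2; have x0 : 0 <= x by rewrite divr_ge0.
have b1 : ball (0 : R) d1 x by rewrite /ball /= sub0r normrN ger0_norm.
have b2 : ball (0 : R) d2 x by rewrite /ball /= sub0r normrN ger0_norm.
have := h1 x b1; have := h2 x b2; rewrite cos0 sin0 sub0r normrN distrC => l2 l1.
apply: le_lt_trans (nc_ReIm _) _; rewrite ReD ImD ReN ImN /= subr0 -/x.
lra.
Qed.

Definition avg (n : nat) (g : C -> C) : C := n.+1%:R^-1 * \sum_(j < n.+1) g (omega n ^+ j).

Lemma nc_omegaX n j : nc (omega n ^+ j) = 1.
Proof. by rewrite ncX nc_omega expr1n. Qed.

Lemma n1_neq0 n : n.+1%:R != 0 :> C. Proof. by rewrite pnatr_eq0. Qed.

Lemma avg_bound n g M : (forall z, nc z = 1 -> nc (g z) <= M) -> nc (avg n g) <= M.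
Proof.
move=> h; rewrite ncM ncV nc_nat mulrC ler_pdivrMr ?ltr0n //.
apply: le_trans (nc_sum _ _ _) _.
apply: le_trans (ler_sum (G := fun=> M) _ _) _; first by move=> j _; rewrite h ?nc_omegaX.
by rewrite sumr_const card_ord mulr_natr.
Qed.

Lemma avg_lin n a g h : avg n (fun z => a * g z + h z) = a * avg n g + avg n h.
Proof. by rewrite /avg big_split /= -mulr_sumr mulrDr mulrCA. Qed.

Lemma avg_ext n g h : (forall z, nc z = 1 -> g z = h z) -> avg n g = avg n h.
Proof. by move=> gh; rewrite /avg; congr (_ * _); apply: eq_bigr => j _; rewrite gh ?nc_omegaX. Qed.

Lemma avg_conj n g : avg n (fun z => (g z)^*) = (avg n g)^*.
Proof. by rewrite /avg rmorphM /= fmorphV /= rmorph_nat rmorph_sum. Qed.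

Lemma Re_sum (I : Type) (r : seq I) (P : pred I) (F : I -> C) :
  complex.Re (\sum_(i <- r | P i) F i) = \sum_(i <- r | P i) complex.Re (F i).
Proof. by elim/big_rec2: _ => [|i y x _ <-]; rewrite ?ReD. Qed.

Lemma avg_Re_ge0 n g : (forall z, nc z = 1 -> 0 <= complex.Re (g z)) ->
  0 <= complex.Re (avg n g).
Proof.
move=> h; rewrite /avg -(rmorph_nat toC) -fmorphV ReZ Re_sum mulr_ge0 ?invr_ge0 //.
by apply: sumr_ge0 => j _; rewrite h ?nc_omegaX.
Qed.

Lemma avg_pow n k : (0 < k < n.+1)%N -> avg n (fun z => z ^+ k) = 0.
Proof.
move=> hk; rewrite /avg (_ : \sum_(j < _) _ = 0) ?mulr0 //.
have := subrX1 (omega n ^+ k) n.+1.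
rewrite -exprM mulnC exprM omega_unity expr1n subrr => /esym/eqP.
rewrite mulf_eq0 subr_eq0 (negPf (omega_prim hk)) /= => /eqP h; rewrite -[RHS]h.
by apply: eq_bigr => j _; rewrite -!exprM mulnC.
Qed.

(* A limit along an ultrafilter gives every bounded function a mean, so that no
   integrability has to be established. *)
Definition Ult : set_system nat :=
  sval (cid (ultraFilterLemma (F := \oo%classic) _)).

Lemma Ult_ultra : UltraFilter Ult.
Proof. by rewrite /Ult; case: cid => G []. Qed.

Lemma Ult_filter : Filter Ult.
Proof. by case: Ult_ultra => -[]. Qed.

Lemma Ult_tail (P : nat -> Prop) N : (forall n, (N <= n)%N -> P n) -> Ult P.
Proof.
move=> h; rewrite /Ult; case: cid => G [_ sub] /=; apply: sub.
by exists N.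
Qed.

Lemma Ult_and (P Q : nat -> Prop) : Ult P -> Ult Q -> Ult (fun n => P n /\ Q n).
Proof. by move=> hP hQ; have F := Ult_filter; exact: filterI. Qed.

Lemma Ult_mono (P Q : nat -> Prop) : (forall n, P n -> Q n) -> Ult P -> Ult Q.
Proof. by move=> PQ hP; have F := Ult_filter; apply: filterS hP. Qed.

Lemma Ult_ex (P : nat -> Prop) : Ult P -> exists n, P n.
Proof. by move=> hP; have [F _] := Ult_ultra; exact: filter_ex hP. Qed.

(** The limit is the supremum of the levels [x] such that [x <= u n] holds along [Ult]; the
    ultrafilter decides for every level whether [u] is above or below it. *)
Lemma Ult_real_limit (u : nat -> R) M : (forall n, `|u n| <= M) ->
  exists l, forall e, 0 < e -> Ult (fun n => `|u n - l| < e).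
Proof.
move=> hM; pose S : set R := fun x => Ult (fun n => x <= u n).
have SM : S (- M).
  by apply: (@Ult_tail _ 0%N) => n _; have := hM n; rewrite ler_norml => /andP[].
have ubS : ubound S M.
  move=> x /Ult_ex[n hn]; apply: le_trans hn _; have := hM n.
  by rewrite ler_norml => /andP[].
have hS : has_sup S by split; [exists (- M)|exists M].
exists (sup S) => e e0.
have [x Sx lx] := sup_adherent e0 hS.
have nS : ~ S (sup S + e / 2).
  by move=> h; have := ub_le_sup (proj2 hS) h; lra.
have := Ult_ultra => UU.
have [//|h] := @in_ultra_setVsetC _ _ (fun n => sup S + e / 2 <= u n) UU.
have {}h : Ult (fun n => u n < sup S + e / 2).
  by apply: Ult_mono h => n /= /negP; rewrite -ltNge.
apply: Ult_mono (Ult_and Sx h) => n [a b]; rewrite ltr_norml; lra.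
Qed.

Definition has_mean (g : C -> C) (l : C) := forall e, 0 < e -> Ult (fun n => nc (avg n g - l) < e).

Definition cbdd (g : C -> C) := exists M, forall z, nc z = 1 -> nc (g z) <= M.

Lemma has_mean_exists g : cbdd g -> exists l, has_mean g l.
Proof.
move=> [M hM]; have B n := avg_bound n hM.
have [x hx] : exists l, forall e, 0 < e -> Ult (fun n => `|complex.Re (avg n g) - l| < e).
  by apply: (@Ult_real_limit _ M) => n; apply: le_trans (nc_Re _) _.
have [y hy] : exists l, forall e, 0 < e -> Ult (fun n => `|complex.Im (avg n g) - l| < e).
  by apply: (@Ult_real_limit _ M) => n; apply: le_trans (nc_Im _) _.
exists (Complex x y) => e e0; have e2 : 0 < e / 2 by rewrite divr_gt0.
apply: Ult_mono (Ult_and (hx _ e2) (hy _ e2)) => n [a b].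
apply: le_lt_trans (nc_ReIm _) _; rewrite ReD ImD ReN ImN /=; lra.
Qed.

Lemma has_mean_unique g l m : has_mean g l -> has_mean g m -> l = m.
Proof.
move=> hl hm; apply/eqP; rewrite -subr_eq0; apply/eqP/nc_eq0/eqP.
rewrite eq_le nc_ge0 andbT; apply: (@real_eps0 R _ 2) => // e e0.
have [n [a b]] := Ult_ex (Ult_and (hl _ e0) (hm _ e0)).
have := nc_trans (avg n g) l m; rewrite (ncB l (avg n g)); lra.
Qed.

(** Stands for the normalised integral over the unit circle; linear and positive on functions
    bounded there. For trigonometric polynomials the averages are eventually constant, so the choice
    of the ultrafilter has no influence. *)
Definition circle_mean (g : C -> C) : C := xget 0 (has_mean g).
Local Notation E := circle_mean.

Lemma has_mean_circle_mean g : cbdd g -> has_mean g (E g).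
Proof. by move=> /has_mean_exists h; exact: (@xgetPex _ 0 (has_mean g) h). Qed.

Lemma mean_eq g l : cbdd g -> has_mean g l -> E g = l.
Proof. by move=> /has_mean_circle_mean; exact: has_mean_unique. Qed.

Lemma mean_ext g h : (forall z, nc z = 1 -> g z = h z) -> E g = E h.
Proof.
move=> gh; rewrite /circle_mean; congr (xget 0 _); apply/funext => l; apply/propext.
by rewrite /has_mean; split => H e /H; apply: Ult_mono => n; rewrite (avg_ext n gh).
Qed.

Lemma mean_tail g l : cbdd g ->
  (forall e, 0 < e -> exists N, forall n, (N <= n)%N -> nc (avg n g - l) < e) -> E g = l.
Proof. by move=> bg h; apply: mean_eq => // e /h[N hN]; exact: Ult_tail hN. Qed.

Lemma cbdd_ext g h : (forall z, nc z = 1 -> g z = h z) -> cbdd g -> cbdd h.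
Proof. by move=> gh [M hM]; exists M => z z1; rewrite -gh // hM. Qed.
Lemma cbdd_cst (a : C) : cbdd (fun=> a).
Proof. by exists (nc a). Qed.
Lemma cbddD g h : cbdd g -> cbdd h -> cbdd (fun z => g z + h z).
Proof.
move=> [M hM] [N hN]; exists (M + N) => z z1; apply: le_trans (ncD _ _) _.
by rewrite lerD ?hM ?hN.
Qed.
Lemma cbddM g h : cbdd g -> cbdd h -> cbdd (fun z => g z * h z).
Proof.
move=> [M hM] [N hN]; exists (M * N) => z z1; rewrite ncM.
by rewrite ler_pM ?nc_ge0 ?hM ?hN.
Qed.
Lemma cbddZ a g : cbdd g -> cbdd (fun z => a * g z).
Proof. by move=> bg; apply: cbddM (cbdd_cst a) bg. Qed.
Lemma cbddN g : cbdd g -> cbdd (fun z => - g z).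
Proof. by move=> [M hM]; exists M => z z1; rewrite ncN hM. Qed.
Lemma cbddB g h : cbdd g -> cbdd h -> cbdd (fun z => g z - h z).
Proof. by move=> bg bh; apply: cbddD bg (cbddN bh). Qed.
Lemma cbdd_conj g : cbdd g -> cbdd (fun z => (g z)^*).
Proof. by move=> [M hM]; exists M => z z1; rewrite nc_conj hM. Qed.
Lemma cbddX g n : cbdd g -> cbdd (fun z => g z ^+ n).
Proof.
move=> [M hM]; exists (M ^+ n) => z z1; rewrite ncX.
by rewrite lerXn2r ?nnegrE ?nc_ge0 ?hM // (le_trans (nc_ge0 _) (hM z z1)).
Qed.
Lemma cbdd_id : cbdd id. Proof. by exists 1 => z ->. Qed.
Lemma cbdd_sum (I : Type) (r : seq I) (F : I -> C -> C) : (forall i, cbdd (F i)) ->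
  cbdd (fun z => \sum_(i <- r) F i z).
Proof.
move=> h; elim: r => [|i r IH].
  by exists 0 => z _; rewrite big_nil nc0.
by apply: cbdd_ext (cbddD (h i) IH) => z _; rewrite big_cons.
Qed.

Lemma mean_bound g M : (forall z, nc z = 1 -> nc (g z) <= M) -> nc (E g) <= M.
Proof.
move=> hM; have bg : cbdd g by exists M.
apply/ler_addgt0Pr => e e0; have [n hn] := Ult_ex (has_mean_circle_mean bg e0).
have := avg_bound n hM; have := nc_lerB (E g) (avg n g); rewrite (ncB (E g)); lra.
Qed.

Lemma mean_lin a g h : cbdd g -> cbdd h -> E (fun z => a * g z + h z) = a * E g + E h.
Proof.
move=> bg bh; apply: mean_eq; first exact: cbddD (cbddZ a bg) bh.
move=> e e0; have k0 : 0 < nc a + 1 by rewrite ltr_wpDl ?nc_ge0.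
have e2 : 0 < e / 2 by rewrite divr_gt0.
apply: Ult_mono (Ult_and (has_mean_circle_mean bg (divr_gt0 e2 k0)) (has_mean_circle_mean bh e2)) => n [].
rewrite ltr_pdivlMr // => h1 h2; rewrite avg_lin.
have -> : a * avg n g + avg n h - (a * E g + E h) = a * (avg n g - E g) + (avg n h - E h) by ring.
apply: le_lt_trans (ncD _ _) _; rewrite ncM.
have := nc_ge0 (avg n g - E g); lra.
Qed.

Lemma mean_cst a : E (fun=> a) = a.
Proof.
apply: mean_eq (cbdd_cst a) _ => e e0; apply: (@Ult_tail _ 0%N) => n _.
rewrite /avg sumr_const card_ord -(mulr_natl a) mulrA mulVf ?n1_neq0 // mul1r.
by rewrite subrr nc0.
Qed.

Lemma meanZ a g : cbdd g -> E (fun z => a * g z) = a * E g.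
Proof.
move=> bg; have := mean_lin a bg (cbdd_cst 0); rewrite mean_cst addr0 => <-.
by apply: mean_ext => z _; rewrite addr0.
Qed.
Lemma meanD g h : cbdd g -> cbdd h -> E (fun z => g z + h z) = E g + E h.
Proof.
move=> bg bh; have := mean_lin 1 bg bh; rewrite mul1r => <-.
by apply: mean_ext => z _; rewrite mul1r.
Qed.
Lemma meanB g h : cbdd g -> cbdd h -> E (fun z => g z - h z) = E g - E h.
Proof.
move=> bg bh; have := mean_lin (- 1) bh bg; rewrite mulN1r addrC => <-.
by apply: mean_ext => z _; rewrite mulN1r addrC.
Qed.
Lemma mean_sum (I : Type) (r : seq I) (F : I -> C -> C) : (forall i, cbdd (F i)) ->
  E (fun z => \sum_(i <- r) F i z) = \sum_(i <- r) E (F i).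
Proof.
move=> h; elim: r => [|i r IH].
  by rewrite big_nil (mean_ext (h := fun=> 0)) ?mean_cst // => z _; rewrite big_nil.
rewrite big_cons -IH -meanD //; last exact: cbdd_sum.
by apply: mean_ext => z _; rewrite big_cons.
Qed.

Lemma mean_conj g : cbdd g -> E (fun z => (g z)^*) = (E g)^*.
Proof.
move=> bg; apply: mean_eq (cbdd_conj bg) _ => e e0.
by apply: Ult_mono (has_mean_circle_mean bg e0) => n; rewrite avg_conj -rmorphB nc_conj.
Qed.

Lemma mean_Re_ge0 g : cbdd g -> (forall z, nc z = 1 -> 0 <= complex.Re (g z)) ->
  0 <= complex.Re (E g).
Proof.
move=> bg h; rewrite -oppr_le0; apply/ler_addgt0Pr => e e0; rewrite add0r.
have [n hn] := Ult_ex (has_mean_circle_mean bg e0).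
have := avg_Re_ge0 n h; have := nc_Re (avg n g - E g); rewrite ReD ReN.
have := ler_norm (complex.Re (avg n g) - complex.Re (E g)); lra.
Qed.

Lemma mean_pow k : (0 < k)%N -> E (fun z => z ^+ k) = 0.
Proof.
move=> k0; apply: mean_tail; first exact: cbddX cbdd_id.
move=> e e0; exists k => n kn; rewrite avg_pow ?k0 //=.
by rewrite subrr nc0.
Qed.

Lemma circle_conj (z : C) : nc z = 1 -> z * z^* = 1.
Proof. by move=> z1; rewrite -nc_sqr z1 expr1n. Qed.

(** On the circle the conjugate of [z] is its inverse, so for [k <= l] the mean is that of the
    conjugate of [z ^+ (l - k)]; the other case is obtained by conjugation. *)
Lemma mean_mono k l : E (fun z => z ^+ k * z^* ^+ l) = (k == l)%:R.
Proof.
have swap a b : E (fun z => z ^+ a * z^* ^+ b) = (E (fun z => z ^+ b * z^* ^+ a))^*.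
  rewrite -mean_conj; last exact: cbddM (cbddX _ cbdd_id) (cbddX _ (cbdd_conj cbdd_id)).
  by apply: mean_ext => z _; rewrite rmorphM !rmorphXn /= conjCK mulrC.
wlog le : k l / (k <= l)%N.
  move=> H; have [/H//|/ltnW/H h] := leqP k l.
  by rewrite swap h rmorph_nat eq_sym.
have -> : E (fun z => z ^+ k * z^* ^+ l) = E (fun z => (z ^+ (l - k))^*).
  apply: mean_ext => z z1; rewrite -(subnKC le) addKn exprD mulrA -exprMn.
  by rewrite circle_conj // expr1n mul1r rmorphXn.
rewrite mean_conj; last exact: cbddX cbdd_id.
have [->|neq] := eqVneq k l; first by rewrite subnn (mean_ext (h := fun=> 1)) ?mean_cst ?conjC1.
by rewrite mean_pow ?conjC0 // subn_gt0 ltn_neqAle neq.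
Qed.

End Circle.

(** * Cauchy's formula and power series *)

Section PowerSeries.
Variable R : realType.
Local Notation C := R[i].
Local Notation nc := (@Defs.normc R).
Local Notation toC := (real_complex R).
Local Notation E := (@circle_mean R).

Lemma pow_small (q e : R) : 0 <= q < 1 -> 0 < e ->
  exists N, forall n, (N <= n)%N -> q ^+ n < e.
Proof.
move=> /andP[q0 q1] e0.
have : `|q| < 1 by rewrite ger0_norm.
move=> /cvg_expr/cvgrPdist_lt/(_ _ e0)[N _ hN]; exists N => n /hN /=.
by rewrite sub0r normrN ger0_norm // exprn_ge0.
Qed.

Lemma nc_1B (q : C) : nc q < 1 -> 0 < 1 - nc q /\ 1 - nc q <= nc (1 - q).
Proof. by move=> q1; split; [lra|rewrite -{1}(nc1 R) nc_lerB]. Qed.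

Lemma neq0_1B (q : C) : nc q < 1 -> 1 - q != 0.
Proof.
by move=> /nc_1B[h1 h2]; apply: contraTneq (lt_le_trans h1 h2) => ->; rewrite nc0 ltxx.
Qed.

Lemma nc_inv1B (q : C) : nc q < 1 -> nc (1 - q)^-1 <= (1 - nc q)^-1.
Proof.
move=> /nc_1B[h1 h2]; rewrite ncV lef_pV2 // posrE //; exact: lt_le_trans h2.
Qed.

Lemma nc_qconj (q z : C) : nc z = 1 -> nc (q * z^*) = nc q.
Proof. by move=> z1; rewrite ncM nc_conj z1 mulr1. Qed.

Lemma cbdd_szego (q : C) : nc q < 1 -> cbdd (fun z => (1 - q * z^*)^-1).
Proof.
move=> q1; exists (1 - nc q)^-1 => z z1.
by rewrite -(nc_qconj q z1) nc_inv1B // nc_qconj.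
Qed.

Lemma geom_expand (q : C) n : nc q < 1 ->
  (1 - q)^-1 = \sum_(k < n) q ^+ k + q ^+ n * (1 - q)^-1.
Proof.
move=> q1; have := neq0_1B q1; have := subrX1 q n.
set S := \sum_(k < n) _ => h q0.
apply: (mulfI q0); rewrite divff // mulrDr mulrCA divff // mulr1.
have -> : (1 - q) * S = - ((q - 1) * S) by ring.
rewrite -h; ring.
Qed.

Lemma cbdd_conjX n : cbdd (fun z : C => z^* ^+ n).
Proof. exact: cbddX (cbdd_conj (@cbdd_id R)). Qed.

(** Geometric expansion of the Szego kernel: on the circle the remainder is at most [nc q ^+ n]
    times a bound of the integrand. The limit is the analytic projection of [g], evaluated at
    [q]. *)
Lemma mean_szego (g : C -> C) (q : C) : cbdd g -> nc q < 1 ->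
  cconv (fun n => \sum_(k < n) E (fun z => g z * z^* ^+ k) * q ^+ k)
        (E (fun z => g z * (1 - q * z^*)^-1)).
Proof.
move=> bg q1; apply/cconvP => e e0.
have [M hM] := cbddM bg (cbdd_szego q1).
have M1 : 0 < `|M| + 1 by rewrite ltr_wpDl.
have [|N hN] := @pow_small (nc q) (e / (`|M| + 1)) _ (divr_gt0 e0 M1).
  by rewrite nc_ge0.
exists N => n /hN; rewrite ltr_pdivlMr // => hn.
have bk k : cbdd (fun z => g z * z^* ^+ k) by exact: cbddM bg (cbdd_conjX k).
have -> : E (fun z => g z * (1 - q * z^*)^-1) =
   E (fun z => \sum_(k < n) q ^+ k * (g z * z^* ^+ k)) +
   E (fun z => q ^+ n * (z^* ^+ n * (g z * (1 - q * z^*)^-1))).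
  rewrite -meanD.
  - apply: mean_ext => z z1; have qz : nc (q * z^*) < 1 by rewrite nc_qconj.
    rewrite {1}(geom_expand n qz) mulrDr mulr_sumr; congr (_ + _).
      by apply: eq_bigr => k _; rewrite exprMn; ring.
    by rewrite exprMn; ring.
  - by apply: cbdd_sum => k; exact: cbddZ.
  - exact: cbddZ (cbddM (cbdd_conjX n) (cbddM bg (cbdd_szego q1))).
rewrite mean_sum; last by move=> k; exact: cbddZ.
rewrite [X in _ - (X + _)](eq_bigr (fun k : 'I_n => E (fun z => g z * z^* ^+ k) * q ^+ k)); last first.
  by move=> k _; rewrite meanZ // mulrC.
rewrite opprD addrA subrr add0r ncN; apply: le_lt_trans hn.
apply: mean_bound => z z1; rewrite ncM ncX ncM ncX nc_conj z1 expr1n mul1r.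
rewrite ler_wpM2l ?exprn_ge0 ?nc_ge0 //; apply: le_trans (hM z z1) _.
by apply: le_trans (ler_norm M) _; rewrite lerDl.
Qed.

Lemma mean_conjX k : E (fun z => z^* ^+ k) = (k == 0%N)%:R.
Proof. by rewrite eq_sym -mean_mono; apply: mean_ext => z _; rewrite expr0 mul1r. Qed.

Lemma mean_szego1 (q : C) : nc q < 1 -> E (fun z => (1 - q * z^*)^-1) = 1.
Proof.
move=> q1; have h := mean_szego (cbdd_cst 1) q1.
have -> : E (fun z => (1 - q * z^*)^-1) = E (fun z => 1 * (1 - q * z^*)^-1).
  by apply: mean_ext => z _; rewrite mul1r.
apply: cconv_unique h _; apply/cconvP => e e0; exists 1%N => -[//|n] _.
have e1 k : E (fun z => 1 * z^* ^+ k) = (k == 0%N)%:R.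
  by rewrite -mean_conjX; apply: mean_ext => z _; rewrite mul1r.
rewrite big_ord_recl /= e1 mul1r expr0 big1 ?addr0 ?subrr ?nc0 // => k _.
by rewrite e1 mul0r.
Qed.

(* Rotation by a root of unity permutes the nodes, so the increments of F sum to zero. *)
Lemma mean_rot (F D : C -> C) (K M rho : R) (p s : C) : quad_deriv K rho F D ->
  (forall u, nc u <= rho -> nc (D u) <= M) -> nc p + nc s <= rho -> 0 <= K ->
  E (fun z => s * D (p + s * z) * z) = 0.
Proof.
move=> qd bD ps K0.
have in_rho z : nc z = 1 -> nc (p + s * z) <= rho.
  by move=> z1; apply: le_trans (ncD _ _) _; rewrite ncM z1 mulr1.
apply: mean_tail.
  apply: cbddM (@cbdd_id R); apply: cbddZ; exists M => z z1; exact/bD/in_rho.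
move=> e e0; have k0 : 0 < K * nc s ^+ 2 + 1.
  by rewrite ltr_wpDl // mulr_ge0 ?sqr_ge0.
have [N hN] := @omega_near1 R _ (divr_gt0 e0 k0).
(* The shift makes [n] positive, so that [omega R n] differs from 1. *)
exists N.+1 => n nN; have := hN n (ltnW nN); rewrite ltr_pdivlMr // => lt.
have o1 : omega R n != 1.
  by rewrite -[omega R n]expr1; apply: omega_prim; rewrite /= ltnS (leq_trans _ nN).
have o0 : 0 < nc (omega R n - 1) by apply: nc_gt0; rewrite subr_eq0.
rewrite subr0; set w := omega R n in lt o1 o0 *.
(* An increment of [F] under the rotation is [(w - 1) * s * z] times [D], up to a multiple of
   [nc (w - 1) ^+ 2]. As the increments average to zero, dividing by [nc (w - 1)] leaves a bound
   that tends to zero. *)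
suff le : nc (w - 1) * nc (avg n (fun z => s * D (p + s * z) * z)) <=
          nc (w - 1) * (nc (w - 1) * (K * nc s ^+ 2)).
  move: le; rewrite ler_pM2l // => le; apply: le_lt_trans le _.
  by apply: le_lt_trans lt; rewrite ler_wpM2l ?nc_ge0 // lerDl.
pose G z := F (p + s * z).
have tel : avg n (fun z => G (w * z) - G z) = 0.
  rewrite /avg (eq_bigr (fun j : 'I_n.+1 => G (w ^+ j.+1) - G (w ^+ j))); last first.
    by move=> j _; rewrite exprS.
  rewrite -(big_mkord xpredT (fun j => G (w ^+ j.+1) - G (w ^+ j))).
  by rewrite telescope_sumr // /w omega_unity expr0 subrr mulr0.
have -> : nc (w - 1) * nc (avg n (fun z => s * D (p + s * z) * z)) =
    nc (avg n (fun z => (w - 1) * (s * D (p + s * z) * z) + (- (G (w * z) - G z)))).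
  rewrite avg_lin -ncM; congr nc; rewrite -[LHS]addr0; congr (_ + _).
  have := avg_lin n (-1) (fun z => G (w * z) - G z) (fun=> 0).
  rewrite tel mulr0 add0r {2}/avg big1 // mulr0 => <-.
  by apply: avg_ext => z _; rewrite addr0 mulN1r.
apply: avg_bound => z z1; rewrite -ncN.
have wz : nc (w * z) = 1 by rewrite ncM z1 nc_omega mulr1.
have := qd _ _ (in_rho z z1) (in_rho _ wz).
have -> : p + s * (w * z) - (p + s * z) = (w - 1) * (s * z) by ring.
rewrite !ncM z1 mulr1 -/(G _) -/(G _).
have -> : - ((w - 1) * (s * D (p + s * z) * z) + - (G (w * z) - G z)) =
  G (w * z) - G z - (w - 1) * (s * z) * D (p + s * z) by ring.
by move=> le; apply: le_trans le _; rewrite exprMn le_eqVlt; apply/orP; left; apply/eqP; ring.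
Qed.

(* The mean over the circles shrinking from |z| = r to the point w is constant, because its
   derivative vanishes by [mean_rot]. *)
Lemma cauchy_formula (F D : C -> C) (K M r : R) (w : C) : quad_deriv K r F D ->
  (forall u, nc u <= r -> nc (F u) <= M) -> (forall u, nc u <= r -> nc (D u) <= M) ->
  0 <= K -> nc w < r ->
  F w = E (fun z => F (toC r * z) * (1 - w / toC r * z^*)^-1).
Proof.
move=> qd bF bD K0 wr; have r0 : 0 < r by apply: le_lt_trans wr; exact: nc_ge0.
have rC : toC r != 0 by rewrite fmorph_eq0 gt_eqF.
set q := w / toC r; have q1 : nc q < 1.
  by rewrite ncM ncV nc_real gtr0_norm // ltr_pdivrMr // mul1r.
pose u (t : R) z := w + toC t * (toC r * z - w).
have ur t z : 0 <= t <= 1 -> nc z = 1 -> nc (u t z) <= r.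
  move=> t01 z1; apply: segment_disk t01; first exact: ltW.
  by rewrite ncM nc_real gtr0_norm // z1 mulr1.
pose phi t := E (fun z => F (u t z) * (1 - q * z^*)^-1).
have bphi t : 0 <= t <= 1 -> cbdd (fun z => F (u t z) * (1 - q * z^*)^-1).
  by move=> t01; apply: cbddM (cbdd_szego q1); exists M => z z1; exact/bF/ur.
(* The factor [toC r * z - w] is the derivative of [u] in [t]. It cancels the denominator of the
   kernel, and what is left is the integrand of [mean_rot]. *)
have kern z : nc z = 1 -> (toC r * z - w) * (1 - q * z^*)^-1 = toC r * z.
  move=> z1; have qz : nc (q * z^*) < 1 by rewrite nc_qconj.
  apply: (canLR (mulfK (neq0_1B qz))).
  have -> : toC r * z * (1 - q * z^*) = toC r * z - toC r * q * (z * z^*) by ring.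
  by rewrite circle_conj // mulr1 /q (mulrC (toC r) (w / _)) divfK.
have rot t : 0 <= t <= 1 -> E (fun z => D (u t z) * z) = 0.
  (* At [t = 0] the scale [t * r] in [mean_rot] vanishes and cannot be divided out; there [D] is
     evaluated at the constant point [w]. *)
  move=> t01; have [->|t0] := eqVneq t 0.
    rewrite (_ : E _ = E (fun z => D w * (z ^+ 1))).
      by rewrite meanZ ?mean_pow ?mulr0 //; exact: cbddX (@cbdd_id R).
    by apply: mean_ext => z _; rewrite /u rmorph0 mul0r addr0 expr1.
  have s0 : toC t * toC r != 0 by rewrite mulf_neq0 // fmorph_eq0.
  apply: (mulfI s0); rewrite mulr0 -meanZ; last first.
    by apply: cbddM (@cbdd_id R); exists M => z z1; exact/bD/ur.
  have [tge tle] := andP t01.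
  rewrite -[RHS](mean_rot (p := (1 - toC t) * w) (s := toC t * toC r) qd bD) //.
    apply: mean_ext => z _; rewrite mulrA; congr (_ * D _ * _); rewrite /u; ring.
  have -> : 1 - toC t = toC (1 - t) by rewrite rmorphB rmorph1.
  rewrite !ncM !nc_real (ger0_norm tge) (gtr0_norm r0) ger0_norm ?subr_ge0 //.
  have : 0 <= 1 - t by rewrite subr_ge0.
  move=> /ler_wpM2l/(_ _ _ (ltW wr)); lra.
have dphi : deriv01 phi (fun=> 0).
  apply: (@deriv01_quad _ _ _ (K * (r * (2 * r)))).
    by rewrite !mulr_ge0 // ltW.
  move=> s t s01 t01; rewrite mulr0 subr0 /phi -meanB; [|exact: bphi|exact: bphi].
  pose A z := toC (s - t) * (toC r * (D (u t z) * z)).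
  have bDz : cbdd (fun z => D (u t z) * z).
    by apply: cbddM (@cbdd_id R); exists M => z z1; exact/bD/ur.
  have EA : E A = 0 by rewrite !meanZ ?rot ?mulr0 //; exact: cbddZ.
  rewrite -[X in nc X]subr0 -EA -meanB; last by do 2 apply: cbddZ.
    apply: mean_bound => z z1.
    have qz : nc (q * z^*) < 1 by rewrite nc_qconj.
    have hu := qd _ _ (ur t z t01 z1) (ur s z s01 z1).
    have Eu : u s z - u t z = toC (s - t) * (toC r * z - w).
      by rewrite /u rmorphB /=; ring.
    rewrite Eu in hu.
    have -> : F (u s z) * (1 - q * z^*)^-1 - F (u t z) * (1 - q * z^*)^-1 - A z =
       (F (u s z) - F (u t z) - toC (s - t) * (toC r * z - w) * D (u t z)) * (1 - q * z^*)^-1.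
      rewrite !mulrBl; congr (_ - _).
      transitivity (toC (s - t) * D (u t z) * (toC r * z)); first by rewrite /A; ring.
      by rewrite -[toC r * z in LHS](kern z z1); ring.
    rewrite ncM; apply: le_trans (ler_wpM2r (nc_ge0 _) hu) _.
    have XI : nc (toC r * z - w) * nc (1 - q * z^*)^-1 = r.
      by rewrite -ncM kern // ncM z1 mulr1 nc_real gtr0_norm.
    have X2 : nc (toC r * z - w) <= 2 * r.
      apply: le_trans (ncBD _ _) _; rewrite ncM z1 mulr1 nc_real gtr0_norm //.
      by move: wr; lra.
    rewrite ncM nc_real; move: XI X2; set X := nc _; set I := nc _ => XI X2.
    have -> : K * (`|s - t| * X) ^+ 2 * I = K * (r * X) * `|s - t| ^+ 2.
      by rewrite -[in RHS]XI; ring.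
    rewrite ler_wpM2r ?sqr_ge0 // ler_wpM2l // ler_wpM2l //; exact: ltW.
  exact: cbddB (bphi s s01) (bphi t t01).
have h : nc (phi 1 - phi 0) <= 0.
  by apply: (deriv01_lipschitz dphi) => t _; rewrite nc0.
have {}h : phi 1 = phi 0.
  by apply/eqP; rewrite -subr_eq0; apply/eqP/nc_eq0/eqP; rewrite eq_le h nc_ge0.
have <- : phi 0 = F w.
  rewrite /phi (_ : E _ = E (fun z => F w * (1 - q * z^*)^-1)).
    by rewrite meanZ ?mean_szego1 ?mulr1 //; exact: cbdd_szego.
  by apply: mean_ext => z _; rewrite /u rmorph0 mul0r addr0.
rewrite -h; apply: mean_ext => z _; congr (F _ * _).
by rewrite /u rmorph1 mul1r addrC subrK.
Qed.

Definition ps_rep (r : R) (f : C -> C) (a : nat -> C) := forall w, nc w < r ->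
  cconv (fun n => \sum_(k < n) a k * w ^+ k) (f w).

Lemma sum_tail_bound (a : nat -> C) (w : C) (M t s : R) (n m : nat) :
  0 < t -> 0 <= s < t -> nc w <= s -> (forall k, nc (a k) * t ^+ k <= M) ->
  nc (\sum_(k < n + m) a k * w ^+ k - \sum_(k < n) a k * w ^+ k)
    <= M * (s / t) ^+ n * (1 - s / t)^-1.
Proof.
move=> t0 /andP[s0 st] ws hM.
have q0 : 0 <= s / t by rewrite divr_ge0 // ltW.
have q1 : s / t < 1 by rewrite ltr_pdivrMr // mul1r.
have M0 : 0 <= M by apply: le_trans (hM 0%N); rewrite mulr_ge0 ?nc_ge0 ?exprn_ge0 // ltW.
rewrite big_split_ord /= addrAC subrr add0r.
apply: le_trans (nc_sum _ _ _) _.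
apply: le_trans (ler_sum (G := fun k : 'I_m => M * (s / t) ^+ n * (s / t) ^+ k) _ _) _.
  move=> k _; rewrite ncM ncX -mulrA -exprD.
  have -> : (s / t) ^+ (n + k) = (t ^+ (n + k))^-1 * s ^+ (n + k).
    by rewrite expr_div_n mulrC.
  rewrite mulrA; apply: ler_pM; rewrite ?nc_ge0 ?exprn_ge0 ?nc_ge0 //.
    by rewrite ler_pdivlMr ?exprn_gt0.
  by rewrite lerXn2r ?nnegrE ?nc_ge0.
rewrite -mulr_sumr ler_wpM2l ?mulr_ge0 ?exprn_ge0 //.
have p0 : 0 < 1 - s / t by rewrite subr_gt0.
rewrite -[(1 - s / t)^-1]mul1r ler_pdivlMr // mulrC.
have := subrX1 (s / t) m; set S := \sum_(i < m) _ => h.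
have -> : (1 - s / t) * S = - ((s / t - 1) * S) by ring.
rewrite -h opprB.
by rewrite lerBlDr lerDl exprn_ge0.
Qed.

Lemma ps_terms_bounded (r t : R) f a : ps_rep r f a -> 0 <= t < r ->
  exists M, forall k, nc (a k) * t ^+ k <= M.
Proof.
move=> h /andP[t0 tr]; have [|M hM] := cconv_bounded (h (toC t) _).
  by rewrite nc_real ger0_norm.
exists (M + M) => k.
have -> : nc (a k) * t ^+ k = nc (\sum_(j < k.+1) a j * toC t ^+ j - \sum_(j < k) a j * toC t ^+ j).
  by rewrite big_ord_recr /= addrAC subrr add0r ncM ncX nc_real ger0_norm.
by apply: le_trans (ncBD _ _) _; rewrite lerD.
Qed.

(** The terms are bounded at a radius [t] between [s] and [r], so for [nc z <= s] the tails are
    dominated by a geometric series of ratio [s / t]. *)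
Lemma ps_uniform (r s : R) f a : ps_rep r f a -> 0 <= s < r -> forall e, 0 < e ->
  exists N, forall n, (N <= n)%N -> forall z, nc z <= s ->
    nc (f z - \sum_(k < n) a k * z ^+ k) <= e.
Proof.
move=> h /andP[s0 sr] e e0; pose t := (s + r) / 2.
have st : s < t by rewrite /t; lra.
have tr : t < r by rewrite /t; lra.
have t0 : 0 < t by apply: le_lt_trans st.
have [|M hM] := ps_terms_bounded (t := t) h; first by rewrite tr ltW.
have M0 : 0 <= M by apply: le_trans (hM 0%N); rewrite mulr_ge0 ?nc_ge0 ?exprn_ge0 // ltW.
have q0 : 0 <= s / t by rewrite divr_ge0 // ltW.
have q1 : s / t < 1 by rewrite ltr_pdivrMr // mul1r.
have p0 : 0 < 1 - s / t by rewrite subr_gt0.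
have k0 : 0 < (M + 1) * (1 - s / t)^-1 by rewrite mulr_gt0 ?invr_gt0 // ltr_wpDl.
have [|N hN] := @pow_small (s / t) (e / ((M + 1) * (1 - s / t)^-1)) _ (divr_gt0 e0 k0).
  by rewrite q0.
exists N => n nN z zs.
have zr : nc z < r by apply: le_lt_trans zs sr.
apply/ler_addgt0Pr => e' e'0.
have /cconvP/(_ _ e'0)[N' hN'] := h z zr.
have := hN' (n + N')%N (leq_addl _ _); rewrite ncB.
have := sum_tail_bound (a := a) (w := z) (M := M) n N' t0 _ zs hM.
rewrite s0 st => /(_ isT) tail.
have : M * (s / t) ^+ n * (1 - s / t)^-1 <= e.
  have := ltW (hN n nN); rewrite ler_pdivlMr // => le; apply: le_trans le.
  have Q0 : 0 <= (s / t) ^+ n by exact: exprn_ge0.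
  have I0 : 0 <= (1 - s / t)^-1 by rewrite invr_ge0 ltW.
  have := mulr_ge0 Q0 I0; set Q := _ ^+ n; set I := _^-1; lra.
have := nc_trans (\sum_(k < n + N') a k * z ^+ k) (f z) (\sum_(k < n) a k * z ^+ k).
lra.
Qed.

Lemma ps_bounded (r s : R) f a : ps_rep r f a -> 0 <= s < r ->
  exists M, forall z, nc z <= s -> nc (f z) <= M.
Proof.
move=> h sr; have [N /(_ N (leqnn N)) hN] := ps_uniform h sr ltr01.
exists (1 + \sum_(k < N) nc (a k) * s ^+ k) => z zs.
have := hN z zs; have := nc_lerB (f z) (\sum_(k < N) a k * z ^+ k).
suff : nc (\sum_(k < N) a k * z ^+ k) <= \sum_(k < N) nc (a k) * s ^+ k by lra.
apply: le_trans (nc_sum _ _ _) _; apply: ler_sum => k _.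
by rewrite ncM ncX ler_wpM2l ?nc_ge0 // lerXn2r ?nnegrE ?nc_ge0 //; case/andP: sr.
Qed.

Lemma mean_ps (r s : R) f a (g : C -> C) : ps_rep r f a -> 0 <= s < r -> cbdd g ->
  cconv (fun n => \sum_(k < n) a k * toC s ^+ k * E (fun z => z ^+ k * g z))
        (E (fun z => f (toC s * z) * g z)).
Proof.
move=> h sr bg; have [s0 s1] := andP sr; have [M hM] := bg.
have Ms : 0 < `|M| + 1 by rewrite ltr_wpDl.
have [B hB] := ps_bounded h sr.
have in_s z : nc z = 1 -> nc (toC s * z) <= s by move=> z1; rewrite ncM z1 mulr1 nc_real ger0_norm.
apply/cconvP => e e0.
have e2 : 0 < e / 2 by rewrite divr_gt0.
have [N hN] := ps_uniform h sr (divr_gt0 e2 Ms); exists N => n nN.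
have bz k : cbdd (fun z => z ^+ k * g z) by exact: cbddM (cbddX k (@cbdd_id R)) bg.
rewrite (eq_bigr (fun k : 'I_n => E (fun z => a k * toC s ^+ k * (z ^+ k * g z)))); last first.
  by move=> k _; rewrite meanZ.
rewrite -(@mean_sum R _ _ (fun (k : 'I_n) z => a k * toC s ^+ k * (z ^+ k * g z)));
  last by move=> k; exact: cbddZ.
rewrite ncB -meanB; last by apply: cbdd_sum => k; exact: cbddZ.
  apply: le_lt_trans (_ : e / 2 < e); last by lra.
  apply: mean_bound => z z1.
  have := hN n nN _ (in_s z z1); rewrite ler_pdivlMr // => le.
  have -> : f (toC s * z) * g z - \sum_(k < n) a k * toC s ^+ k * (z ^+ k * g z) =
    (f (toC s * z) - \sum_(k < n) a k * (toC s * z) ^+ k) * g z.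
    rewrite mulrBl mulr_suml; congr (_ - _); apply: eq_bigr => k _.
    by rewrite exprMn; ring.
  rewrite ncM; apply: le_trans le; rewrite ler_wpM2l ?nc_ge0 //.
  by apply: le_trans (hM z z1) _; apply: le_trans (ler_norm M) _; rewrite lerDl.
by apply: cbddM bg; exists B => z z1; exact/hB/in_s.
Qed.

Lemma cconv_const_tail (u : nat -> C) l N : (forall n, (N <= n)%N -> u n = l) -> cconv u l.
Proof. by move=> h; apply/cconvP => e e0; exists N => n /h ->; rewrite subrr nc0. Qed.

(** Cauchy's coefficient formula. It shows that the values of [f] on one circle of positive radius
    determine the coefficients, which are therefore unique. *)
Lemma ps_coef (r s : R) f a k : ps_rep r f a -> 0 <= s < r ->
  E (fun z => f (toC s * z) * z^* ^+ k) = a k * toC s ^+ k.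
Proof.
move=> h sr; apply: cconv_unique (mean_ps h sr (cbdd_conjX k)) _.
apply: (@cconv_const_tail _ _ k.+1) => n kn.
rewrite (bigD1 (Ordinal kn)) //= mean_mono eqxx mulr1 big1 ?addr0 // => j hj.
rewrite mean_mono; move: hj; rewrite -val_eqE /= => /negPf ->.
by rewrite mulr0.
Qed.

End PowerSeries.

(** * Power series of bounded holomorphic functions *)

Section Holomorphic.
Variable R : realType.
Local Notation C := R[i].
Local Notation nc := (@Defs.normc R).
Local Notation toC := (real_complex R).
Local Notation E := (@circle_mean R).
Local Notation J := (@segment_integral R).

Lemma quad_deriv_mean (G : C -> C) (A B : C -> C -> C) (K M rho : R) :
  (forall z, nc z = 1 -> nc (G z) <= M) -> 0 <= K ->
  (forall u, nc u <= rho -> cbdd (A u)) -> (forall u, nc u <= rho -> cbdd (B u)) ->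
  (forall u v z, nc u <= rho -> nc v <= rho -> nc z = 1 ->
     nc (A v z - A u z - (v - u) * B u z) <= K * nc (v - u) ^+ 2) ->
  quad_deriv (M * K) rho (fun w => E (fun z => G z * A w z)) (fun w => E (fun z => G z * B w z)).
Proof.
move=> hM K0 bA bB h u v hu hv; have bG : cbdd G by exists M.
have b1 w : nc w <= rho -> cbdd (fun z => G z * A w z) by move=> hw; exact: cbddM bG (bA _ hw).
have b2 : cbdd (fun z => G z * B u z) by exact: cbddM bG (bB _ hu).
rewrite -meanB; [|exact: b1|exact: b1]; rewrite -meanZ // -meanB; last exact: cbddZ.
  apply: mean_bound => z z1.
  have -> : G z * A v z - G z * A u z - (v - u) * (G z * B u z) =
     G z * (A v z - A u z - (v - u) * B u z) by ring.
  by rewrite ncM -mulrA; apply: ler_pM; rewrite ?nc_ge0 ?hM ?h.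
by apply: cbddB; exact: b1.
Qed.

Lemma deriv_unique (F D : C -> C) (K rho : R) (z l : C) : rho <= 1 -> 0 <= K ->
  quad_deriv K rho F D -> nc z < rho -> has_deriv F z l -> D z = l.
Proof.
move=> rho1 K0 qd zr hl; apply/eqP; rewrite -subr_eq0; apply/eqP/nc_eq0/eqP.
rewrite eq_le nc_ge0 andbT; apply: (@real_eps0 R _ (K + 1)); first by rewrite addr_ge0.
move=> e e0; have [d d0 hd] := hl e e0.
(* [h] is at most [e], to absorb the error [K * h], and small enough for [w] to stay within distance
   [d] of [z] and inside the disk of radius [rho]. *)
pose h := Num.min e (Num.min (d / 2) ((rho - nc z) / 2)).
have h0 : 0 < h by rewrite !lt_min e0 !divr_gt0 // subr_gt0.
have he : h <= e by rewrite ge_min lexx.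
have hh : h <= d / 2 by rewrite !ge_min lexx orbT.
have hr : h <= (rho - nc z) / 2 by rewrite !ge_min lexx !orbT.
pose w := z + toC h.
have wz : nc (w - z) = h by rewrite /w addrC addKr nc_real gtr0_norm.
have wr : nc w < rho.
  by apply: le_lt_trans (ncD _ _) _; rewrite nc_real gtr0_norm //; lra.
have h1 := qd z w (ltW zr) (ltW wr).
have h2 : nc (F w - F z - (w - z) * l) <= e * nc (w - z).
  by apply: hd; rewrite ?wz; lra.
rewrite wz in h1 h2.
have : h * nc (D z - l) <= h * ((K + 1) * e).
  have -> : h * nc (D z - l) = nc ((w - z) * (D z - l)) by rewrite ncM wz.
  have -> : (w - z) * (D z - l) = (F w - F z - (w - z) * l) - (F w - F z - (w - z) * D z).
    by ring.
  apply: le_trans (ncBD _ _) _; apply: le_trans (lerD h2 h1) _.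
  have : h * (K * h) <= h * (K * e) by rewrite ler_pM2l // ler_wpM2l.
  rewrite expr2; lra.
by rewrite ler_pM2l.
Qed.

(** * Powers of the resolvent and their uniform derivatives *)

Section Resolvent.
Variables (r rho : R).
Hypotheses (rho0 : 0 <= rho) (rho_r : rho < r).
Let X := (r - rho)^-1.
Let r0 : 0 < r := le_lt_trans rho0 rho_r.

Definition resolv (w z : C) : C := (toC r * z - w)^-1.

Lemma resolv_den w z : nc w <= rho -> nc z = 1 ->
  r - rho <= nc (toC r * z - w) /\ toC r * z - w != 0.
Proof.
move=> hw z1.
have le : r - rho <= nc (toC r * z - w).
  apply: le_trans (nc_lerB _ _); rewrite ncM nc_real z1 mulr1 gtr0_norm //.
  by rewrite lerD2l lerN2.
split=> //; apply: contraTneq le => ->.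
by rewrite nc0 -ltNge subr_gt0.
Qed.

Lemma resolv_bound w z : nc w <= rho -> nc z = 1 -> nc (resolv w z) <= X.
Proof.
move=> hw z1; have [h _] := resolv_den hw z1.
rewrite ncV lef_pV2 // posrE ?subr_gt0 //; apply: lt_le_trans h.
by rewrite subr_gt0.
Qed.

Lemma resolv_diff u v z : nc u <= rho -> nc v <= rho -> nc z = 1 ->
  resolv v z - resolv u z = (v - u) * resolv u z * resolv v z.
Proof.
move=> hu hv z1; have [_ nu] := resolv_den hu z1; have [_ nv] := resolv_den hv z1.
by rewrite /resolv; field; rewrite nu nv.
Qed.

Lemma cbdd_resolvX w n : nc w <= rho -> cbdd (fun z => resolv w z ^+ n).
Proof. by move=> hw; apply: cbddX; exists X => z z1; exact: resolv_bound. Qed.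

Lemma resolv_bound_ge0 : 0 <= X. Proof. by rewrite invr_ge0 subr_ge0 ltW. Qed.

(** With [x], [y] the two resolvents and [h = v - u], the resolvent identity reads
    [y - x = h * x * y]. Modulo this identity the remainder is [h ^+ 2] times a polynomial in [x]
    and [y], each of which is bounded by [X]. The same works for the next two powers, where the
    constants 3 and 12 are the sums of the coefficients of these polynomials. *)
Lemma resolv_quad1 u v z : nc u <= rho -> nc v <= rho -> nc z = 1 ->
  nc (resolv v z - resolv u z - (v - u) * resolv u z ^+ 2) <= X ^+ 3 * nc (v - u) ^+ 2.
Proof.
move=> hu hv z1; have /eqP := resolv_diff hu hv z1.
have := resolv_bound hu z1; have := resolv_bound hv z1; have X0 := resolv_bound_ge0.
set x := resolv u z; set y := resolv v z; set h := v - u => hy hx.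
rewrite -subr_eq0 => /eqP e.
have -> : y - x - h * x ^+ 2 = (y - x - h * x * y) * (1 + h * x) + x * x * y * h ^+ 2 by ring.
rewrite e mul0r add0r (ncM _ (h ^+ 2)) ncX ler_wpM2r ?sqr_ge0 // !ncM.
by rewrite !exprS expr0 mulr1 mulrA; do 2 (apply: ler_pM => //; rewrite ?mulr_ge0 ?nc_ge0 //).
Qed.

Lemma resolv_quad2 u v z : nc u <= rho -> nc v <= rho -> nc z = 1 ->
  nc (resolv v z ^+ 2 - resolv u z ^+ 2 - (v - u) * (2 * resolv u z ^+ 3))
    <= 3 * X ^+ 4 * nc (v - u) ^+ 2.
Proof.
move=> hu hv z1; have /eqP := resolv_diff hu hv z1.
have := resolv_bound hu z1; have := resolv_bound hv z1; have X0 := resolv_bound_ge0.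
set x := resolv u z; set y := resolv v z; set h := v - u => hy hx.
rewrite -subr_eq0 => /eqP e.
have -> : y ^+ 2 - x ^+ 2 - h * (2 * x ^+ 3) =
  (y - x - h * x * y) * ((y + x) + h * x * (y + 2 * x)) + (x * x * y * (y + 2 * x)) * h ^+ 2.
  by ring.
rewrite e mul0r add0r (ncM _ (h ^+ 2)) ncX ler_wpM2r ?sqr_ge0 // !ncM.
have hs : nc (y + 2 * x) <= 3 * X.
  by apply: le_trans (ncD _ _) _; rewrite ncM nc_nat; lra.
have -> : 3 * X ^+ 4 = X * X * X * (3 * X) by ring.
by do 3 (apply: ler_pM => //; rewrite ?mulr_ge0 ?nc_ge0 //).
Qed.

Lemma resolv_quad3 u v z : nc u <= rho -> nc v <= rho -> nc z = 1 ->
  nc (2 * resolv v z ^+ 3 - 2 * resolv u z ^+ 3 - (v - u) * (6 * resolv u z ^+ 4))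
    <= 12 * X ^+ 5 * nc (v - u) ^+ 2.
Proof.
move=> hu hv z1; have /eqP := resolv_diff hu hv z1.
have := resolv_bound hu z1; have := resolv_bound hv z1; have X0 := resolv_bound_ge0.
set x := resolv u z; set y := resolv v z; set h := v - u => hy hx.
rewrite -subr_eq0 => /eqP e.
have -> : 2 * y ^+ 3 - 2 * x ^+ 3 - h * (6 * x ^+ 4) =
  (y - x - h * x * y) * (2 * (x ^+ 2 + x * y + y ^+ 2) + 2 * h * x * (y ^+ 2 + 2 * x * y + 3 * x ^+ 2))
  + (x * x * y * (2 * (y * y + 2 * (x * y) + 3 * (x * x)))) * h ^+ 2.
  by ring.
rewrite e mul0r add0r (ncM _ (h ^+ 2)) ncX ler_wpM2r ?sqr_ge0 // !ncM nc_nat.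
have hp a b : nc a <= X -> nc b <= X -> nc (a * b) <= X * X.
  by move=> ha hb; rewrite ncM; apply: ler_pM; rewrite ?nc_ge0.
have hs : 2 * nc (y * y + 2 * (x * y) + 3 * (x * x)) <= 12 * (X * X).
  have := ncD (y * y + 2 * (x * y)) (3 * (x * x)); have := ncD (y * y) (2 * (x * y)).
  rewrite (ncM 2) (ncM 3) !nc_nat.
  by have := hp y y hy hy; have := hp x y hx hy; have := hp x x hx hx; lra.
have -> : 12 * X ^+ 5 = X * X * X * (12 * (X * X)) by ring.
by do 3 (apply: ler_pM => //; rewrite ?mulr_ge0 ?nc_ge0 //).
Qed.

End Resolvent.

Lemma quad_deriv_ext (K rho rho' : R) (F G D D' : C -> C) : rho' <= rho ->
  (forall u, nc u <= rho' -> F u = G u) -> (forall u, nc u <= rho' -> D u = D' u) ->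
  quad_deriv K rho F D -> quad_deriv K rho' G D'.
Proof.
move=> le FG DD qd u v hu hv; rewrite -!FG // -DD //.
by apply: qd; apply: le_trans le.
Qed.

(* The first primitive of f is Lipschitz, so the second one is uniformly differentiable and
   satisfies Cauchy's formula; differentiating that formula twice recovers f. *)
Lemma holo_smooth (f : C -> C) (rho : R) : holo f -> (forall z, nc (f z) <= 1) ->
  0 <= rho < 1 -> exists K M D, [/\ 0 <= K, quad_deriv K rho f D &
     forall u, nc u <= rho -> nc (D u) <= M].
Proof.
move=> hf f1 /andP[rho0 rho1].
pose F1 := J f 0; pose F2 := J F1 0.
have hF1 : holo F1 by move=> z z1; exists (f z); exact: primitive_deriv.
have lF1 z w : nc z < 1 -> nc w < 1 -> nc (F1 w - F1 z) <= nc (w - z).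
  exact: primitive_lipschitz.
(* A derivative is identified by [deriv_unique] only strictly inside the disk where the formula
   holds, so every differentiation costs some radius: [r] for Cauchy's formula, then [rho3], [rho2]
   and finally [rho]. *)
pose rho2 := rho + (1 - rho) / 4; pose rho3 := rho + (1 - rho) / 2.
pose r := rho + (1 - rho) * 3 / 4.
have l1 : rho < rho2 by rewrite /rho2; lra.
have l2 : rho2 < rho3 by rewrite /rho2 /rho3; lra.
have l3 : rho3 < r by rewrite /rho3 /r; lra.
have r1 : r < 1 by rewrite /r; lra.
have rho30 : 0 <= rho3 by lra.
have r0 : 0 < r by lra.
have rC : toC r != 0 by rewrite fmorph_eq0 gt_eqF.
have q2 : quad_deriv 1 r F2 F1 by exact: primitive_quad.
have o1 : nc (0 : C) < 1 by rewrite nc0.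
have bF1 z : nc z <= r -> nc (F1 z) <= nc (F1 0) + 1.
  move=> zr; have z1 : nc z < 1 by lra.
  have := lF1 0 z o1 z1; have := nc_lerB (F1 z) (F1 0); rewrite subr0; lra.
have bF2 z : nc z <= r -> nc (F2 z) <= nc (F2 0) + nc (F1 0) + 1.
  move=> zr; have z1 : nc z < 1 by lra.
  have := q2 0 z (ltW _) zr; rewrite nc0 => /(_ r0); rewrite subr0 mul1r.
  have := nc_lerB (F2 z - F2 0) (z * F1 0); have := nc_lerB (F2 z) (F2 0).
  have : nc z ^+ 2 <= 1 by rewrite exprn_ile1 ?nc_ge0 // ltW.
  have : nc z * nc (F1 0) <= nc (F1 0) by rewrite ler_piMl ?nc_ge0 // ltW.
  rewrite ncM; lra.
(* On the circle the kernel of Cauchy's formula is [toC r * z * resolv r w z]. The factor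
   [toC r * z] is absorbed into [G], so that [w] enters through the resolvent only. *)
pose G z := F2 (toC r * z) * (toC r * z).
have [M hM] : cbdd G.
  apply: cbddM (cbddZ _ (@cbdd_id R)); exists (nc (F2 0) + nc (F1 0) + 1) => z z1.
  by apply: bF2; rewrite ncM z1 mulr1 nc_real gtr0_norm.
have M0 : 0 <= M by apply: le_trans (nc_ge0 _) (hM 1 (nc1 R)).
have repF2 w : nc w < r -> F2 w = E (fun z => G z * resolv r w z).
  move=> wr.
  rewrite (@cauchy_formula R F2 F1 1 (nc (F2 0) + nc (F1 0) + 1) r w) //; last first.
    by move=> u hu; apply: le_trans (bF1 u hu) _; have := nc_ge0 (F2 0); lra.
  apply: mean_ext => z z1; rewrite /G -[RHS]mulrA; congr (_ * _).
  have z0 : z != 0 by apply: contraTneq isT => zz; move: z1; rewrite zz nc0 => /eqP; rewrite eq_sym oner_eq0.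
  have zc : z^* = z^-1.
    by apply: (mulfI z0); rewrite circle_conj // divff.
  have [|_ den] := @resolv_den r (nc w) (nc_ge0 _) wr w z (lexx _); first by [].
  by rewrite zc /resolv; field; rewrite z0 rC den.
pose X := (r - rho3)^-1.
have X0 : 0 <= X by rewrite invr_ge0; lra.
have bA n (c : C) u : nc u <= rho3 -> cbdd (fun z => c * resolv r u z ^+ n).
  by move=> hu; apply: cbddZ; exact: cbdd_resolvX hu.
have Q1 : quad_deriv (M * X ^+ 3) rho3 (fun w => E (fun z => G z * resolv r w z))
    (fun w => E (fun z => G z * resolv r w z ^+ 2)).
  apply: quad_deriv_mean => //; first by rewrite exprn_ge0.
  - by move=> u hu; have := cbdd_resolvX rho30 l3 1 hu.
  - by move=> u hu; exact: cbdd_resolvX hu.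
  - by move=> *; exact: resolv_quad1.
have Q2 : quad_deriv (M * (3 * X ^+ 4)) rho3 (fun w => E (fun z => G z * resolv r w z ^+ 2))
    (fun w => E (fun z => G z * (2 * resolv r w z ^+ 3))).
  apply: quad_deriv_mean => //; first by rewrite mulr_ge0 ?exprn_ge0.
  - by move=> u hu; exact: cbdd_resolvX hu.
  - by move=> u hu; exact: bA.
  - by move=> *; exact: resolv_quad2.
have Q3 : quad_deriv (M * (12 * X ^+ 5)) rho3 (fun w => E (fun z => G z * (2 * resolv r w z ^+ 3)))
    (fun w => E (fun z => G z * (6 * resolv r w z ^+ 4))).
  apply: quad_deriv_mean => //; first by rewrite mulr_ge0 ?exprn_ge0.
  - by move=> u hu; exact: bA.
  - by move=> u hu; exact: bA.
  - by move=> *; exact: resolv_quad3.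
have E1 u : nc u < rho3 -> E (fun z => G z * resolv r u z ^+ 2) = F1 u.
  move=> hu; have : has_deriv F2 u (F1 u) by apply: primitive_deriv => //; lra.
  apply: (@deriv_unique F2 (fun w => E (fun z => G z * resolv r w z ^+ 2)) (M * X ^+ 3) rho3) => //.
  - lra.
  - by rewrite mulr_ge0 ?exprn_ge0.
  - apply: quad_deriv_ext Q1 => // w hw; rewrite repF2 //; lra.
have E2 u : nc u < rho2 -> E (fun z => G z * (2 * resolv r u z ^+ 3)) = f u.
  move=> hu; have : has_deriv F1 u (f u) by apply: primitive_deriv => //; lra.
  apply: (@deriv_unique F1 (fun w => E (fun z => G z * (2 * resolv r w z ^+ 3)))
    (M * (3 * X ^+ 4)) rho2) => //.
  - lra.
  - by rewrite !mulr_ge0 ?exprn_ge0.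
  - apply: quad_deriv_ext Q2 => // [|w hw]; first exact: ltW.
    by rewrite E1 //; lra.
exists (M * (12 * X ^+ 5)), (M * (6 * X ^+ 4)), (fun w => E (fun z => G z * (6 * resolv r w z ^+ 4))).
split.
- by rewrite !mulr_ge0 ?exprn_ge0.
- apply: quad_deriv_ext Q3 => // [|u hu]; first by lra.
  by rewrite E2 //; lra.
- move=> u hu; have hu3 : nc u <= rho3 by lra.
  apply: mean_bound => z z1; rewrite ncM ncM nc_nat ncX.
  apply: ler_pM; rewrite ?nc_ge0 ?mulr_ge0 ?exprn_ge0 ?nc_ge0 ?hM //.
  rewrite ler_pM2l // lerXn2r ?nnegrE ?nc_ge0 //.
  exact: resolv_bound.
Qed.

Lemma holo_power_series (f : C -> C) : holo f -> (forall z, nc (f z) <= 1) ->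
  exists a, ps_rep 1 f a.
Proof.
move=> hf f1.
have rep r : 0 < r < 1 -> exists a, ps_rep r f a.
  move=> /andP[r0 r1]; have [|K [M [D [K0 qd bD]]]] := @holo_smooth f r hf f1.
    by rewrite ltW.
  exists (fun k => E (fun z => f (toC r * z) * z^* ^+ k) / toC r ^+ k) => w wr.
  rewrite (@cauchy_formula R f D K (`|M| + 1) r w) //; last first.
  - by move=> u hu; apply: le_trans (bD u hu) _; apply: le_trans (ler_norm M) _; rewrite lerDl.
  - by move=> u hu; apply: le_trans (f1 u) _; rewrite lerDr.
  have q1 : nc (w / toC r) < 1.
    by rewrite ncM ncV nc_real gtr0_norm // ltr_pdivrMr // mul1r.
  have bf : cbdd (fun z => f (toC r * z)) by exists 1 => z _.
  apply: cconv_ext (mean_szego bf q1) => n; apply: eq_bigr => k _.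
  by rewrite expr_div_n; ring.
(* The coefficients are read off on the circle of radius 1/4. For each [w] there is a series valid
   up to a radius [r] that exceeds [nc w] and is at least 1/2, and by [ps_coef] it has these same
   coefficients. *)
exists (fun k => E (fun z => f (toC (1 / 4) * z) * z^* ^+ k) / toC (1 / 4) ^+ k) => w w1.
pose r := Num.max (1 / 2) ((nc w + 1) / 2).
have r1 : 0 < r < 1 by rewrite lt_max gt_max; apply/andP; split; [apply/orP; left|apply/andP; split]; lra.
have r4 : 0 <= (1 / 4 : R) < r by rewrite lt_max; apply/andP; split; [|apply/orP; left]; lra.
have wr : nc w < r by rewrite lt_max; apply/orP; right; lra.
have [a ha] := rep r r1.
apply: cconv_ext (ha w wr) => n; apply: eq_bigr => k _; congr (_ * _).
rewrite (ps_coef _ ha r4) mulfK // expf_neq0 // fmorph_eq0; lra.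
Qed.

End Holomorphic.

(** * Reproducing kernel Hilbert spaces *)

Section RKHS.
Variable R : realType.
Local Notation C := R[i].
Local Notation D := (disk R).
Local Notation nc := (@Defs.normc R).
Local Notation toC := (real_complex R).
Variables (K : D -> D -> C) (H : (D -> C) -> Prop) (ip : (D -> C) -> (D -> C) -> C).
Hypothesis HK : is_RKHS K H ip.
Local Notation nrm := (hnorm ip).
Implicit Types (f g k : D -> C).

Lemma H_lin a f g : H f -> H g -> H (fun z => a * f z + g z).
Proof. by case: HK => h _; exact: h. Qed.
Lemma ip_lin a f g k : H f -> H g -> H k -> ip (fun z => a * f z + g z) k = a * ip f k + ip g k.
Proof. by case: HK => _ [h _]; exact: h. Qed.
Lemma ip_sym f g : H f -> H g -> ip g f = (ip f g)^*.
Proof. by case: HK => _ [_ [h _]]; exact: h. Qed.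
Lemma ip_ge0 f : H f -> 0 <= ip f f.
Proof. by case: HK => _ [_ [_ [h _]]]; exact: h. Qed.
Lemma ip_eq0 f : H f -> ip f f = 0 -> f = (fun=> 0).
Proof. by case: HK => _ [_ [_ [_ [h _]]]]; exact: h. Qed.
Lemma H_complete (u : nat -> D -> C) : (forall n, H (u n)) ->
  (forall e : R, 0 < e -> exists N, forall m n, (N <= m)%N -> (N <= n)%N ->
     nrm (fun z => u m z - u n z) < e) ->
  exists f, H f /\ forall e, 0 < e -> exists N, forall n, (N <= n)%N -> nrm (fun z => u n z - f z) < e.
Proof.
case: HK => _ [_ [_ [_ [_ [h _]]]]] Hu /(h u Hu) [f [Hf cf]]; exists f; split=> // e e0.
move/cvgrPdist_lt: cf => /(_ e e0)[N _ hN]; exists N => n /hN /=.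
by rewrite sub0r normrN ger0_norm // sqrtr_ge0.
Qed.
Lemma H_K w : H (K^~ w).
Proof. by case: HK => _ [_ [_ [_ [_ [_ [h _]]]]]]; exact: h. Qed.
Lemma ip_K f w : H f -> ip f (K^~ w) = f w.
Proof. by case: HK => _ [_ [_ [_ [_ [_ [_ h]]]]]]; exact: h. Qed.

Lemma disk0_lt : nc 0 < 1. Proof. by rewrite nc0. Qed.
Definition disk0 : D := exist _ 0 disk0_lt.

(** The zero function arises as the difference of a kernel function with itself. *)
Lemma H_0 : H (fun=> 0).
Proof.
have := H_lin (-1) (H_K disk0) (H_K disk0); congr H.
by apply/funext => z; rewrite mulN1r addNr.
Qed.
Lemma H_D f g : H f -> H g -> H (fun z => f z + g z).
Proof.
by move=> hf hg; have := H_lin 1 hf hg; congr H; apply/funext => z; rewrite mul1r.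
Qed.
Lemma H_Z a f : H f -> H (fun z => a * f z).
Proof.
by move=> hf; have := H_lin a hf H_0; congr H; apply/funext => z; rewrite addr0.
Qed.
Lemma H_B f g : H f -> H g -> H (fun z => f z - g z).
Proof.
move=> hf hg; have := H_lin (-1) hg hf; congr H; apply/funext => z.
by rewrite mulN1r addrC.
Qed.
Lemma H_sum (I : Type) (r : seq I) (F : I -> D -> C) : (forall i, H (F i)) ->
  H (fun z => \sum_(i <- r) F i z).
Proof.
move=> h; elim: r => [|i r IH].
  by have := H_0; congr H; apply/funext => z; rewrite big_nil.
by have := H_D (h i) IH; congr H; apply/funext => z; rewrite big_cons.
Qed.

Lemma ip0l k : H k -> ip (fun=> 0) k = 0.
Proof.
move=> hk; have := ip_lin (-1) H_0 H_0 hk.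
rewrite (_ : (fun z => -1 * 0 + 0) = (fun=> 0)).
  by rewrite mulN1r addNr.
by apply/funext => z; rewrite mulr0 addr0.
Qed.
Lemma ip_D f g k : H f -> H g -> H k -> ip (fun z => f z + g z) k = ip f k + ip g k.
Proof.
move=> hf hg hk; have := ip_lin 1 hf hg hk; rewrite mul1r => <-.
by congr ip; apply/funext => z; rewrite mul1r.
Qed.
Lemma ip_Z a f k : H f -> H k -> ip (fun z => a * f z) k = a * ip f k.
Proof.
move=> hf hk; have := ip_lin a hf H_0 hk; rewrite ip0l // addr0 => <-.
by congr ip; apply/funext => z; rewrite addr0.
Qed.
Lemma ip_B f g k : H f -> H g -> H k -> ip (fun z => f z - g z) k = ip f k - ip g k.
Proof.
move=> hf hg hk; have := ip_lin (-1) hg hf hk; rewrite mulN1r addrC => <-.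
by congr ip; apply/funext => z; rewrite mulN1r addrC.
Qed.
Lemma ip_sum (I : Type) (r : seq I) (F : I -> D -> C) k : (forall i, H (F i)) -> H k ->
  ip (fun z => \sum_(i <- r) F i z) k = \sum_(i <- r) ip (F i) k.
Proof.
move=> h hk; elim: r => [|i r IH].
  rewrite big_nil -[RHS](ip0l hk); congr ip.
  by apply/funext => z; rewrite big_nil.
rewrite big_cons -IH -ip_D //; last exact: H_sum.
by congr ip; apply/funext => z; rewrite big_cons.
Qed.
Lemma ip_linr a f g k : H f -> H g -> H k ->
  ip k (fun z => a * f z + g z) = a^* * ip k f + ip k g.
Proof.
move=> hf hg hk; rewrite (ip_sym (H_lin a hf hg) hk) ip_lin // rmorphD rmorphM /=.
by rewrite -!ip_sym.
Qed.
Lemma ip_Br f g k : H f -> H g -> H k -> ip k (fun z => f z - g z) = ip k f - ip k g.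
Proof.
by move=> hf hg hk; rewrite (ip_sym (H_B hf hg) hk) ip_B // rmorphB /= -!ip_sym.
Qed.

Lemma nrm_ge0 f : 0 <= nrm f. Proof. exact: sqrtr_ge0. Qed.

Lemma ip_nrm f : H f -> ip f f = toC (nrm f ^+ 2).
Proof.
move=> hf; have := ip_ge0 hf; rewrite lecE /hnorm => /andP[/eqP i0 r0].
rewrite sqr_sqrtr //; case: (ip f f) i0 r0 => a b /= -> _.
by [].
Qed.

Lemma nrm_sqE f : H f -> nrm f ^+ 2 = complex.Re (ip f f).
Proof. by move=> hf; rewrite ip_nrm. Qed.

Lemma nrm_sq_lin a f g : H f -> H g ->
  nrm (fun z => a * f z + g z) ^+ 2 =
    nc a ^+ 2 * nrm f ^+ 2 + 2 * complex.Re (a * ip f g) + nrm g ^+ 2.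
Proof.
move=> hf hg; rewrite !nrm_sqE //; last exact: H_lin.
rewrite ip_lin //; last exact: H_lin.
rewrite !ip_linr // (ip_sym hf hg).
have -> : a * (a^* * ip f f + ip f g) + (a^* * (ip f g)^* + ip g g) =
  a * a^* * ip f f + (a * ip f g + (a * ip f g)^*) + ip g g by rewrite rmorphM; ring.
rewrite -nc_sqr !ReD ReZ cRe_conj; ring.
Qed.

Lemma nrm0 : nrm (fun=> 0) = 0.
Proof. by rewrite /hnorm ip0l ?sqrtr0 //; exact: H_0. Qed.

Lemma nrm_Z a f : H f -> nrm (fun z => a * f z) = nc a * nrm f.
Proof.
move=> hf; apply/eqP; rewrite -(@eqrXn2 _ 2) ?nrm_ge0 ?mulr_ge0 ?nc_ge0 ?nrm_ge0 //.
have := nrm_sq_lin a hf H_0; rewrite (ip_sym H_0 hf) ip0l // conjC0 mulr0 /= mulr0.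
rewrite nrm0 expr0n /= !addr0 exprMn => <-; apply/eqP; congr (hnorm ip _ ^+ 2).
by apply/funext => z; rewrite addr0.
Qed.

Lemma nrm_eq0 f : H f -> nrm f = 0 -> f = (fun=> 0).
Proof. by move=> hf h; apply: ip_eq0 => //; rewrite ip_nrm // h expr0n. Qed.

Lemma cauchy_schwarz f g : H f -> H g -> nc (ip f g) <= nrm f * nrm g.
Proof.
move=> hf hg; have [g0|g0] := eqVneq (nrm g) 0.
  rewrite (nrm_eq0 hg g0) (ip_sym H_0 hf) ip0l // conjC0 nc0.
  by rewrite mulr_ge0 ?nrm_ge0.
have gp : 0 < nrm g by rewrite lt_def g0 nrm_ge0.
rewrite -ler_sqr ?nnegrE ?mulr_ge0 ?nrm_ge0 ?nc_ge0 //.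
pose a := - (ip f g / toC (nrm g ^+ 2)).
have := sqr_ge0 (nrm (fun z => a * g z + f z)); rewrite nrm_sq_lin // (ip_sym hf hg).
have -> : a * (ip f g)^* = toC (- (nc (ip f g) ^+ 2 / nrm g ^+ 2)).
  by rewrite rmorphN rmorphM fmorphV /= nc_sqr /a; ring.
rewrite /= /a ncN ncM ncV nc_real ger0_norm ?sqr_ge0 // exprMn exprVn.
set x := nc (ip f g) ^+ 2; set y := nrm g ^+ 2.
have y0 : 0 < y by rewrite exprn_gt0.
have -> : x * (y ^+ 2)^-1 * y + 2 * - (x / y) + nrm f ^+ 2 = nrm f ^+ 2 - x / y.
  by field; rewrite gt_eqF.
by rewrite subr_ge0 ler_pdivrMr // exprMn.
Qed.

Lemma nrm_triangle f g : H f -> H g -> nrm (fun z => f z + g z) <= nrm f + nrm g.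
Proof.
move=> hf hg; rewrite -ler_sqr ?nnegrE ?addr_ge0 ?nrm_ge0 //.
have := nrm_sq_lin 1 hf hg; rewrite nc1 expr1n !mul1r.
rewrite (_ : (fun z => 1 * f z + g z) = (fun z => f z + g z)); last first.
  by apply/funext => z; rewrite mul1r.
move=> ->; have := cauchy_schwarz hf hg; have := nc_Re (ip f g).
have := ler_norm (complex.Re (ip f g)); rewrite sqrrD mulr2n; lra.
Qed.

Lemma nrm_sum (I : Type) (r : seq I) (F : I -> D -> C) : (forall i, H (F i)) ->
  nrm (fun z => \sum_(i <- r) F i z) <= \sum_(i <- r) nrm (F i).
Proof.
move=> h; elim: r => [|i r IH].
  rewrite big_nil (_ : (fun z => _) = (fun=> 0)) ?nrm0 //.
  by apply/funext => z; rewrite big_nil.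
rewrite big_cons (_ : (fun z => _) = (fun z => F i z + \sum_(j <- r) F j z)); last first.
  by apply/funext => z; rewrite big_cons.
apply: le_trans (nrm_triangle (h i) (H_sum r h)) _.
by rewrite lerD2l.
Qed.

Lemma nrm_N f : H f -> nrm (fun z => - f z) = nrm f.
Proof.
move=> hf; rewrite -[RHS]mul1r -(nc1 R) -(ncN 1) -nrm_Z //; congr (hnorm ip _).
by apply/funext => z; rewrite mulN1r.
Qed.

Lemma nrm_B f g : H f -> H g -> nrm (fun z => f z - g z) = nrm (fun z => g z - f z).
Proof.
move=> hf hg; rewrite -[LHS]nrm_N; last exact: H_B.
by congr (hnorm ip _); apply/funext => z; rewrite opprB.
Qed.

Lemma nrm_distD f g k : H f -> H g -> H k ->
  nrm (fun z => f z - k z) <= nrm (fun z => f z - g z) + nrm (fun z => g z - k z).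
Proof.
move=> hf hg hk; have := nrm_triangle (H_B hf hg) (H_B hg hk).
rewrite (_ : (fun z => f z - g z + (g z - k z)) = (fun z => f z - k z)) //.
by apply/funext => z; rewrite addrA subrK.
Qed.

Lemma nrm_lerD f g : H f -> H g -> nrm f <= nrm g + nrm (fun z => f z - g z).
Proof.
move=> hf hg; have := nrm_triangle hg (H_B hf hg).
rewrite (_ : (fun z => g z + (f z - g z)) = f) //.
by apply/funext => z; rewrite addrC subrK.
Qed.

Lemma parallelogram f g : H f -> H g ->
  nrm (fun z => f z - g z) ^+ 2 = 2 * nrm f ^+ 2 + 2 * nrm g ^+ 2
    - 4 * nrm (fun z => 2^-1 * (f z + g z)) ^+ 2.
Proof.
move=> hf hg; rewrite nrm_Z; last exact: H_D.
rewrite ncV nc_nat exprMn.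
have := nrm_sq_lin 1 hf hg; have := nrm_sq_lin (-1) hg hf.
rewrite (_ : (fun z => 1 * f z + g z) = (fun z => f z + g z)); last first.
  by apply/funext => z; rewrite mul1r.
rewrite (_ : (fun z => -1 * g z + f z) = (fun z => f z - g z)); last first.
  by apply/funext => z; rewrite mulN1r addrC.
move=> -> ->; rewrite ncN nc1 expr1n !mul1r mulN1r ReN (ip_sym hf hg) cRe_conj.
by field.
Qed.

Lemma eval_bound f w : H f -> nc (f w) <= nrm f * nrm (K^~ w).
Proof. by move=> hf; rewrite -(ip_K w hf); apply: cauchy_schwarz => //; exact: H_K. Qed.

Lemma nrm_K w : nrm (K^~ w) ^+ 2 = complex.Re (K w w).
Proof. by rewrite nrm_sqE ?ip_K //; exact: H_K. Qed.

(** * Membership criterion in terms of kernel combinations *)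

Section Member.
Variables (q : D -> C) (s : R).
Let v (r : seq (C * D)) : D -> C := fun z => \sum_(p <- r) p.1 * K z p.2.
(** The value that [ip (v r) q] must take if [q] belongs to [H]. *)
Let L (r : seq (C * D)) : C := \sum_(p <- r) p.1 * (q p.2)^*.
Hypothesis s0 : 0 <= s.
Hypothesis bnd : forall r, nc (L r) <= s * nrm (v r).

Lemma H_kernel_comb r : H (v r).
Proof. by apply: H_sum => p; apply: H_Z; exact: H_K. Qed.

(** Formally the squared distance from [v r] to [q], less the squared norm of [q]. *)
Let energy r := nrm (v r) ^+ 2 - 2 * complex.Re (L r).

Lemma energy_lower r : - (s ^+ 2) <= energy r.
Proof.
have := bnd r; have := nc_Re (L r); have := ler_norm (complex.Re (L r)).
have := sqr_ge0 (nrm (v r) - s); rewrite sqrrB /energy mulr2n; lra.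
Qed.

Let V : set R := [set energy r | r in [set: seq (C * D)]]%classic.

Lemma energy_has_inf : has_inf V.
Proof. by split; [exists (energy [::]), [::]|exists (- (s ^+ 2)) => _ [r _ <-]; exact: energy_lower]. Qed.

(* Riesz representation by minimising the energy [|v|^2 - 2 Re L v] over the span of the
   kernels: the parallelogram law makes a minimising sequence Cauchy. *)
Lemma rkhs_member : H q /\ nrm q <= s.
Proof.
pose I := inf V.
have IJ r : I <= energy r by apply: ge_inf; [exact: (proj2 energy_has_inf)|exists r].
have ex n : exists r, energy r < I + (2 ^+ n)^-1.
  have [|_ [r _ <-] lt] := @inf_adherent _ V (2 ^+ n)^-1 _ energy_has_inf; last by exists r.
  by rewrite invr_gt0 exprn_gt0.
have [r hr] := choice ex.
pose vv n := v (r n).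
(* The midpoint of two almost minimising combinations is again a combination, so its energy is at
   least [I]. *)
have dist m n : nrm (fun z => vv m z - vv n z) ^+ 2 <= 2 * (2 ^+ m)^-1 + 2 * (2 ^+ n)^-1.
  rewrite parallelogram; [|exact: H_kernel_comb|exact: H_kernel_comb].
  pose h := [seq (2^-1 * p.1, p.2) | p <- r m ++ r n].
  have -> : (fun z => 2^-1 * (vv m z + vv n z)) = v h.
    apply/funext => z; rewrite /v /h big_map big_cat /= mulrDr !mulr_sumr.
    by congr (_ + _); apply: eq_bigr => p _; rewrite mulrA.
  have Lh : L h = toC 2^-1 * (L (r m) + L (r n)).
    rewrite /L /h big_map big_cat /= fmorphV rmorph_nat mulrDr !mulr_sumr.
    by congr (_ + _); apply: eq_bigr => p _; rewrite mulrA.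
  have := IJ h; have := hr m; have := hr n.
  rewrite /energy Lh ReZ ReD -/(vv m) -/(vv n); lra.
have Hv n : H (vv n) by exact: H_kernel_comb.
have [|u [Hu cu]] := H_complete Hv.
  move=> e e0; have e2 : 0 < e ^+ 2 by rewrite exprn_gt0.
  have [N hN] := half_pow_small 4 e2; exists N => m n mN nN.
  rewrite -ltr_sqr ?nnegrE ?nrm_ge0 ?(ltW e0) //.
  apply: le_lt_trans (dist m n) _; apply: le_lt_trans hN.
  have h (k : nat) : (N <= k)%N -> (2 ^+ k)^-1 <= (2 ^+ N)^-1 :> R.
    by move=> Nk; rewrite lef_pV2 ?posrE ?exprn_gt0 // ler_eXn2l // ltr1n.
  have := h m mN; have := h n nN; lra.
have uq : u = q.
  apply/funext => w; apply/eqP; rewrite -subr_eq0; apply/eqP/nc_eq0/eqP.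
  have [//|neq] := eqVneq (nc (u w - q w)) 0.
  pose d := (u w)^* - (q w)^*.
  have dpos : 0 < nc d.
    by rewrite /d -rmorphB nc_conj lt_def neq nc_ge0.
  have Hk := H_K w.
  (* First variation: adding [t] times the kernel at [w] to [vv n] cannot lower the energy below
     [I], while [energy (r n)] tends to [I]. In the limit the resulting quadratic expression in [t]
     is nonnegative. *)
  have key t : 0 <= nc t ^+ 2 * nrm (K^~ w) ^+ 2 + 2 * complex.Re (t * d).
    pose c := 2 * nc t * nrm (K^~ w) + 1.
    have c0 : 0 <= c by rewrite !addr_ge0 // !mulr_ge0 ?nc_ge0 ?nrm_ge0.
    rewrite -oppr_le0; apply: (@real_eps0 R _ c) => // e e0.
    have [N1 h1] := cu e e0; have [N2 h2] := half_pow_small 1 e0.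
    pose n := maxn N1 N2.
    have n1 : nrm (fun z => vv n z - u z) < e by apply: h1; exact: leq_maxl.
    have n2 : (2 ^+ n)^-1 < e.
      apply: le_lt_trans h2; rewrite mul1r lef_pV2 ?posrE ?exprn_gt0 //.
      by rewrite ler_eXn2l ?ltr1n // leq_maxr.
    have := IJ ((t, w) :: r n); rewrite /energy.
    have -> : v ((t, w) :: r n) = (fun z => t * K z w + vv n z).
      by apply/funext => z; rewrite /v big_cons.
    rewrite nrm_sq_lin //; rewrite {1}/L big_cons -/(L (r n)) ReD /=.
    have := hr n; rewrite /energy -/(vv n).
    have -> : ip (K^~ w) (vv n) = (u w)^* + ip (K^~ w) (fun z => vv n z - u z).
      by rewrite ip_Br // (ip_sym Hu Hk) ip_K // addrC subrK.
    set y := ip _ (fun z => vv n z - u z).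
    have hy : nc y <= nrm (K^~ w) * e.
      apply: le_trans (cauchy_schwarz Hk (H_B (Hv n) Hu)) _.
      by rewrite ler_wpM2l ?nrm_ge0 // ltW.
    have -> : t * d = t * ((u w)^* + y) - t * (q w)^* - t * y by rewrite /d; ring.
    have ty : `|complex.Re (t * y)| <= nc t * (nrm (K^~ w) * e).
      by apply: le_trans (nc_Re _) _; rewrite ncM ler_wpM2l ?nc_ge0.
    move: ty; rewrite ler_norml => /andP[ty1 ty2].
    rewrite !ReD !ReN /c; move: ty1 ty2 n2; set T1 := complex.Re _; lra.
  pose k2 := nrm (K^~ w) ^+ 2.
  have k20 : 0 <= k2 by exact: sqr_ge0.
  (* At [t = - a * conj(d)] the linear term is negative, and [a * k2 < 1] keeps the quadratic term
     below half its size, which contradicts [key]. *)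
  pose a := (k2 + 1)^-1.
  have a0 : 0 < a by rewrite invr_gt0 ltr_wpDl.
  have ak : a * k2 < 1 by rewrite mulrC ltr_pdivrMr ?ltr_wpDl // mul1r ltrDl.
  have := key (- (toC a * d^*)).
  have -> : - (toC a * d^*) * d = toC (- (a * nc d ^+ 2)).
    by rewrite rmorphN rmorphM /= nc_sqr; ring.
  rewrite ncN ncM nc_real nc_conj gtr0_norm // /= -/k2.
  have -> : (a * nc d) ^+ 2 * k2 + 2 * - (a * nc d ^+ 2) = (a * nc d ^+ 2) * (a * k2 - 2) by ring.
  by rewrite pmulr_rge0 ?mulr_gt0 ?exprn_gt0 //; lra.
rewrite -uq; split=> //.
(* [L (r N)] tends to [ip u u], so in the limit the hypothesis reads [nrm u ^+ 2 <= s * nrm u]. *)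
have [u0|u0] := eqVneq (nrm u) 0; first by rewrite u0.
have up : 0 < nrm u by rewrite lt_def u0 nrm_ge0.
rewrite -(ler_pM2r up) -subr_le0; apply: (@real_eps0 R _ (s + nrm u)).
  by rewrite addr_ge0 ?nrm_ge0.
move=> e e0; have [N /(_ N (leqnn N)) hN] := cu e e0.
have LE : L (r N) = ip (vv N) u.
  rewrite /vv ip_sum //; last by move=> p; apply: H_Z; exact: H_K.
  apply: eq_bigr => p _; rewrite ip_Z //; last exact: H_K.
  by rewrite (ip_sym Hu (H_K _)) ip_K // uq.
have := bnd (r N); rewrite LE -/(vv N).
have := nrm_lerD (Hv N) Hu => h1.
have : nrm u * nrm u <= nc (ip (vv N) u) + nrm (fun z => vv N z - u z) * nrm u.
  have -> : nrm u * nrm u = nc (ip u u) by rewrite ip_nrm // nc_real ger0_norm ?sqr_ge0.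
  have -> : ip u u = ip (vv N) u - ip (fun z => vv N z - u z) u by rewrite ip_B //; ring.
  by apply: le_trans (ncBD _ _) _; rewrite lerD2l cauchy_schwarz //; exact: H_B.
have : nrm (fun z => vv N z - u z) * nrm u <= e * nrm u by rewrite ler_pM2r // ltW.
have : s * nrm (vv N) <= s * (nrm u + e) by rewrite ler_wpM2l //; lra.
lra.
Qed.

End Member.

(** * Uniform boundedness for sequences of seminorms *)

Section UniformBoundedness.
Variable p : nat -> (D -> C) -> R.
Hypothesis p_triangle : forall n f g, H f -> H g -> p n (fun z => f z + g z) <= p n f + p n g.
Hypothesis p_homog : forall n a f, H f -> p n (fun z => a * f z) = nc a * p n f.
Hypothesis p_cont : forall n, exists B, forall f, H f -> p n f <= B * nrm f.
Hypothesis p_pointwise : forall f, H f -> exists B, forall n, p n f <= B.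

Lemma seminorm_sub n f g : H f -> H g -> p n f <= p n g + p n (fun z => f z - g z).
Proof.
move=> hf hg; have := p_triangle n hg (H_B hf hg).
rewrite (_ : (fun z => g z + (f z - g z)) = f) //.
by apply/funext => z; rewrite addrC subrK.
Qed.

(* Gliding hump: since [2 y = (x + y) - (x - y)], one of [p n (x + y)], [p n (x - y)] is at
   least [p n y], so the signs of the terms of a geometrically convergent series can be chosen
   to keep [p n] large at stage [n] whatever the earlier terms are. *)
Lemma uniform_boundedness : exists B, forall n f, H f -> p n f <= B * nrm f.
Proof.
pose op n := inf [set B | 0 <= B /\ forall f, H f -> p n f <= B * nrm f]%classic.
have opP n : has_inf [set B | 0 <= B /\ forall f, H f -> p n f <= B * nrm f]%classic.
  have [B hB] := p_cont n; split; last by exists 0 => B' [].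
  exists `|B|; split=> // f hf; apply: le_trans (hB f hf) _.
  by rewrite ler_wpM2r ?nrm_ge0 ?ler_norm.
have op0 n : 0 <= op n by apply: lb_le_inf; [case: (opP n)|move=> B []].
have opB n f : H f -> p n f <= op n * nrm f.
  move=> hf; apply/ler_addgt0Pr => e e0.
  have k0 : 0 < nrm f + 1 by rewrite ltr_wpDl ?nrm_ge0.
  have [B [B0 hB] lt] := inf_adherent (divr_gt0 e0 k0) (opP n).
  apply: le_trans (hB f hf) _; rewrite mulrC; apply: le_trans (ler_wpM2l (nrm_ge0 f) (ltW lt)) _.
  rewrite mulrDr (mulrC (op n)) lerD2l mulrCA ler_piMr ?(ltW e0) //.
  by rewrite ler_pdivrMr // mul1r lerDl.
have op_attain n : 0 < op n -> exists f, [/\ H f, nrm f <= 1 & op n <= 2 * p n f].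
  move=> on; apply: contrapT => no.
  have : op n <= op n / 2.
    apply: ge_inf; first by case: (opP n).
    split; first by rewrite divr_ge0.
    move=> f hf; have [f0|f0] := eqVneq (nrm f) 0.
      by have := opB n f hf; rewrite f0 !mulr0.
    have fp : 0 < nrm f by rewrite lt_def f0 nrm_ge0.
    rewrite leNgt; apply/negP => lt; apply: no.
    have fC : toC (nrm f) != 0 by rewrite fmorph_eq0.
    exists (fun z => toC (nrm f)^-1 * f z); split; first exact: H_Z.
      by rewrite nrm_Z // nc_real ger0_norm ?invr_ge0 ?nrm_ge0 // mulVf.
    rewrite p_homog // nc_real ger0_norm ?invr_ge0 ?nrm_ge0 //.
    rewrite mulrCA mulrC ler_pdivlMr // (mulrC 2) -ler_pdivrMr //.
    by apply: ltW; move: lt; rewrite mulrAC.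
  by lra.
have [[B hB]|unb] := pselect (exists B, forall n, op n <= B).
  exists B => n f hf; apply: le_trans (opB n f hf) _.
  by rewrite ler_wpM2r ?nrm_ge0.
exfalso.
(* Stage [j] makes the seminorm at least half of its operator norm divided by [4 ^+ j], and all
   later stages take away at most a third of that quotient. The remaining sixth is at least [j.+1],
   whence the factor [6 * j.+1 * 4 ^+ j]. *)
have ex (j : nat) : exists nf : nat * (D -> C), [/\ H nf.2, nrm nf.2 <= 1,
    6 * (j.+1)%:R * 4 ^+ j <= op nf.1 & op nf.1 <= 2 * p nf.1 nf.2].
  have [n hn] : exists n, 6 * (j.+1)%:R * 4 ^+ j <= op n.
    apply: contrapT => no; apply: unb; exists (6 * (j.+1)%:R * 4 ^+ j) => n.
    by rewrite leNgt; apply/negP => lt; apply: no; exists n; exact: ltW.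
  have on : 0 < op n by apply: lt_le_trans hn; rewrite !mulr_gt0 ?exprn_gt0 ?ltr0n.
  by have [f [h1 h2 h3]] := op_attain n on; exists (n, f).
have [w hw] := choice ex.
pose N j := (w j).1; pose y j := (w j).2.
pose add j (x : D -> C) z := x z + toC (4 ^+ j)^-1 * y j z.
pose sub j (x : D -> C) z := x z - toC (4 ^+ j)^-1 * y j z.
pose step j x := if (4 ^+ j)^-1 * p (N j) (y j) <= p (N j) (add j x) then add j x else sub j x.
pose x := fix x j := if j is i.+1 then step i (x i) else (fun=> 0 : C).
have Hy j : H (y j) by case: (hw j).
have Hsy j : H (fun z => toC (4 ^+ j)^-1 * y j z) by exact: H_Z.
have i4 j : 0 < (4 ^+ j)^-1 :> R by rewrite invr_gt0 exprn_gt0.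
have Hx j : H (x j).
  elim: j => [|j IH] /=; first exact: H_0.
  by rewrite /step; case: ifP => _; [exact: H_D|exact: H_B].
have big j : (4 ^+ j)^-1 * p (N j) (y j) <= p (N j) (x j.+1).
  rewrite /= /step; case: ifPn => //; rewrite -ltNge => lt.
  have := p_triangle (N j) (H_D (Hx j) (Hsy j)) (H_Z (-1) (H_B (Hx j) (Hsy j))).
  rewrite p_homog; last exact: H_B.
  rewrite (_ : (fun z => _ + -1 * _) = (fun z => (2 * toC (4 ^+ j)^-1) * y j z)); last first.
    by apply/funext => z; ring.
  rewrite p_homog // ncM nc_nat nc_real gtr0_norm // ncN nc1 mul1r.
  move: lt; rewrite /add /sub; set A := p _ _; set B' := p _ _; set Y := p _ _.
  by rewrite -mulrA; lra.
have close j : nrm (fun z => x j.+1 z - x j z) <= (4 ^+ j)^-1.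
  have le : nrm (fun z => toC (4 ^+ j)^-1 * y j z) <= (4 ^+ j)^-1.
    rewrite nrm_Z // nc_real gtr0_norm //.
    by case: (hw j) => _ h _ _; rewrite ler_piMr // ltW.
  rewrite /= /step; case: ifPn => _.
    rewrite (_ : (fun z => _) = (fun z => toC (4 ^+ j)^-1 * y j z)) //.
    by apply/funext => z; rewrite /add addrC addKr.
  rewrite (_ : (fun z => _) = (fun z => - (toC (4 ^+ j)^-1 * y j z))) ?nrm_N //.
  by apply/funext => z; rewrite /sub addrC addKr.
have e4 j : (4 ^+ j)^-1 = 4 * (4 ^+ j.+1)^-1 :> R.
  by rewrite exprS invfM mulrA divff ?mul1r.
have far j m : nrm (fun z => x (j + m)%N z - x j z) <= 4 / 3 * ((4 ^+ j)^-1 - (4 ^+ (j + m))^-1).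
  elim: m => [|m IH].
    rewrite addn0 subrr mulr0 (_ : (fun z => _) = (fun=> 0)) ?nrm0 //.
    by apply/funext => z; rewrite subrr.
  rewrite addnS; have := nrm_distD (Hx (j + m).+1) (Hx (j + m)%N) (Hx j).
  by have := close (j + m)%N; move: IH; rewrite (e4 (j + m)%N); lra.
have far' j m : nrm (fun z => x (j + m)%N z - x j z) <= 4 / 3 * (4 ^+ j)^-1.
  apply: le_trans (far j m) _; rewrite ler_pM2l ?divr_gt0 // gerBl ltW //.
have small (e : R) : 0 < e -> exists j, (4 ^+ j)^-1 < e.
  move=> e0; have [j hj] := half_pow_small 1 e0; exists j; apply: le_lt_trans hj.
  rewrite mul1r lef_pV2 ?posrE ?exprn_gt0 // lerXn2r ?nnegrE //; lra.
have [|u [Hu cu]] := H_complete Hx.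
  move=> e e0; have eq0 : 0 < e / 4 by rewrite divr_gt0.
  have [j hj] := small _ eq0; exists j => m n jm jn.
  have := nrm_distD (Hx m) (Hx j) (Hx n); rewrite (nrm_B (Hx j)) //.
  have := far' j (m - j)%N; have := far' j (n - j)%N; rewrite !subnKC //.
  by lra.
have tail j : nrm (fun z => x j z - u z) <= 4 / 3 * (4 ^+ j)^-1.
  apply/ler_addgt0Pr => e e0; have [M hM] := cu e e0.
  have := hM (j + M)%N (leq_addl _ _); have := far' j M.
  have := nrm_distD (Hx j) (Hx (j + M)%N) Hu; rewrite (nrm_B (Hx j) (Hx (j + M)%N)); lra.
have [B hB] := p_pointwise Hu.
have lower j : (j.+1)%:R <= p (N j) u.
  have [_ _ h1 h2] := hw j.
  have h3 := seminorm_sub (N j) (Hx j.+1) Hu.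
  have h4 := opB (N j) _ (H_B (Hx j.+1) Hu).
  have h5 := ler_wpM2l (op0 (N j)) (tail j.+1).
  have h6 := big j.
  rewrite -/(N j) -/(y j) in h1 h2.
  have h7 := ler_wpM2l (ltW (i4 j)) h2.
  have h8 := ler_wpM2l (ltW (i4 j)) h1.
  have e6 : (4 ^+ j)^-1 * (6 * j.+1%:R * 4 ^+ j) = 6 * j.+1%:R :> R.
    by rewrite mulrC mulfK // gt_eqF // exprn_gt0.
  rewrite e6 in h8.
  have e5 : op (N j) * (4 / 3 * (4 ^+ j.+1)^-1) = 1 / 3 * ((4 ^+ j)^-1 * op (N j)).
    by rewrite (e4 j); field.
  rewrite e5 in h5; lra.
have := lower (Num.bound B); have := hB (N (Num.bound B)).
have := archi_boundP (normr_ge0 B); have := ler_norm B.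
have : (Num.bound B)%:R <= ((Num.bound B).+1)%:R :> R by rewrite ler_nat.
have : (Num.bound B)%:R = (Num.bound `|B|)%:R :> R by rewrite /Num.bound normr_id.
lra.
Qed.

End UniformBoundedness.

End RKHS.

(** * Cesaro numbers *)

Section CesaroNumbers.
Variable R : realType.
Variable alpha : R.
Hypothesis alpha0 : 0 <= alpha.

(** The binomial coefficient of [n + alpha] over [n]; the generating function is
    [(1 - x)^(-alpha-1)]. *)
Definition cesaro_A (n : nat) : R := \prod_(i < n) ((i%:R + 1 + alpha) / (i%:R + 1)).
(* coefficients of [(1 - x)^(alpha+1)], the inverse of the generating function of [cesaro_A] *)
Definition cesaro_d (n : nat) : R := \prod_(i < n) ((i%:R - alpha - 1) / (i%:R + 1)).

Lemma natr1_gt0 (i : nat) : 0 < i%:R + 1 :> R.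
Proof. by rewrite ltr_wpDl. Qed.

Lemma natr1_neq0 (i : nat) : i%:R + 1 != 0 :> R.
Proof. by rewrite gt_eqF ?natr1_gt0. Qed.

Lemma cesaro_A_gt0 n : 0 < cesaro_A n.
Proof.
apply: prodr_gt0 => i _; rewrite divr_gt0 ?natr1_gt0 //.
by rewrite ltr_wpDr // natr1_gt0.
Qed.

Lemma cesaro_AS n : cesaro_A n.+1 * (n%:R + 1) = cesaro_A n * (n%:R + 1 + alpha).
Proof. by rewrite /cesaro_A big_ord_recr /= -mulrA divfK ?natr1_neq0. Qed.

Lemma cesaro_dS n : cesaro_d n.+1 * (n%:R + 1) = cesaro_d n * (n%:R - alpha - 1).
Proof. by rewrite /cesaro_d big_ord_recr /= -mulrA divfK ?natr1_neq0. Qed.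

Lemma cesaro_A_mono m n : (m <= n)%N -> cesaro_A m <= cesaro_A n.
Proof.
move=> /subnKC <-; elim: (n - m)%N => [|k IH]; first by rewrite addn0.
apply: le_trans IH _; rewrite addnS /cesaro_A big_ord_recr /= -/(cesaro_A _).
rewrite ler_peMr ?(ltW (cesaro_A_gt0 _)) // ler_pdivlMr ?natr1_gt0 //.
by rewrite mul1r lerDl.
Qed.

Definition cesaro_conv n : R := \sum_(i < n.+1) cesaro_d i * cesaro_A (n - i).

(** The weight [n + 1] is split as [i + (n + 1 - i)], as in the product rule. The two recurrences
    then contribute the factors [i - alpha - 1] and [n - i + 1 + alpha], which add up to [n]. *)
Lemma cesaro_conv_rec n : (n%:R + 1) * cesaro_conv n.+1 = n%:R * cesaro_conv n.
Proof.
rewrite /cesaro_conv mulr_sumr.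
have -> : \sum_(i < n.+2) (n%:R + 1) * (cesaro_d i * cesaro_A (n.+1 - i)) =
   \sum_(i < n.+2) i%:R * (cesaro_d i * cesaro_A (n.+1 - i)) +
   \sum_(i < n.+2) (n.+1 - i)%:R * (cesaro_d i * cesaro_A (n.+1 - i)).
  rewrite -big_split /=; apply: eq_bigr => i _; rewrite -mulrDl -natrD.
  by rewrite subnKC ?leq_ord // natr1.
rewrite big_ord_recl /= mul0r add0r [X in _ + X]big_ord_recr /= subnn mul0r addr0.
rewrite -big_split /= mulr_sumr; apply: eq_bigr => i _.
have le : (i <= n)%N by rewrite -ltnS.
rewrite /bump /= add1n subSS subSn //.
have h1 := cesaro_dS i; have h2 := cesaro_AS (n - i).
rewrite -!natr1; have -> : n%:R = i%:R + (n - i)%:R :> R by rewrite -natrD subnKC.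
set a := cesaro_d i.+1 in h1 *; set b := cesaro_A (n - i).+1 in h2 *.
have -> : (i%:R + 1) * (a * cesaro_A (n - i)) + ((n - i)%:R + 1) * (cesaro_d i * b) =
  a * (i%:R + 1) * cesaro_A (n - i) + cesaro_d i * (b * ((n - i)%:R + 1)) by ring.
by rewrite h1 h2; ring.
Qed.

Lemma cesaro_convS n : cesaro_conv n.+1 = 0.
Proof.
elim: n => [|n IH]; [apply: (mulfI (natr1_neq0 0))|apply: (mulfI (natr1_neq0 n.+1))].
  by rewrite cesaro_conv_rec mul0r mulr0.
by rewrite cesaro_conv_rec IH !mulr0.
Qed.

(* From [(n + 1) |d (n + 1)| = (n - alpha - 1) |d n|] for large [n], the sum of
   [(alpha + 1) |d n|] telescopes. *)
Lemma cesaro_d_summable : exists S, forall n, \sum_(i < n) `|cesaro_d i| <= S.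
Proof.
(* From [N >= alpha + 1] on, the factors [n - alpha - 1] are nonnegative, so the recurrence passes
   to absolute values. *)
pose N := (Num.bound alpha).+1.
have hN : alpha + 1 <= N%:R by rewrite /N -natr1 lerD2r; exact/ltW/archi_boundP.
have rec n : `|cesaro_d (N + n).+1| * ((N + n)%:R + 1) = `|cesaro_d (N + n)| * ((N + n)%:R - alpha - 1).
  have := congr1 Num.norm (cesaro_dS (N + n)); rewrite !normrM (gtr0_norm (natr1_gt0 _)).
  rewrite (@ger0_norm _ ((N + n)%:R - alpha - 1)) // natrD; have := ler0n R n; lra.
have tel n : (alpha + 1) * (\sum_(i < n) `|cesaro_d (N + i)|) + (N + n)%:R * `|cesaro_d (N + n)|
   = N%:R * `|cesaro_d N|.
  elim: n => [|n IH]; first by rewrite big_ord0 mulr0 add0r addn0.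
  rewrite big_ord_recr /= -IH addnS; have := rec n; rewrite -natr1; lra.
have a1 : 0 < alpha + 1 by rewrite ltr_wpDl.
exists (\sum_(i < N) `|cesaro_d i| + N%:R * `|cesaro_d N| / (alpha + 1)) => n.
apply: (@le_trans _ _ (\sum_(i < N + n) `|cesaro_d i|)).
  by rewrite addnC big_split_ord /= lerDl; apply: sumr_ge0.
rewrite big_split_ord /= lerD2l ler_pdivlMr // mulrC -(tel n) lerDl.
by rewrite mulr_ge0.
Qed.

(** For [n > 0] the factor [1 + alpha / (n + 1)] is at most the exponential of
    [alpha * (ln (n + 1) - ln n)], since [ln (1 - x) <= - x], and these factors telescope. The
    constant comes from [A 1 = 1 + alpha <= expR alpha]. *)
Lemma cesaro_A_growth n : (0 < n)%N -> cesaro_A n <= expR alpha * (n%:R `^ alpha).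
Proof.
case: n => // n _; rewrite /powR pnatr_eq0 /=; elim: n => [|n IH].
  rewrite ln1 mulr0 expR0 mulr1 /cesaro_A big_ord1 /= add0r divr1.
  exact: expR_ge1Dx.
rewrite /cesaro_A big_ord_recr /= -/(cesaro_A n.+1) natr1.
have n2 : 0 < n.+2%:R :> R by rewrite ltr0n.
have n1 : 0 < n.+1%:R :> R by rewrite ltr0n.
have l1 : (n.+2%:R + alpha) / n.+2%:R <= expR (alpha * (ln n.+2%:R - ln n.+1%:R)).
  rewrite mulrDl divff ?gt_eqF //; apply: le_trans (expR_ge1Dx _) _.
  rewrite ler_expR ler_wpM2l // -ln_div ?posrE //.
  have -> : n.+2%:R / n.+1%:R = (n.+1%:R / n.+2%:R)^-1 :> R by rewrite invf_div.
  rewrite lnV ?posrE ?divr_gt0 //.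
  rewrite lerNr.
  have -> : n.+1%:R / n.+2%:R = 1 + - (n.+2%:R)^-1 :> R.
    by rewrite -[n.+1%:R](addrK 1) natr1 mulrBl divff ?gt_eqF // mul1r.
  by apply: le_ln1Dx; rewrite ltrN2 invf_lt1 // ltr1n.
have l0 : 0 <= (n.+2%:R + alpha) / n.+2%:R by rewrite divr_ge0 ?addr_ge0 // ltW.
apply: le_trans (ler_pM (ltW (cesaro_A_gt0 _)) l0 IH l1) _.
have -> : expR (alpha * ln n.+2%:R) =
  expR (alpha * ln n.+1%:R) * expR (alpha * (ln n.+2%:R - ln n.+1%:R)).
  by rewrite -expRD; congr expR; ring.
by rewrite mulrA.
Qed.

(** In this form [A n] times a Cesaro mean is a convolution with [A], which [cesaro_d] inverts. *)
Lemma cesaro_weight n j : (j <= n)%N ->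
  dbr_binom n%:R j / dbr_binom (n%:R + alpha) j = cesaro_A (n - j) / cesaro_A n.
Proof.
move=> jn; rewrite /dbr_binom.
have f0 : (j`!)%:R != 0 :> R by rewrite pnatr_eq0 -lt0n fact_gt0.
rewrite invf_div mulrA divfK //.
elim: j jn {f0} => [|j IH] jn.
  by rewrite !big_ord0 subn0 divr1 divff // gt_eqF ?cesaro_A_gt0.
rewrite !big_ord_recr /= invfM mulrACA IH ?(ltnW jn) //.
have := cesaro_AS (n - j.+1); have -> : (n - j.+1).+1 = (n - j)%N by rewrite subnSK.
have -> : (n - j.+1)%:R + 1 = n%:R - j%:R :> R.
  by rewrite natr1 subnSK // natrB // ltnW.
move=> h; have p : n%:R - j%:R + alpha != 0.
  by rewrite gt_eqF // ltr_wpDr // subr_gt0 ltr_nat.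
have A0 : cesaro_A n != 0 by rewrite gt_eqF ?cesaro_A_gt0.
have -> : cesaro_A (n - j) / cesaro_A n * ((n%:R - j%:R) / (n%:R + alpha - j%:R)) =
  cesaro_A (n - j) * (n%:R - j%:R) / (n%:R - j%:R + alpha) / cesaro_A n.
  by rewrite [n%:R + alpha - _]addrAC; field; rewrite A0 p.
by rewrite h mulfK.
Qed.

End CesaroNumbers.

(** * The contraction inequality *)

Section KernelInequality.
Variable R : realType.
Local Notation C := R[i].
Local Notation D := (disk R).
Local Notation nc := (@Defs.normc R).
Local Notation toC := (real_complex R).
Local Notation E := (@circle_mean R).

(** The analysis above concerns functions on the whole plane tested on the disk; extension by zero
    preserves the bound by 1. *)
Definition disk_ext (f : D -> C) (z : C) : C :=
  if pselect (nc z < 1) is left h then f (exist _ z h) else 0.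

Lemma disk_ext_in f z (h : nc z < 1) : disk_ext f z = f (exist _ z h).
Proof.
by rewrite /disk_ext; case: pselect => // h'; congr (f (exist _ z _)); exact: bool_irrelevance.
Qed.

Lemma disk_ext_sval f (w : D) : disk_ext f (sval w) = f w.
Proof. by case: w => z h; rewrite disk_ext_in. Qed.

Lemma ps_rep_ext (f : D -> C) a : power_series_rep f a <-> ps_rep 1 (disk_ext f) a.
Proof.
split=> h.
  by move=> z z1; rewrite (disk_ext_in f z1); exact: (h (exist _ z z1)).
by move=> [z z1]; have := h z z1; rewrite (disk_ext_in f z1).
Qed.

Lemma holo_ext f : holomorphic_disk f -> holo (disk_ext f).
Proof.
move=> hf z z1; have [l hl] := hf (exist _ z z1); exists l => e e0.
have [d [d0 hd]] := hl e e0; exists d => // w w1 wd.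
have [->|wz] := eqVneq w z; first by rewrite !subrr mul0r subr0 nc0 mulr0.
have wz0 : w - z != 0 by rewrite subr_eq0.
have := hd (exist _ w w1); rewrite /= wd (nc_gt0 wz0) => /(_ isT).
rewrite -(disk_ext_in f w1) -(disk_ext_in f z1) => lt.
have -> : disk_ext f w - disk_ext f z - (w - z) * l = ((disk_ext f w - disk_ext f z) / (w - z) - l) * (w - z).
  by rewrite -{1}(divfK wz0 (disk_ext f w - disk_ext f z)); ring.
by rewrite ncM ler_wpM2r ?nc_ge0 // ltW.
Qed.

Lemma Hinf_power_series (f : D -> C) : Hinf_ball f -> exists a, power_series_rep f a.
Proof.
move=> [hf f1]; have [|z|a ha] := @holo_power_series R (disk_ext f); first exact: holo_ext.
  by rewrite /disk_ext; case: pselect => // _; rewrite nc0.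
by exists a; apply/ps_rep_ext.
Qed.

Section CconvAlgebra.
Implicit Types (u v : nat -> C) (l m : C).
Lemma cconvD u v l m : cconv u l -> cconv v m -> cconv (fun n => u n + v n) (l + m).
Proof.
move=> /cconvP hu /cconvP hv; apply/cconvP => e e0; have e2 : 0 < e / 2 by rewrite divr_gt0.
have [N1 h1] := hu _ e2; have [N2 h2] := hv _ e2; exists (maxn N1 N2) => n.
rewrite geq_max => /andP[/h1 a /h2 b]; rewrite opprD addrACA.
by apply: le_lt_trans (ncD _ _) _; lra.
Qed.
Lemma cconvZ a u l : cconv u l -> cconv (fun n => a * u n) (a * l).
Proof.
move=> /cconvP hu; apply/cconvP => e e0; have k0 : 0 < nc a + 1 by rewrite ltr_wpDl ?nc_ge0.
have [N h] := hu _ (divr_gt0 e0 k0); exists N => n /h; rewrite ltr_pdivlMr // => lt.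
rewrite -mulrBr ncM; apply: le_lt_trans lt; rewrite mulrC ler_wpM2l ?nc_ge0 //.
by rewrite lerDl.
Qed.
Lemma cconvM u v l m : cconv u l -> cconv v m -> cconv (fun n => u n * v n) (l * m).
Proof.
move=> hu hv; have [M hM] := cconv_bounded hu.
have h1 : cconv (fun n => u n * (v n - m)) 0.
  have M1 : 0 < `|M| + 1 by rewrite ltr_wpDl.
  move/cconvP: hv => hv; apply/cconvP => e e0; have [N h] := hv _ (divr_gt0 e0 M1).
  exists N => n /h; rewrite ltr_pdivlMr // subr0 ncM => lt; apply: le_lt_trans lt.
  rewrite mulrC ler_wpM2l ?nc_ge0 //; apply: le_trans (hM n) _.
  by apply: le_trans (ler_norm M) _; rewrite lerDl.
have := cconvD h1 (cconvZ m hu); rewrite add0r mulrC; apply: cconv_ext => n.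
by rewrite mulrBr (mulrC m) subrK.
Qed.
Lemma cconv_conj u l : cconv u l -> cconv (fun n => (u n)^*) l^*.
Proof.
move=> /cconvP hu; apply/cconvP => e /hu[N h]; exists N => n /h.
by rewrite -rmorphB nc_conj.
Qed.
Lemma cconv_sum (I : Type) (r : seq I) (F : nat -> I -> C) (G : I -> C) :
  (forall i, cconv (F^~ i) (G i)) ->
  cconv (fun n => \sum_(i <- r) F n i) (\sum_(i <- r) G i).
Proof.
move=> h; elim: r => [|i r IH].
  by rewrite big_nil; apply: cconv_ext (cconv_cst 0) => n; rewrite big_nil.
by rewrite big_cons; apply: cconv_ext (cconvD (h i) IH) => n; rewrite big_cons.
Qed.
Lemma cconvX u l k : cconv u l -> cconv (fun n => u n ^+ k) (l ^+ k).
Proof.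
move=> h; elim: k => [|k IH]; first exact: cconv_cst.
by rewrite exprS; apply: cconv_ext (cconvM h IH) => n; rewrite exprS.
Qed.
Lemma cconv_Re_ge0 u l : (forall n, 0 <= complex.Re (u n)) -> cconv u l -> 0 <= complex.Re l.
Proof.
move=> h /cconvP hu; rewrite -oppr_le0; apply/ler_addgt0Pr => e e0; rewrite add0r.
have [N /(_ N (leqnn N)) hN] := hu e e0; have := h N; have := nc_Re (u N - l).
have := ler_norm (complex.Re (u N - l)); rewrite ReD ReN; lra.
Qed.
End CconvAlgebra.

Lemma geom_cconv (q : C) : nc q < 1 -> cconv (fun n => \sum_(k < n) q ^+ k) (1 - q)^-1.
Proof.
move=> q1; apply/cconvP => e e0.
have k0 : 0 < nc (1 - q)^-1 + 1 by rewrite ltr_wpDl ?nc_ge0.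
have [|N hN] := @pow_small R (nc q) (e / (nc (1 - q)^-1 + 1)) _ (divr_gt0 e0 k0).
  by rewrite nc_ge0.
exists N => n /hN; rewrite ltr_pdivlMr // => lt.
rewrite (geom_expand n q1) opprD addrA subrr add0r ncN ncM ncX.
by apply: le_lt_trans lt; rewrite ler_wpM2l ?exprn_ge0 ?nc_ge0 // lerDl.
Qed.

Lemma cbdd_monomial n : cbdd (fun z : C => z ^+ n).
Proof. exact: cbddX (@cbdd_id R). Qed.

(** The analytic projection of [z ^+ (m - k)], evaluated at [q]; it vanishes when the exponent is
    negative. *)
Lemma mean_monomial_szego (q : C) m k : nc q < 1 ->
  E (fun z => z ^+ m * z^* ^+ k * (1 - q * z^*)^-1) = if (k <= m)%N then q ^+ (m - k) else 0.
Proof.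
move=> q1; apply: cconv_unique (mean_szego (cbddM (cbdd_monomial m) (@cbdd_conjX R k)) q1) _.
have e1 j : E (fun z => z ^+ m * z^* ^+ k * z^* ^+ j) = (m == k + j)%N%:R.
  by rewrite -mean_mono; apply: mean_ext => z _; rewrite exprD mulrA.
apply: (@cconv_const_tail _ _ _ (m - k).+1) => n hn.
case: leqP => km; last first.
  rewrite big1 // => j _; rewrite e1 ltn_eqF ?mul0r //.
  exact: leq_trans km (leq_addr _ _).
rewrite (bigD1 (Ordinal hn)) //= e1 subnKC // eqxx mul1r big1 ?addr0 // => j hj.
rewrite e1; have -> : (m == k + j)%N = false; last by rewrite mul0r.
apply: contraNF hj => /eqP mk; rewrite -val_eqE /= mk addKn; exact: eqxx.
Qed.

Lemma conj_szego (v z : C) : ((1 - v * z^*)^-1)^* = (1 - v^* * z)^-1.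
Proof. by rewrite fmorphV rmorphB rmorphM rmorph1 /= conjCK. Qed.

Lemma conj_szego' (v z : C) : ((1 - v^* * z)^-1)^* = (1 - v * z^*)^-1.
Proof. by rewrite -conj_szego conjCK. Qed.

Lemma cbdd_szego' (v : C) : nc v < 1 -> cbdd (fun z => (1 - v^* * z)^-1).
Proof.
by move=> v1; apply: cbdd_ext (cbdd_conj (cbdd_szego v1)) => z _; rewrite conj_szego.
Qed.

Lemma mean_monomial_szego' (v : C) m k : nc v < 1 ->
  E (fun z => z ^+ k * z^* ^+ m * (1 - v^* * z)^-1) = if (k <= m)%N then v^* ^+ (m - k) else 0.
Proof.
move=> v1; have := congr1 Num.conj (mean_monomial_szego m k v1).
rewrite -mean_conj; last first.
  exact: cbddM (cbddM (cbdd_monomial m) (@cbdd_conjX R k)) (cbdd_szego v1).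
rewrite (fun_if Num.conj) conjC0 rmorphXn /= => <-; apply: mean_ext => z _.
by rewrite !rmorphM !rmorphXn /= conj_szego conjCK (mulrC (z ^+ k)).
Qed.

Lemma mean_two_szego (v w : C) k : nc v < 1 -> nc w < 1 ->
  E (fun z => z ^+ k * ((1 - v^* * z)^-1 * (1 - w * z^*)^-1)) = w ^+ k * (1 - v^* * w)^-1.
Proof.
move=> v1 w1; have bs := cbdd_szego' v1.
have -> : E (fun z => z ^+ k * ((1 - v^* * z)^-1 * (1 - w * z^*)^-1)) =
  E (fun z => z ^+ k * (1 - v^* * z)^-1 * (1 - w * z^*)^-1).
  by apply: mean_ext => z _; rewrite mulrA.
have vw : nc (v^* * w) < 1.
  rewrite ncM nc_conj; apply: le_lt_trans w1; rewrite ler_piMl ?nc_ge0 //; exact: ltW.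
apply: cconv_unique (mean_szego (cbddM (cbdd_monomial k) bs) w1) _.
have e1 j : E (fun z => z ^+ k * (1 - v^* * z)^-1 * z^* ^+ j) = if (k <= j)%N then v^* ^+ (j - k) else 0.
  by rewrite -mean_monomial_szego' //; apply: mean_ext => z _; rewrite mulrAC.
have h := cconvZ (w ^+ k) (geom_cconv vw).
move/cconvP: h => h; apply/cconvP => e /h[N hN]; exists (k + N)%N => n kn.
have -> : n = (k + (n - k))%N by rewrite subnKC // (leq_trans _ kn) ?leq_addr.
rewrite big_split_ord /= big1 ?add0r; last first.
  by move=> j _; rewrite e1 leqNgt ltn_ord mul0r.
have -> : \sum_(i < n - k) E (fun z => z ^+ k * (1 - v^* * z)^-1 * z^* ^+ (k + i)) * w ^+ (k + i)
  = w ^+ k * \sum_(i < n - k) (v^* * w) ^+ i.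
  rewrite mulr_sumr; apply: eq_bigr => i _; rewrite e1 leq_addr addKn exprMn exprD.
  by ring.
by apply: hN; rewrite leq_subRL // (leq_trans _ kn) ?leq_addr.
Qed.

Lemma mean_reproducing (f : C -> C) a (s : R) (v w : C) : ps_rep 1 f a -> 0 <= s < 1 ->
  nc v < 1 -> nc w < 1 ->
  E (fun z => f (toC s * z) * ((1 - v^* * z)^-1 * (1 - w * z^*)^-1)) =
    f (toC s * w) * (1 - v^* * w)^-1.
Proof.
move=> ha s01 v1 w1; have [s0 s1] := andP s01.
have sw : nc (toC s * w) < 1.
  by rewrite ncM nc_real ger0_norm //; apply: le_lt_trans w1; rewrite ler_piMl ?nc_ge0 // ltW.
apply: cconv_unique (mean_ps ha s01 (cbddM (cbdd_szego' v1) (cbdd_szego w1))) _.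
rewrite mulrC; apply: cconv_ext (cconvZ (1 - v^* * w)^-1 (ha _ sw)) => n.
rewrite mulr_sumr; apply: eq_bigr => k _; rewrite mean_two_szego // exprMn; ring.
Qed.

(** This is the [m]-th Taylor coefficient of the product of the dilated [f] with a Szego kernel,
    hence a Cauchy product. *)
Lemma mean_coef_szego (f : C -> C) a (s : R) (v : C) m : ps_rep 1 f a -> 0 <= s < 1 -> nc v < 1 ->
  E (fun z => f (toC s * z) * ((1 - v^* * z)^-1 * z^* ^+ m)) =
    \sum_(k < m.+1) a k * toC s ^+ k * v^* ^+ (m - k).
Proof.
move=> ha s01 v1.
apply: cconv_unique (mean_ps ha s01 (cbddM (cbdd_szego' v1) (@cbdd_conjX R m))) _.
have e1 k : E (fun z => z ^+ k * ((1 - v^* * z)^-1 * z^* ^+ m)) = if (k <= m)%N then v^* ^+ (m - k) else 0.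
  by rewrite -mean_monomial_szego' //; apply: mean_ext => z _; rewrite -mulrA (mulrC (z^* ^+ m)).
apply: (@cconv_const_tail _ _ _ m.+1) => n /subnKC <-.
rewrite big_split_ord /= [X in _ + X]big1 ?addr0; last first.
  by move=> k _; rewrite e1 leqNgt addSn ltnS leq_addr mulr0.
by apply: eq_bigr => k _; rewrite e1 -ltnS ltn_ord.
Qed.

Lemma Re_mulC_ge0 (x : C) : 0 <= complex.Re (x * x^*).
Proof. by rewrite -nc_sqr /= sqr_ge0. Qed.

(** * The inequality for finite sums of kernels *)

Section Contraction.
Variables (fb fc : C -> C) (beta gamma : nat -> C).
Hypothesis hb : ps_rep 1 fb beta.
Hypothesis hc : ps_rep 1 fc gamma.
Hypothesis bc1 : forall z, nc z < 1 -> nc (fb z) ^+ 2 + nc (fc z) ^+ 2 <= 1.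

(** The [m]-th Taylor coefficient of the dilated [c] times the Szego combination given by [r]. At
    [s = 1] it is the pairing of that combination with the Toeplitz image of [z ^+ m]. *)
Definition backward_shift_sum (s : R) (m : nat) (r : seq (C * D)) : C :=
  \sum_(p <- r) p.1 * \sum_(k < m.+1) gamma k * toC s ^+ k * (sval p.2)^* ^+ (m - k).

(** At [s = 1] the squared norm of the kernel combination given by [r]. Only the arguments of [b]
    are dilated, since the Szego kernels are already bounded on the circle. *)
Definition kernel_sum (s : R) (r : seq (C * D)) : C :=
  \sum_(p <- r) \sum_(p' <- r) p.1 * p'.1^* *
    ((1 - fb (toC s * sval p'.2) * (fb (toC s * sval p.2))^*) / (1 - (sval p.2)^* * sval p'.2)).

Definition szego_comb (x : C * D -> C) (r : seq (C * D)) (z : C) : C :=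
  \sum_(p <- r) x p * (1 - (sval p.2)^* * z)^-1.

Lemma cbdd_szego_comb x r : cbdd (szego_comb x r).
Proof. by apply: cbdd_sum => p; apply: cbddZ; apply: cbdd_szego'; case: (p.2). Qed.

Lemma mean_szego_comb (h : C -> C) (M : C * D -> C * D -> C) x y r : cbdd h ->
  (forall p p', E (fun z => h z * ((1 - (sval p.2)^* * z)^-1 * (1 - sval p'.2 * z^*)^-1)) = M p p') ->
  E (fun z => h z * (szego_comb x r z * (szego_comb y r z)^*)) =
    \sum_(p <- r) \sum_(p' <- r) x p * (y p')^* * M p p'.
Proof.
move=> bh hM.
have bk (p p' : C * D) : cbdd (fun z => x p * (y p')^* * (h z * ((1 - (sval p.2)^* * z)^-1 * (1 - sval p'.2 * z^*)^-1)))
  .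
  apply: cbddZ; apply: cbddM bh _; apply: cbddM; [apply: cbdd_szego'|apply: cbdd_szego].
  - by case: (p.2).
  - by case: (p'.2).
rewrite (@mean_ext R _ (fun z => \sum_(p <- r) \sum_(p' <- r)
   x p * (y p')^* * (h z * ((1 - (sval p.2)^* * z)^-1 * (1 - sval p'.2 * z^*)^-1)))).
  rewrite mean_sum; last by move=> p; exact: cbdd_sum.
  apply: eq_bigr => p _; rewrite mean_sum //; apply: eq_bigr => p' _.
  rewrite meanZ ?hM //; apply: cbddM bh _; apply: cbddM; [apply: cbdd_szego'|apply: cbdd_szego].
  - by case: (p.2).
  - by case: (p'.2).
move=> z _; rewrite /szego_comb rmorph_sum /= mulr_suml mulr_sumr; apply: eq_bigr => p _.
rewrite mulr_sumr mulr_sumr; apply: eq_bigr => p' _.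
by rewrite rmorphM /= conj_szego'; ring.
Qed.

(* With F the combination of Szego kernels given by r, B and G the dilates of b and c,
   and P the projection of conj(B) F on analytic functions, both sides_le are compared by taking
   the mean of |F|^2 (1 - |B|^2 - |G|^2) + |conj(B) F - P|^2 + |G F - T z^m|^2 >= 0. *)
Lemma kernel_contraction_dilated (s : R) m (r : seq (C * D)) : 0 <= s < 1 ->
  nc (backward_shift_sum s m r) ^+ 2 <= complex.Re (kernel_sum s r).
Proof.
move=> s01; have [s0 s1] := andP s01.
pose F := szego_comb fst r.
pose B z := fb (toC s * z); pose G z := fc (toC s * z).
(* The Toeplitz operator with symbol [conj(B)] multiplies the Szego kernel at [w] by the number
   [conj(B w)], which makes the projection explicit. *)
pose P := szego_comb (fun p => p.1 * (fb (toC s * sval p.2))^*) r.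
pose T := backward_shift_sum s m r.
have in_s z : nc z = 1 -> nc (toC s * z) <= s by move=> z1; rewrite ncM z1 mulr1 nc_real ger0_norm.
have bF : cbdd F by exact: cbdd_szego_comb.
have bP : cbdd P by exact: cbdd_szego_comb.
have bB : cbdd B by have [M hM] := ps_bounded hb s01; exists M => z /in_s /hM.
have bG : cbdd G by have [M hM] := ps_bounded hc s01; exists M => z /in_s /hM.
pose g := \sum_(p <- r) \sum_(p' <- r) p.1 * p'.1^* *
   (fb (toC s * sval p'.2) * (fb (toC s * sval p.2))^* * (1 - (sval p.2)^* * sval p'.2)^-1).
pose f := \sum_(p <- r) \sum_(p' <- r) p.1 * p'.1^* * (1 - (sval p.2)^* * sval p'.2)^-1.
have d1 (p : C * D) : nc (sval p.2) < 1 by case: (p.2).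
have two (p p' : C * D) : E (fun z => 1 * ((1 - (sval p.2)^* * z)^-1 * (1 - sval p'.2 * z^*)^-1)) =
    (1 - (sval p.2)^* * sval p'.2)^-1.
  rewrite -[RHS]mul1r -[in RHS](expr0 (sval p'.2)) -mean_two_szego //.
have E1 : E (fun z => F z * (F z)^*) = f.
  rewrite (@mean_ext R _ (fun z => 1 * (F z * (F z)^*))); last by move=> z _; rewrite mul1r.
  by rewrite (mean_szego_comb _ _ r (cbdd_cst 1) two).
have E3 : E (fun z => P z * (P z)^*) = g.
  rewrite (@mean_ext R _ (fun z => 1 * (P z * (P z)^*))); last by move=> z _; rewrite mul1r.
  rewrite (mean_szego_comb _ _ r (cbdd_cst 1) two); apply: eq_bigr => p _; apply: eq_bigr => p' _.
  by rewrite rmorphM /= conjCK; ring.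
have E2 : E (fun z => B z * (P z * (F z)^*)) = g.
  rewrite (mean_szego_comb (M := fun p p' => fb (toC s * sval p'.2) * (1 - (sval p.2)^* * sval p'.2)^-1)) //.
    by apply: eq_bigr => p _; apply: eq_bigr => p' _; ring.
  by move=> p p'; rewrite (mean_reproducing hb s01).
have E4 : E (fun z => G z * F z * z^* ^+ m) = T.
  rewrite (@mean_ext R _ (fun z => \sum_(p <- r) p.1 * (G z * ((1 - (sval p.2)^* * z)^-1 * z^* ^+ m)))).
    rewrite mean_sum.
      apply: eq_bigr => p _; rewrite meanZ ?(mean_coef_szego m hc s01) //.
      exact: cbddM bG (cbddM (cbdd_szego' (d1 p)) (@cbdd_conjX R m)).
    by move=> p; apply: cbddZ; exact: cbddM bG (cbddM (cbdd_szego' (d1 p)) (@cbdd_conjX R m)).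
  move=> z _; rewrite /F /szego_comb mulr_sumr mulr_suml; apply: eq_bigr => p _; ring.
pose Q z := B z * (P z * (F z)^*); pose S z := G z * F z * z^* ^+ m.
have bQ : cbdd Q by exact: cbddM bB (cbddM bP (cbdd_conj bF)).
have bS : cbdd S by exact: cbddM (cbddM bG bF) (@cbdd_conjX R m).
have bFF : cbdd (fun z => F z * (F z)^*) by exact: cbddM bF (cbdd_conj bF).
have bPP : cbdd (fun z => P z * (P z)^*) by exact: cbddM bP (cbdd_conj bP).
(* The expanded integrand: the terms [|B F|^2] and [|G F|^2] have cancelled, and only means known in
   closed form remain. *)
pose W z := F z * (F z)^* - (Q z + (Q z)^*) + P z * (P z)^* + (T * T^* - (T^* * S z + T * (S z)^*)).
have b1 : cbdd (fun z => Q z + (Q z)^*) by exact: cbddD bQ (cbdd_conj bQ).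
have b2 : cbdd (fun z => F z * (F z)^* - (Q z + (Q z)^*)) by exact: cbddB bFF b1.
have b3 : cbdd (fun z => F z * (F z)^* - (Q z + (Q z)^*) + P z * (P z)^*) by exact: cbddD b2 bPP.
have b4 : cbdd (fun z => T^* * S z + T * (S z)^*) by exact: cbddD (cbddZ _ bS) (cbddZ _ (cbdd_conj bS)).
have b5 : cbdd (fun z => T * T^* - (T^* * S z + T * (S z)^*)) by exact: cbddB (cbdd_cst _) b4.
(* The mean contains the conjugate of [g] where the kernel sum contains [g]; their real parts
   agree. *)
have EW : E W = f - g^* - T * T^*.
  rewrite (meanD b3 b5) (meanD b2 bPP) (meanB bFF b1) (meanD bQ (cbdd_conj bQ)) (meanB (cbdd_cst _) b4).
  rewrite (meanD (cbddZ _ bS) (cbddZ _ (cbdd_conj bS))) (meanZ _ bS) (meanZ _ (cbdd_conj bS)).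
  by rewrite (mean_conj bQ) (mean_conj bS) mean_cst E1 E2 E3 E4; ring.
have : 0 <= complex.Re (E W).
  apply: mean_Re_ge0; first exact: cbddD b3 b5.
  move=> z z1; pose u := z ^+ m.
  have uu : u * u^* = 1 by apply: circle_conj; rewrite ncX z1 expr1n.
  have -> : W z = toC (1 - nc (B z) ^+ 2 - nc (G z) ^+ 2) * (F z * (F z)^*)
     + ((B z)^* * F z - P z) * ((B z)^* * F z - P z)^*
     + (G z * F z - T * u) * (G z * F z - T * u)^*.
    have -> : toC (1 - nc (B z) ^+ 2 - nc (G z) ^+ 2) = 1 - B z * (B z)^* - G z * (G z)^*.
      by rewrite !rmorphB rmorph1 /= !nc_sqr.
    rewrite /W /Q /S -(rmorphXn Num.conj) -/u !rmorphB !rmorphM /= !conjCK.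
    have -> : T * T^* = T * T^* * (u * u^*) by rewrite uu mulr1.
    by ring.
  rewrite !ReD ReZ; apply: addr_ge0; [apply: addr_ge0|]; try exact: Re_mulC_ge0.
  rewrite mulr_ge0 ?Re_mulC_ge0 //; have := bc1 (le_lt_trans (in_s z z1) s1).
  rewrite /B /G; lra.
have KE : kernel_sum s r = f - g.
  rewrite /kernel_sum /f /g -sumrB; apply: eq_bigr => p _; rewrite -sumrB.
  by apply: eq_bigr => p' _; ring.
rewrite EW KE !ReD !ReN cRe_conj -nc_sqr /= -/T; lra.
Qed.

Lemma dilation_cconv : cconv (fun n => toC (1 - (n.+1)%:R^-1)) 1.
Proof.
apply/cconvP => e e0; exists (Num.bound e^-1) => n hn.
have -> : toC (1 - (n.+1)%:R^-1) - 1 = - toC (n.+1)%:R^-1 by rewrite rmorphB rmorph1; ring.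
rewrite ncN nc_real ger0_norm ?invr_ge0 // invf_plt ?posrE ?ltr0n //.
apply: lt_le_trans (archi_boundP _) _; first by rewrite invr_ge0 ltW.
by rewrite ler_nat (leq_trans hn).
Qed.

Lemma dilate_cconv (f : C -> C) w : holo f -> nc w < 1 ->
  cconv (fun n => f (toC (1 - (n.+1)%:R^-1) * w)) (f w).
Proof.
move=> hf w1; apply/cconvP => e e0; have [d d0 hd] := holo_cont hf w1 e0.
have /cconvP/(_ d d0)[N hN] := cconvZ w dilation_cconv.
exists N => n /hN; rewrite mulr1 mulrC => lt; apply: hd lt.
have n1 : (n.+1)%:R^-1 <= 1 :> R by rewrite invf_le1 ?ler1n ?ltr0n.
rewrite ncM nc_real ger0_norm ?subr_ge0 //.
by apply: le_lt_trans w1; rewrite ler_piMl ?nc_ge0 // gerBl invr_ge0.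
Qed.

(** The dilation factor tends to 1 in finite sums: the left one is polynomial in it, and the right
    one depends on it through values of [b], which is continuous. *)
Lemma kernel_contraction m (r : seq (C * D)) : holo fb ->
  nc (backward_shift_sum 1 m r) ^+ 2 <= complex.Re (kernel_sum 1 r).
Proof.
move=> hol; pose s n : R := 1 - (n.+1)%:R^-1.
have s01 n : 0 <= s n < 1.
  by rewrite /s subr_ge0 invf_le1 ?ler1n ?ltr0n //= ltrBlDr ltrDl invr_gt0 ltr0n.
have d1 (p : C * D) : nc (sval p.2) < 1 by case: (p.2).
have hT : cconv (fun n => backward_shift_sum (s n) m r) (backward_shift_sum 1 m r).
  apply: cconv_sum => p; apply: cconvZ; apply: cconv_sum => k.
  apply: cconvM (cconv_cst _); apply: cconvZ; apply: cconvX.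
  by rewrite rmorph1; exact: dilation_cconv.
have hK : cconv (fun n => kernel_sum (s n) r) (kernel_sum 1 r).
  apply: cconv_sum => p; apply: cconv_sum => p'; apply: cconvZ; apply: cconvM (cconv_cst _).
  rewrite rmorph1 !mul1r -mulN1r; apply: cconvD (cconv_cst _) _.
  have h := cconvM (dilate_cconv hol (d1 p')) (cconv_conj (dilate_cconv hol (d1 p))).
  by apply: cconv_ext (cconvZ (-1) h) => n; rewrite mulN1r.
have h := cconvD hK (cconvZ (-1) (cconvM hT (cconv_conj hT))).
have : 0 <= complex.Re (kernel_sum 1 r + -1 * (backward_shift_sum 1 m r * (backward_shift_sum 1 m r)^*)).
  apply: cconv_Re_ge0 h => n; rewrite mulN1r ReD ReN -nc_sqr /= subr_ge0.
  exact: kernel_contraction_dilated.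
by rewrite mulN1r ReD ReN -nc_sqr /= subr_ge0.
Qed.

End Contraction.
End KernelInequality.

(** * Growth of monomials *)

Section Main.
Variable R : realType.
Local Notation C := R[i].
Local Notation D := (disk R).
Local Notation nc := (@Defs.normc R).
Local Notation toC := (real_complex R).
Local Notation E := (@circle_mean R).

Lemma nc_parallelogram (x y : C) : nc (x + y) ^+ 2 + nc (x - y) ^+ 2 = 2 * (nc x ^+ 2 + nc y ^+ 2).
Proof. by rewrite !nc_sqrE !ReD !ImD ReN ImN; ring. Qed.

(** With [b] the midpoint of [b1] and [b2], let [c] be half their difference. Then [b + c] and
    [b - c] are in the unit ball, and the parallelogram law gives the bound. Some coefficient of [c]
    is nonzero because [b1] and [b2] differ. *)
Lemma non_extreme_complement (b : D -> C) : non_extreme b ->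
  exists beta c gamma k, [/\ power_series_rep b beta, power_series_rep c gamma,
    gamma k != 0 & forall z, nc (b z) ^+ 2 + nc (c z) ^+ 2 <= 1].
Proof.
move=> [hb [b1 [b2 [h1 h2 neq bE]]]].
have [beta hbeta] := Hinf_power_series hb; have [a1 ha1] := Hinf_power_series h1;
  have [a2 ha2] := Hinf_power_series h2.
pose c z := (b1 z - b2 z) / 2; pose gamma k := (a1 k - a2 k) / 2.
have hc : power_series_rep c gamma.
  move=> z; have := cconvZ 2^-1 (cconvD (ha1 z) (cconvZ (-1) (ha2 z))).
  rewrite /c mulN1r mulrC; apply: cconv_ext => n.
  rewrite mulN1r -sumrB mulr_sumr; apply: eq_bigr => k _; rewrite /gamma; ring.
have [k hk] : exists k, gamma k != 0.
  apply: contrapT => no; apply: neq; apply/funext => z.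
  have c0 : c z = 0.
    apply: cconv_unique (hc z) _; apply: cconv_ext (cconv_cst 0) => n.
    rewrite big1 // => k _; suff -> : gamma k = 0 by rewrite mul0r.
    by apply/eqP; apply: contrapT => hk; apply: no; exists k; exact/negP.
  have : b1 z - b2 z = c z * 2 by rewrite /c divfK // pnatr_eq0.
  by rewrite c0 mul0r => /eqP; rewrite subr_eq0 => /eqP.
exists beta, c, gamma, k; split=> // z.
have := nc_parallelogram (b z) (c z).
have -> : b z + c z = b1 z by rewrite bE /c; field.
have -> : b z - c z = b2 z by rewrite bE /c; field.
have u (f : D -> C) : Hinf_ball f -> nc (f z) ^+ 2 <= 1.
  by move=> [_ h]; rewrite exprn_ile1 ?nc_ge0.
have := u _ h1; have := u _ h2; lra.
Qed.

Section Space.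
Variables (b : D -> C) (H : (D -> C) -> Prop) (ip : (D -> C) -> (D -> C) -> C).
Hypothesis HK : is_RKHS (dBR_kernel b) H ip.
Hypothesis hbl : Hinf_ball b.
Local Notation nrm := (hnorm ip).

(** * Polynomials in the space *)

Section Polynomials.
Variables (beta gamma : nat -> C) (c : D -> C).
Hypothesis hb : power_series_rep b beta.
Hypothesis hc : power_series_rep c gamma.
Hypothesis bc1 : forall z, nc (b z) ^+ 2 + nc (c z) ^+ 2 <= 1.

(* the Toeplitz operator with symbol conj(c) applied to z^m *)
Definition toeplitz_monomial (m : nat) (z : D) : C :=
  \sum_(k < m.+1) (gamma k)^* * sval z ^+ (m - k).

(** The kernel inequality, read through the membership criterion with constant 1; its right-hand
    side is the squared norm of the kernel combination. *)
Lemma toeplitz_member m : H (toeplitz_monomial m) /\ nrm (toeplitz_monomial m) <= 1.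
Proof.
apply: (rkhs_member HK) => // r; rewrite mul1r.
pose v z := \sum_(p <- r) p.1 * dBR_kernel b z p.2; rewrite -/v; set L := \sum_(p <- r) _.
have LE : L = backward_shift_sum gamma 1 m r.
  apply: eq_bigr => p _; rewrite /toeplitz_monomial rmorph_sum /=; congr (_ * _).
  by apply: eq_bigr => k _; rewrite rmorphM rmorphXn /= conjCK rmorph1 expr1n mulr1.
have Hv : H v by exact: H_kernel_comb HK r.
have vE : complex.Re (kernel_sum (disk_ext b) 1 r) = nrm v ^+ 2.
  rewrite (nrm_sqE HK) //; congr complex.Re.
  rewrite {1}/v (ip_sum HK) //; last by move=> p; apply: (H_Z HK); exact: H_K HK _.
  apply: eq_bigr => p _; rewrite (ip_Z HK) //; last exact: H_K HK _.
  rewrite (ip_sym HK Hv (H_K HK _)) (ip_K HK) // /v rmorph_sum mulr_sumr /=.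
  apply: eq_bigr => p' _; rewrite rmorph1 !mul1r !disk_ext_sval rmorphM /= -[LHS]mulrA; congr (_ * (_ * _)).
  by rewrite /dBR_kernel rmorphM fmorphV !rmorphB !rmorphM /= !conjCK rmorph1 (mulrC (b p'.2)).
rewrite -ler_sqr ?nnegrE ?nc_ge0 ?nrm_ge0 // -vE LE.
have hb' : ps_rep 1 (disk_ext b) beta by apply/ps_rep_ext.
have hc' : ps_rep 1 (disk_ext c) gamma by apply/ps_rep_ext.
have bc1' z : nc z < 1 -> nc (disk_ext b z) ^+ 2 + nc (disk_ext c z) ^+ 2 <= 1.
  by move=> z1; rewrite !(disk_ext_in _ z1).
exact: (kernel_contraction hb' hc' bc1' m r (holo_ext (proj1 hbl))).
Qed.

Section Lowest.
Variable k : nat.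
Hypothesis gk : gamma k != 0.
Hypothesis lowest : forall j, (j < k)%N -> gamma j = 0.

Lemma toeplitz_expand n z :
  toeplitz_monomial (k + n) z = \sum_(i < n.+1) (gamma (k + i))^* * sval z ^+ (n - i).
Proof.
rewrite /toeplitz_monomial -addnS big_split_ord /= big1 ?add0r => [|i _].
  by apply: eq_bigr => i _; rewrite subnDl.
by rewrite lowest // conjC0 mul0r.
Qed.

(** The functions [toeplitz_monomial (k + n)] form a triangular system in the monomials, with
    constant diagonal [conj(gamma k)]; it is solved by strong induction. *)
Lemma monomial_member n : H (dbr_monomial n).
Proof.
elim/ltn_ind: n => n IH.
have g0 : (gamma k)^* != 0 by rewrite conjC_eq0.
have [Ht _] := toeplitz_member (k + n).
pose low z : C := \sum_(i < n) (gamma (k + i.+1))^* * dbr_monomial (n - i.+1) z.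
have Hlow : H low.
  apply: (H_sum HK) => i; apply: (H_Z HK); apply: IH.
  by rewrite ltn_subrL /= (leq_ltn_trans _ (ltn_ord i)).
have := H_Z HK ((gamma k)^*)^-1 (H_B HK Ht Hlow); congr H; apply/funext => z.
rewrite toeplitz_expand big_ord_recl /= addn0 subn0 /low addrAC.
have -> : \sum_(i < n) (gamma (k + bump 0 i))^* * sval z ^+ (n - bump 0 i) =
  \sum_(i < n) (gamma (k + i.+1))^* * dbr_monomial (n - i.+1) z by [].
by rewrite subrK mulKf.
Qed.

End Lowest.
End Polynomials.

Lemma taylor_rep (f : D -> C) : (exists a, power_series_rep f a) -> power_series_rep f (taylor_coef f).
Proof. by move=> h; rewrite /taylor_coef; case: pselect => // P; exact: projT2 (cid P). Qed.

Lemma half_neq0 : toC (1 / 2) != 0.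
Proof. by rewrite fmorph_eq0 gt_eqF // divr_gt0. Qed.

Lemma taylor_mean (f : D -> C) a j : power_series_rep f a ->
  a j = E (fun z => disk_ext f (toC (1 / 2) * z) * z^* ^+ j) / toC (1 / 2) ^+ j.
Proof.
move=> /ps_rep_ext h; rewrite (ps_coef j h); last by apply/andP; split; lra.
by rewrite mulfK // expf_neq0 // half_neq0.
Qed.

Lemma taylorE (f : D -> C) a j : power_series_rep f a -> taylor_coef f j = a j.
Proof.
move=> h; have h' : power_series_rep f (taylor_coef f) by apply: taylor_rep; exists a.
by rewrite (taylor_mean j h) (taylor_mean j h').
Qed.

Lemma poly_rep n (a : nat -> C) :
  power_series_rep (fun z => \sum_(j < n.+1) a j * sval z ^+ j) (fun j => if (j <= n)%N then a j else 0).
Proof.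
move=> z; apply: (@cconv_const_tail _ _ _ n.+1) => N /subnKC <-.
rewrite big_split_ord /= [X in _ + X]big1 ?addr0 => [|i _].
  by apply: eq_bigr => i _; rewrite -ltnS ltn_ord.
by rewrite leqNgt addSn ltnS leq_addr mul0r.
Qed.

Lemma nrm_K_half (w : D) : nc (sval w) = 1 / 2 -> nrm (dBR_kernel b ^~ w) <= 2.
Proof.
move=> w2; rewrite -ler_sqr ?nnegrE ?nrm_ge0 // (nrm_K HK).
have -> : dBR_kernel b w w = toC ((1 - nc (b w) ^+ 2) / (1 - (1 / 2) ^+ 2)).
  by rewrite rmorphM fmorphV !rmorphB /= rmorph1 -w2 !nc_sqr.
have := sqr_ge0 (nc (b w)) => /=.
by rewrite ler_pdivrMr; lra.
Qed.

Lemma taylor_bound j : exists B, forall f, H f -> (exists a, power_series_rep f a) ->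
  nc (taylor_coef f j) <= B * nrm f.
Proof.
(* The first 2 bounds the kernel norms on the circle of radius 1/2, and [2 ^+ j] is the factor of
   Cauchy's estimate there. *)
exists (2 * 2 ^+ j) => f hf hps.
rewrite (taylor_mean j (taylor_rep hps)) ncM ncV ncX nc_real ger0_norm; last by lra.
have -> : ((1 / 2) ^+ j)^-1 = 2 ^+ j :> R by rewrite div1r exprVn invrK.
rewrite mulrAC ler_pM2r ?exprn_gt0 //.
apply: mean_bound => z z1; rewrite ncM ncX nc_conj z1 expr1n mulr1.
have z2 : nc (toC (1 / 2) * z) = 1 / 2 by rewrite ncM z1 mulr1 nc_real ger0_norm //; lra.
have z3 : nc (toC (1 / 2) * z) < 1 by rewrite z2; lra.
rewrite (disk_ext_in f z3); apply: le_trans (eval_bound HK _ hf) _.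
by rewrite mulrC ler_wpM2r ?nrm_ge0 //; exact: nrm_K_half.
Qed.

(** * Bounds on the Cesaro means and their inversion *)

Section Cesaro.
Variable alpha : R.
Hypothesis alpha0 : 0 <= alpha.
Hypothesis mono : forall j, H (dbr_monomial j).
Hypothesis weak : forall h, H h -> forall g, H g ->
  cconv (fun n => ip (dbr_sigma alpha n h) g) (ip h g).
Local Notation A := (cesaro_A alpha).
Local Notation d := (cesaro_d alpha).

Lemma sigmaE n h : dbr_sigma alpha n h = fun z =>
  \sum_(j < n.+1) toC (A (n - j) / A n) * taylor_coef h j * dbr_monomial j z.
Proof.
apply/funext => z; apply: eq_bigr => j _; congr (toC _ * _ * _).
by apply: cesaro_weight => //; rewrite -ltnS.
Qed.

Lemma H_sigma n h : H (dbr_sigma alpha n h).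
Proof. by rewrite sigmaE; apply: (H_sum HK) => j; exact: (H_Z HK). Qed.

(* without a power series h would have vanishing means by the convention on taylor_coef,
   contradicting the convergence hypothesis *)
Lemma H_power_series h : H h -> exists a, power_series_rep h a.
Proof.
move=> hh; have [//|no] := pselect (exists a, power_series_rep h a).
have s0 n : dbr_sigma alpha n h = fun=> 0.
  rewrite sigmaE; apply/funext => z; rewrite big1 // => j _.
  by rewrite /taylor_coef; case: pselect => // _; rewrite mulr0 mul0r.
have h0 : ip h h = 0.
  apply: cconv_unique (weak hh hh) _; apply: cconv_ext (cconv_cst 0) => n.
  by rewrite s0 (ip0l HK).
exfalso; apply: no; rewrite (ip_eq0 HK hh h0); exists (fun=> 0) => z.
by apply: cconv_ext (cconv_cst 0) => n; rewrite big1 // => j _; rewrite mul0r.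
Qed.

Lemma taylor_H h : H h -> power_series_rep h (taylor_coef h).
Proof. by move=> /H_power_series; exact: taylor_rep. Qed.

Lemma taylor_lin a f g j : H f -> H g ->
  taylor_coef (fun z => a * f z + g z) j = a * taylor_coef f j + taylor_coef g j.
Proof.
move=> hf hg; apply: (taylorE (a := fun j => a * taylor_coef f j + taylor_coef g j)) => z.
have := cconvD (cconvZ a (taylor_H hf z)) (taylor_H hg z); apply: cconv_ext => n.
by rewrite mulr_sumr -big_split /=; apply: eq_bigr => i _; ring.
Qed.

(** Uniform boundedness for the functionals [f |-> nc (ip (dbr_sigma alpha n h) f)], which weak
    convergence bounds pointwise; testing the [n]-th one at the mean itself yields its norm. *)
Lemma sigma_bounded h : H h -> exists B, forall n, nrm (dbr_sigma alpha n h) <= B.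
Proof.
move=> hh; pose p n g := nc (ip (dbr_sigma alpha n h) g).
have [||||B hB] := @uniform_boundedness _ _ _ _ HK p.
- move=> n f g hf hg; rewrite /p; have := ip_linr HK 1 hf hg (H_sigma n h).
  rewrite conjC1 mul1r (_ : (fun z => 1 * f z + g z) = (fun z => f z + g z)); last first.
    by apply/funext => z; rewrite mul1r.
  by move=> ->; exact: ncD.
- move=> n a f hf; rewrite /p (ip_sym HK (H_Z HK a hf) (H_sigma n h)) (ip_Z HK) //.
    by rewrite nc_conj ncM (ip_sym HK (H_sigma n h) hf) nc_conj.
  exact: H_sigma.
- move=> n; exists (nrm (dbr_sigma alpha n h)) => f hf.
  exact: (cauchy_schwarz HK (H_sigma n h) hf).
- by move=> f hf; exact: cconv_bounded (weak hh hf).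
exists `|B| => n; set s := dbr_sigma alpha n h.
have [->|s0] := eqVneq (nrm s) 0; first exact: normr_ge0.
have sp : 0 < nrm s by rewrite lt_def s0 nrm_ge0.
have := hB n s (H_sigma n h); rewrite /p -/s (ip_nrm HK) ?nc_real; last exact: H_sigma.
rewrite ger0_norm ?sqr_ge0 // expr2 ler_pM2r // => le.
by apply: le_trans le (ler_norm _).
Qed.

(** [A m] times the [m]-th mean is the convolution of [A] with the Taylor terms. Convolving with [d]
    leaves the last term, since the convolution of [d] and [A] is 1 at index 0 and 0 elsewhere. *)
Lemma taylor_term_sigma n h z : taylor_coef h n * dbr_monomial n z =
  \sum_(i < n.+1) toC (d i * A (n - i)) * dbr_sigma alpha (n - i) h z.
Proof.
pose t (i j : nat) := toC (d i * A (n - j - i)) * (taylor_coef h j * dbr_monomial j z).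
have -> : \sum_(i < n.+1) toC (d i * A (n - i)) * dbr_sigma alpha (n - i) h z =
  \sum_(i < n.+1) \sum_(j < n.+1) if (i + j <= n)%N then t i j else 0.
  apply: eq_bigr => i _; rewrite sigmaE mulr_sumr.
  have le : ((n - i).+1 <= n.+1)%N by rewrite ltnS leq_subr.
  rewrite (big_ord_widen n.+1 (fun j => toC (d i * A (n - i)) *
     (toC (A (n - i - j) / A (n - i)) * taylor_coef h j * dbr_monomial j z)) le) big_mkcond /=.
  apply: eq_bigr => j _; rewrite ltnS leq_subRL; last by rewrite -ltnS.
  case: ifP => // _; rewrite /t (subnAC n j i) -mulrA mulrA -rmorphM /=.
  congr (toC _ * _); have : A (n - i) != 0 by rewrite gt_eqF ?cesaro_A_gt0.
  by move=> a0; field.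
rewrite exchange_big /= (bigD1 ord_max) //= [X in _ + X]big1 ?addr0.
  rewrite (bigD1 ord0) //= add0n leqnn big1 ?addr0.
    rewrite /t subnn /cesaro_d /cesaro_A !big_ord0 mulr1 rmorph1.
    by rewrite mul1r.
  by case=> -[|i] hi // _; rewrite /= addSn ltnNge leq_addl.
move=> j jn; have jlt : (j < n)%N.
  by rewrite ltn_neqAle -ltnS ltn_ord andbT.
rewrite -big_mkcond /= (eq_bigl (fun i : 'I_n.+1 => (i < (n - j).+1)%N)); last first.
  by move=> i; rewrite ltnS leq_subRL 1?addnC // ltnW.
have le : ((n - j).+1 <= n.+1)%N by rewrite ltnS leq_subr.
rewrite -(big_ord_widen n.+1 (fun i => t i j) le).
rewrite /t -mulr_suml -(rmorph_sum (real_complex R)) /=.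
have := cesaro_convS alpha (n - j).-1; rewrite prednK ?subn_gt0 // /cesaro_conv => ->.
by rewrite rmorph0 mul0r.
Qed.

(** [A] is monotone and [d] is absolutely summable, so the inversion costs only [A n] and the sum of
    the [|d i|]. *)
Lemma taylor_term_bounded h : H h ->
  exists B, forall n, nc (taylor_coef h n) * nrm (dbr_monomial n) / A n <= B.
Proof.
move=> hh; have [B hB] := sigma_bounded hh; have [S hS] := @cesaro_d_summable R alpha alpha0.
exists (S * `|B|) => n; rewrite ler_pdivrMr ?cesaro_A_gt0 // -(nrm_Z HK) //.
have -> : (fun z => taylor_coef h n * dbr_monomial n z) = (fun z =>
  \sum_(i < n.+1) toC (d i * A (n - i)) * dbr_sigma alpha (n - i) h z).
  by apply/funext => z; exact: taylor_term_sigma.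
apply: le_trans (nrm_sum HK (F := fun (i : 'I_n.+1) z => _) _ _) _.
  by move=> i; apply: (H_Z HK); exact: H_sigma.
apply: (@le_trans _ _ (\sum_(i < n.+1) `|d i| * (A n * `|B|))).
  apply: ler_sum => i _; rewrite (nrm_Z HK); last exact: H_sigma.
  rewrite nc_real normrM -mulrA ler_wpM2l // ger0_norm ?(ltW (cesaro_A_gt0 _ _)) //.
  apply: ler_pM; rewrite ?nrm_ge0 ?(ltW (cesaro_A_gt0 _ _)) //.
    by apply: cesaro_A_mono; rewrite ?leq_subr.
  exact: le_trans (hB _) (ler_norm _).
rewrite -mulr_suml mulrAC -mulrA (mulrC (A n)) ler_wpM2r //.
by rewrite mulr_ge0 // ltW ?cesaro_A_gt0.
Qed.

Lemma taylor_Z a f j : H f -> taylor_coef (fun z => a * f z) j = a * taylor_coef f j.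
Proof.
move=> hf; apply: (taylorE (a := fun j => a * taylor_coef f j)) => z.
apply: cconv_ext (cconvZ a (taylor_H hf z)) => n.
by rewrite mulr_sumr; apply: eq_bigr => i _; rewrite mulrA.
Qed.

(** The seminorms [p n] are bounded at each [h] by the inversion, hence uniformly on the unit ball.
    At the test function [q n], whose [n]-th coefficient is the same for all [n], only the norm of
    the monomial is left to be bounded. *)
Lemma monomial_growth (c0 : C) (q : nat -> D -> C) : (forall n, H (q n)) -> (forall n, nrm (q n) <= 1) ->
  c0 != 0 -> (forall n, taylor_coef (q n) n = c0) ->
  exists M, forall n, (0 < n)%N -> nrm (dbr_monomial n) <= M * (n%:R `^ alpha).
Proof.
move=> hq q1 c00 qc; pose p n h := nc (taylor_coef h n) * nrm (dbr_monomial n) / A n.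
have pA n : 0 < A n by exact: cesaro_A_gt0.
have w0 n : 0 <= nrm (dbr_monomial n) / A n by rewrite divr_ge0 ?nrm_ge0 // ltW.
have [||||B hB] := @uniform_boundedness _ _ _ _ HK p.
- move=> n f g hf hg; rewrite /p -!mulrA -mulrDl ler_wpM2r //.
  have := taylor_lin 1 n hf hg; rewrite mul1r.
  rewrite (_ : (fun z => 1 * f z + g z) = (fun z => f z + g z)); last first.
    by apply/funext => z; rewrite mul1r.
  by move=> ->; exact: ncD.
- by move=> n a f hf; rewrite /p taylor_Z // ncM !mulrA.
- move=> n; have [B hB] := taylor_bound n; exists (B * (nrm (dbr_monomial n) / A n)) => f hf.
  by rewrite /p -mulrA mulrAC ler_wpM2r // hB //; exact: H_power_series.
- by move=> f hf; exact: taylor_term_bounded.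
have cp := nc_gt0 c00.
exists (`|B| / nc c0 * expR alpha) => n n0.
have le : nrm (dbr_monomial n) <= `|B| / nc c0 * A n.
  have := hB n (q n) (hq n); rewrite /p qc ler_pdivrMr // => le.
  rewrite mulrAC ler_pdivlMr // mulrC; apply: le_trans le _.
  rewrite ler_wpM2r ?(ltW (pA n)) //; apply: le_trans (ler_norm _) _.
  by rewrite normrM (ger0_norm (nrm_ge0 _ _)) ler_piMr.
apply: le_trans le _; rewrite -[leRHS]mulrA ler_wpM2l ?divr_ge0 ?nc_ge0 //.
exact: cesaro_A_growth.
Qed.

End Cesaro.

End Space.
End Main.

(** Weak convergence follows from norm convergence by Cauchy-Schwarz, so both forms of the
    hypothesis are covered. Membership of the monomials belongs to the conclusion because [hnorm]
    carries no meaning outside [H]. *)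
Theorem theorem6p10 (R : realType) (b : disk R -> R[i])
    (H : (disk R -> R[i]) -> Prop) (ip : (disk R -> R[i]) -> (disk R -> R[i]) -> R[i])
    (alpha : R) :
  non_extreme b ->
  is_RKHS (dBR_kernel b) H ip ->
  0 <= alpha ->
  (forall h, H h -> forall g, H g ->
     cconv (fun n => ip (dbr_sigma alpha n h) g) (ip h g)) ->
  (forall j, H (dbr_monomial j)) /\
  exists (M : R) (N : nat), forall j : nat, (N <= j)%N ->
    hnorm ip (dbr_monomial j) <= M * (j%:R `^ alpha).
Proof.
move=> ne HK alpha0 weak; have hbl := proj1 ne.
have [beta [c [gamma [k0 [hb hc gk0 bc1]]]]] := non_extreme_complement ne.
have ex : exists k, gamma k != 0 by exists k0.
(* Minimality of [k] makes [toeplitz_monomial gamma (k + n)] a polynomial of degree exactly [n]. *)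
pose k := ex_minn ex.
have [gk lowest] : gamma k != 0 /\ forall j, (j < k)%N -> gamma j = 0.
  rewrite /k; case: ex_minnP => m gm hm; split=> // j jm.
  by apply/eqP; apply: contraTT jm => /hm; rewrite -leqNgt.
have mono := monomial_member HK hbl hb hc bc1 gk lowest.
split=> //.
pose q n := toeplitz_monomial gamma (k + n).
have [||||M hM] := @monomial_growth _ _ _ _ HK alpha alpha0 mono weak (gamma k)^* q.
- by move=> n; case: (toeplitz_member HK hbl hb hc bc1 (k + n)).
- by move=> n; case: (toeplitz_member HK hbl hb hc bc1 (k + n)).
- by rewrite conjC_eq0.
- move=> n; pose a (j : nat) := (gamma (k + (n - j))%N)^*.
  have qE : q n = fun z => \sum_(j < n.+1) a j * sval z ^+ j.
    apply/funext => z; rewrite /q (toeplitz_expand lowest) (reindex_inj rev_ord_inj) /=.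
    apply: eq_bigr => i _; rewrite /a subSS subKn // -ltnS; exact: ltn_ord.
  by rewrite qE (taylorE n (poly_rep n a)) leqnn /a subnn addn0.
(* The bound starts at 1 because [monomial_growth] concerns positive indices. *)
by exists M, 1%N.
Qed.
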